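(* Let $\alpha>-1/2$ and $\alpha\ge\beta>-1$, and let $p=\frac{4(\alpha+1)}{2\alpha+1}$ or $p=\frac{4(\alpha+1)}{2\alpha+3}$. Then there is no constant $C$ such that $\Vert S_nf\Vert_{L^{p,\infty}(d\nu)}\le C\Vert f\Vert_{L^p(d\nu)}$ for every $n\ge0$ and every $f\in L^p(d\nu)$.
   Context: $d\nu=(1-x)^\alpha(1+x)^\beta dx+\sum_{i=1}^kM_i\delta_{a_i}$ on $[-1,1]$, with $a_1,\dots,a_k\in[-1,1]$ distinct and $M_i>0$. $(P_n)$ are the orthonormal polynomials for $\nu$ (positive leading coefficients), $L_n(x,y)=\sum_{j=0}^nP_j(x)P_j(y)$, $S_nf(x)=\int L_n(x,y)f(y)\,d\nu(y)$. $L^{p,\infty}(d\nu)$ is the weak $L^p$ space with quasinorm $\sup_{t>0}t^{1/p}f^*(t)$, $f^*$ the nonincreasing rearrangement of $f$ with respect to $\nu$. *)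

(* Defs.v *)
From HB Require Import structures.
From mathcomp Require Import all_boot all_order all_algebra.
From mathcomp Require Import all_classical all_reals all_analysis.
Set Implicit Arguments. Unset Strict Implicit. Unset Printing Implicit Defensive.
Import Order.TTheory GRing.Theory Num.Theory.
Local Open Scope classical_set_scope.
Local Open Scope ring_scope.

Section JacobiMeasure.
Context {R : realType}.

Definition jweight (alpha beta : R) (x : R) : R :=
  ((1 - x) `^ alpha) * ((1 + x) `^ beta).

(* Integral of g against
   d nu = (1-x)^alpha (1+x)^beta dx on [-1,1] + sum_i M_i delta_{a_i}. *)
Definition nu_int (alpha beta : R) (k : nat) (a M : 'I_k -> R)
    (g : R -> R) : \bar R :=
  (\int[lebesgue_measure]_(x in `[(-1)%R, 1%R]) (g x * jweight alpha beta x)%:E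
   + \sum_(i < k) (M i * g (a i))%:E)%E.

Definition nu_meas (alpha beta : R) (k : nat) (a M : 'I_k -> R)
    (A : set R) : \bar R :=
  nu_int alpha beta a M (\1_A).

Definition Lp_norm (alpha beta : R) (k : nat) (a M : 'I_k -> R)
    (p : R) (f : R -> R) : \bar R :=
  (nu_int alpha beta a M (fun x => `|f x| `^ p)) `^ p^-1.

Definition in_Lp (alpha beta : R) (k : nat) (a M : 'I_k -> R)
    (p : R) (f : R -> R) : Prop :=
  measurable_fun (`[(-1)%R, 1%R] : set R) f /\
  (nu_int alpha beta a M (fun x => (`|f x| `^ p)%R) < +oo)%E.

Definition distrib (alpha beta : R) (k : nat) (a M : 'I_k -> R)
    (f : R -> R) (s : R) : \bar R :=
  nu_meas alpha beta a M [set x | s < `|f x|].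

Definition rearr (alpha beta : R) (k : nat) (a M : 'I_k -> R)
    (f : R -> R) (t : R) : \bar R :=
  ereal_inf [set s%:E | s in [set s : R | 0 <= s /\
     (distrib alpha beta a M f s <= t%:E)%E]].

Definition weak_Lp_norm (alpha beta : R) (k : nat) (a M : 'I_k -> R)
    (p : R) (f : R -> R) : \bar R :=
  ereal_sup [set ((t `^ p^-1)%:E * rearr alpha beta a M f t)%E
             | t in [set t : R | 0 < t]].

Definition orthonormal_family (alpha beta : R) (k : nat) (a M : 'I_k -> R)
    (P : nat -> {poly R}) : Prop :=
  (forall n, size (P n) = n.+1) /\
  (forall n, 0 < lead_coef (P n)) /\
  (forall j l, nu_int alpha beta a M (fun x => (P j).[x] * (P l).[x])
               = ((j == l)%:R)%:E).

Definition CD_kernel (P : nat -> {poly R}) (n : nat) (x y : R) : R :=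
  \sum_(j < n.+1) (P j).[x] * (P j).[y].

Definition Sn (alpha beta : R) (k : nat) (a M : 'I_k -> R)
    (P : nat -> {poly R}) (n : nat) (f : R -> R) (x : R) : R :=
  fine (nu_int alpha beta a M (fun y => CD_kernel P n x y * f y)).

End JacobiMeasure.

(* Main.v *)
(** Put s = alpha + 1/2 and t = beta + 1/2. In the variable x = cos y the weight becomes
    W(y) = (2 - 2 cos y)^s (2 + 2 cos y)^t, up to a constant. Choose real polynomials q with
    q(0) = 1 that vanish at exp(i acos a_j) for every mass point a_j and for which |q|^2 W is
    bounded and tends to 1. Put R_n(x) = Re(z^n conj(q(z))), where |z| = 1 and Re z = x.
    Pairing P_n with R_n only sees the leading coefficient of P_n. Together with a lower bound
    for 2^n / lead(P_n), obtained by pairing P_n with Re(z^n r(z)) for polynomials r such that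
    |r|^2 / W tends to 1, this shows that P_n is close to a constant multiple of R_n in L^2(nu).

    A weak-type bound implies |int (S_n f) g dnu| <= K ||f||_p G nu(B)^(1 - 1/p) whenever
    |g| <= G 1_B. For the lower exponent, test S_n - S_(n-1) = <., P_n> P_n with g = R_n on a
    fixed interval and f = ((1 + x)/(1 - x))^(1/2) R_n on [c, 1 - 2 d]: the pairing is of
    order L = log((1 - c)/(2 d)), while ||f||_p is at most of order L^(1/p). For the upper
    exponent g is R_n on [1 - 2 d, 1 - d], and S_n - S_(n-1) is replaced by the commutator of
    S_n with multiplication by x, which has rank two. There f is built from the harmonic
    conjugate of R_n, so that <f, P_n> tends to 0 and one of the two terms drops out. In both
    cases L <= K L^(1/p) for all large L, which is absurd because p > 1. *)

Require Import Defs.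
From HB Require Import structures.
From mathcomp Require Import all_boot all_order all_algebra.
From mathcomp Require Import all_classical all_reals all_analysis.
From mathcomp Require Import measurable_realfun.
From mathcomp Require Import ring lra.
Set Implicit Arguments. Unset Strict Implicit. Unset Printing Implicit Defensive.
Import Order.TTheory GRing.Theory Num.Theory.
Import numFieldNormedType.Exports.
Local Open Scope classical_set_scope.
Local Open Scope ring_scope.
(* Imported last, so that [Re] and [Im] are those of [R[i]]. *)
From mathcomp Require Import complex.

(** * Positive functionals on bounded measurable functions *)

(** No pointwise asymptotics of [P n] enter. The test functions are built from the explicit R_n,
    which satisfy |R_n| <= const W^(-1/2) pointwise, and [P n] occurs only in inner products with
    them, where closeness in L^2(nu) suffices. Since q vanishes at the mass points, the masses do
    not contribute to the norm of R_n.

    The limit |q|^2 W -> 1 is reached only along a sequence q_j, and R_n needs n at least the degree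
    of q_j. So j is fixed before n tends to infinity, and all limits are iterated.

    At the upper exponent a function of the critical size W^(-1/2) has a bounded pairing with [P n],
    so a rank-one difference yields no logarithm. The commutator, taken with 1 - x instead of x,
    lets f be larger by a factor 1/(1 - x): in one term that factor is removed from f, in the other
    it is compensated by the smallness of 1 - x on the support of g. Without the harmonic conjugate
    the two products of coefficients in the commutator might nearly cancel. *)

Section BoundedMeasurable.
Context {R : realType}.
Implicit Types (D : set R) (f g : R -> R).

(** Measurability is global, so that composition and products need no side conditions. Boundedness
    is local, because polynomials are bounded on compact intervals only and the weights only away
    from the endpoints. *)
Definition bmeas D f :=
  measurable_fun setT f /\ exists M, forall x, D x -> `|f x| <= M.

Lemma bmeasS D D' f : D' `<=` D -> bmeas D f -> bmeas D' f.
Proof. by move=> sD [mf [M fM]]; split=> //; exists M => x /sD /fM. Qed.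

Lemma bmeas_cst D c : bmeas D (fun=> c).
Proof. by split=> //; exists `|c|. Qed.

Lemma bmeasD D f g : bmeas D f -> bmeas D g -> bmeas D (fun x => f x + g x).
Proof.
move=> [mf [M fM]] [mg [M' gM]]; split; first exact: measurable_funD.
by exists (M + M') => x Dx; rewrite (le_trans (ler_normD _ _))// lerD ?fM ?gM.
Qed.

Lemma bmeasM D f g : bmeas D f -> bmeas D g -> bmeas D (fun x => f x * g x).
Proof.
move=> [mf [M fM]] [mg [M' gM]]; split; first exact: measurable_funM.
by exists (M * M') => x Dx; rewrite normrM ler_pM ?fM ?gM.
Qed.

Lemma bmeasZ D c f : bmeas D f -> bmeas D (fun x => c * f x).
Proof. exact/bmeasM/bmeas_cst. Qed.

Lemma bmeasN D f : bmeas D f -> bmeas D (fun x => - f x).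
Proof.
move=> [mf [M fM]]; split; first exact: measurableT_comp.
by exists M => x Dx; rewrite normrN fM.
Qed.

Lemma bmeasB D f g : bmeas D f -> bmeas D g -> bmeas D (fun x => f x - g x).
Proof. by move=> bf bg; exact/bmeasD/bmeasN. Qed.

Lemma bmeasX D f n : bmeas D f -> bmeas D (fun x => f x ^+ n).
Proof.
move=> bf; elim: n => [|n IH]; first exact: bmeas_cst.
under eq_fun do rewrite exprS; exact: bmeasM.
Qed.

Lemma bmeas_sum D (I : Type) (r : seq I) (P : pred I) (F : I -> R -> R) :
  (forall i, bmeas D (F i)) -> bmeas D (fun x => \sum_(i <- r | P i) F i x).
Proof.
move=> bF; elim: r => [|i r IH].
  by under eq_fun do rewrite big_nil; exact: bmeas_cst.
under eq_fun do rewrite big_cons; case: (P i) => //; exact: bmeasD.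
Qed.

Lemma bmeas_prod D (I : eqType) (r : seq I) (F : I -> R -> R) :
  (forall i, i \in r -> bmeas D (F i)) -> bmeas D (fun x => \prod_(i <- r) F i x).
Proof.
elim: r => [_|i r IH bF].
  by under eq_fun do rewrite big_nil; exact: bmeas_cst.
under eq_fun do rewrite big_cons; apply: bmeasM; first by apply: bF; rewrite mem_head.
by apply: IH => j jr; apply: bF; rewrite inE jr orbT.
Qed.

Lemma bmeas_indic D (A : set R) : measurable A -> bmeas D (\1_A : R -> R).
Proof.
move=> mA; split=> //; exists 1 => x _; rewrite indicE.
by case: (_ \in _); rewrite ?normr1 ?normr0.
Qed.

Lemma bmeas_continuous a b f : continuous f -> bmeas `[a, b] f.
Proof.
move=> cf; split; first exact: continuous_measurable_fun.
have [ab|ba] := leP a b; last first.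
  exists 0 => x /=; rewrite in_itv/= => /andP[ax xb].
  by move: (le_trans ax xb); rewrite leNgt ba.
have [c _ cM] := @EVT_max R (fun x => `|f x|) a b ab (continuous_subspaceT (fun x =>
  continuous_comp (cf x) (@norm_continuous _ _ (f x)))).
by exists (`|f c|) => x /cM.
Qed.

Lemma bmeas_horner D (p : {poly R}) : (exists M, forall x, D x -> `|x| <= M) ->
  bmeas D (fun x => p.[x]).
Proof.
move=> [M DM]; elim/poly_ind: p => [|p c IH].
  by under eq_fun do rewrite horner0; exact: bmeas_cst.
under eq_fun do rewrite hornerMXaddC.
apply: bmeasD; last exact: bmeas_cst.
by apply: bmeasM => //; split; [exact: measurable_id|exists M].
Qed.

(** Integration over [0, pi] and the functional of nu are both instances, so that linear algebra and
    Cauchy-Schwarz are shared. *)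
Record posfun D (I : (R -> R) -> R) : Prop := PosFun {
  posfunD : forall f g, bmeas D f -> bmeas D g ->
    I (fun x => f x + g x) = I f + I g ;
  posfunZ : forall c f, bmeas D f -> I (fun x => c * f x) = c * I f ;
  posfun_le : forall f g, bmeas D f -> bmeas D g ->
    (forall x, D x -> f x <= g x) -> I f <= I g }.

Section PosfunTheory.
Context {D : set R} {I : (R -> R) -> R}.
Context (pI : posfun D I).

Lemma posfun_eq f g : bmeas D f -> bmeas D g ->
  (forall x, D x -> f x = g x) -> I f = I g.
Proof.
move=> bf bg fg; apply/eqP; rewrite eq_le.
by apply/andP; split; apply: (posfun_le pI) => // x /fg ->.
Qed.

Lemma posfun0 : I (fun=> 0) = 0.
Proof.
rewrite -[RHS](mul0r (I (fun=> 0))) -(posfunZ pI); last exact: bmeas_cst.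
by congr I; apply/funext => x; rewrite mul0r.
Qed.

Lemma posfun_ge0 f : bmeas D f -> (forall x, D x -> 0 <= f x) -> 0 <= I f.
Proof. by move=> bf f0; rewrite -posfun0; apply: (posfun_le pI) => //; exact: bmeas_cst. Qed.

Lemma posfunN f : bmeas D f -> I (fun x => - f x) = - I f.
Proof.
move=> bf; rewrite -mulN1r -(posfunZ pI)//.
by congr I; apply/funext => x; rewrite mulN1r.
Qed.

Lemma posfunB f g : bmeas D f -> bmeas D g ->
  I (fun x => f x - g x) = I f - I g.
Proof. by move=> bf bg; rewrite (posfunD pI) ?posfunN//; exact: bmeasN. Qed.

Lemma posfun_sum (J : Type) (r : seq J) (P : pred J) (F : J -> R -> R) :
  (forall i, bmeas D (F i)) ->
  I (fun x => \sum_(i <- r | P i) F i x) = \sum_(i <- r | P i) I (F i).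
Proof.
move=> bF; elim: r => [|i r IH].
  by under eq_fun do rewrite big_nil; rewrite big_nil posfun0.
under eq_fun do rewrite big_cons; rewrite big_cons; case: (P i) => //.
by rewrite (posfunD pI) ?IH//; exact: bmeas_sum.
Qed.

Lemma posfun_norm_le f g : bmeas D f -> bmeas D g ->
  (forall x, D x -> `|f x| <= g x) -> `|I f| <= I g.
Proof.
move=> bf bg fg; rewrite ler_norml -posfunN//.
apply/andP; split; apply: (posfun_le pI) => //; first exact: bmeasN.
- by move=> x /fg; rewrite ler_norml => /andP[].
- by move=> x /fg; rewrite ler_norml => /andP[].
Qed.

Lemma posfun_cauchy_schwarz f g : bmeas D f -> bmeas D g ->
  I (fun x => f x * g x) ^+ 2 <= I (fun x => f x ^+ 2) * I (fun x => g x ^+ 2).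
Proof.
move=> bf bg.
have bff := bmeasX 2 bf; have bgg := bmeasX 2 bg; have bfg := bmeasM bf bg.
set a := I (fun x => f x ^+ 2); set b := I _; set c := I (fun x => g x ^+ 2).
have a0 : 0 <= a by apply: posfun_ge0 => // x _; exact: sqr_ge0.
have c0 : 0 <= c by apply: posfun_ge0 => // x _; exact: sqr_ge0.
have Q u v : 0 <= u ^+ 2 * a + (2 * u * v) * b + v ^+ 2 * c.
  have b1 := bmeasZ (u ^+ 2) bff; have b2 := bmeasZ (2 * u * v) bfg.
  have b3 := bmeasZ (v ^+ 2) bgg; have b12 := bmeasD b1 b2.
  rewrite -(posfunZ pI _ bff) -(posfunZ pI _ bfg) -(posfunZ pI _ bgg).
  rewrite -(posfunD pI b1 b2) -(posfunD pI b12 b3).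
  apply: posfun_ge0; first exact: bmeasD.
  move=> x _; rewrite (_ : _ + _ = (u * f x + v * g x) ^+ 2) ?sqr_ge0//; ring.
(* At (c, -b) the form equals c (a c - b^2), at (-b, a) it equals a (a c - b^2). When a = c = 0, the
   choice (1, -b) leaves -2 b^2 >= 0. *)
have := Q c (- b); have := Q (- b) a; have := Q 1 (-b); have := Q 1 b.
have [c0'|c0'] := eqVneq c 0.
  have [a0'|a0'] := eqVneq a 0; first by rewrite c0' a0' => *; nra.
  have a1 : 0 < a by rewrite lt_def a0' a0.
  move=> _ _ + _.
  rewrite (_ : _ + _ = a * (a * c - b ^+ 2)); last ring.
  by rewrite pmulr_rge0// subr_ge0.
have c1 : 0 < c by rewrite lt_def c0' c0.
move=> _ _ _.
rewrite (_ : _ + _ = c * (a * c - b ^+ 2)); last ring.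
by rewrite pmulr_rge0// subr_ge0.
Qed.

End PosfunTheory.
End BoundedMeasurable.

(** * Polynomials on the unit circle *)

Section TrigPoly.
Context {R : realType}.
Implicit Types (q : {poly R}) (t : R) (z : R[i]).

(** The squared modulus as an element of [R], to be multiplied by real weights; the norm of [R[i]]
    takes values in [R[i]]. *)
Definition nsq z : R := (Re z) ^+ 2 + (Im z) ^+ 2.

Lemma nsqM z1 z2 : nsq (z1 * z2) = nsq z1 * nsq z2.
Proof. by case: z1 => a b; case: z2 => c d; rewrite /nsq/=; ring. Qed.

Lemma nsq1 : nsq 1 = 1.
Proof. by rewrite /nsq/= expr1n expr0n addr0. Qed.

Lemma nsqX z n : nsq (z ^+ n) = nsq z ^+ n.
Proof. by elim: n => [|n IH]; rewrite ?expr0 ?nsq1// !exprS nsqM IH. Qed.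

Lemma nsq_prod (I : Type) (r : seq I) (P : pred I) (F : I -> R[i]) :
  nsq (\prod_(i <- r | P i) F i) = \prod_(i <- r | P i) nsq (F i).
Proof. by apply: big_morph; [exact: nsqM|exact: nsq1]. Qed.

Lemma nsq_ge0 z : 0 <= nsq z.
Proof. by rewrite addr_ge0 ?sqr_ge0. Qed.

Definition expi t : R[i] := (cos t +i* sin t)%C.

Lemma expiX t n : expi t ^+ n = expi (n%:R * t).
Proof.
elim: n => [|n IH]; first by rewrite mul0r /expi cos0 sin0.
rewrite exprS IH -natr1 mulrDl mul1r addrC /expi cosD sinD.
by apply/eqP; rewrite eq_complex/=; apply/andP; split; apply/eqP; ring.
Qed.

Definition circ q t : R[i] := (map_poly (real_complex R) q).[expi t].

Lemma circM q1 q2 t : circ (q1 * q2) t = circ q1 t * circ q2 t.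
Proof. by rewrite /circ rmorphM hornerM. Qed.

Lemma circX q n t : circ (q ^+ n) t = circ q t ^+ n.
Proof. by rewrite /circ rmorphXn horner_exp. Qed.

Lemma circD q1 q2 t : circ (q1 + q2) t = circ q1 t + circ q2 t.
Proof. by rewrite /circ rmorphD hornerD. Qed.

Lemma circN q t : circ (- q) t = - circ q t.
Proof. by rewrite /circ rmorphN hornerN. Qed.

Lemma circC (c : R) t : circ c%:P t = real_complex R c.
Proof. by rewrite /circ map_polyC hornerC. Qed.

Lemma circ_X t : circ 'X t = expi t.
Proof. by rewrite /circ map_polyX hornerX. Qed.

Lemma circ_prod (I : Type) (r : seq I) (P : pred I) (F : I -> {poly R}) t :
  circ (\prod_(i <- r | P i) F i) t = \prod_(i <- r | P i) circ (F i) t.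
Proof.
apply: (big_morph (fun q => circ q t)) => [q1 q2|]; first exact: circM.
by rewrite -[1]/(1%:P) circC.
Qed.

Lemma circE q t : circ q t =
  ((\sum_(k < size q) q`_k * cos (k%:R * t))
    +i* (\sum_(k < size q) q`_k * sin (k%:R * t)))%C.
Proof.
rewrite /circ horner_coef size_map_inj_poly ?rmorph0//; last exact: complexI.
apply/eqP; rewrite eq_complex/= !raddf_sum/=; apply/andP; split; apply/eqP;
  apply: eq_bigr => k _; rewrite coef_map expiX/=; ring.
Qed.

Lemma Re_circ q t : Re (circ q t) = \sum_(k < size q) q`_k * cos (k%:R * t).
Proof. by rewrite circE. Qed.

Lemma Im_circ q t : Im (circ q t) = \sum_(k < size q) q`_k * sin (k%:R * t).
Proof. by rewrite circE. Qed.

Lemma bmeas_cosM (c a b : R) : bmeas `[a, b] (fun t => cos (c * t)).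
Proof.
apply: bmeas_continuous => t; apply: continuous_comp; first exact: mulrl_continuous.
exact: continuous_cos.
Qed.

Lemma bmeas_sinM (c a b : R) : bmeas `[a, b] (fun t => sin (c * t)).
Proof.
apply: bmeas_continuous => t; apply: continuous_comp; first exact: mulrl_continuous.
exact: continuous_sin.
Qed.

Lemma bmeas_Re_circ q (a b : R) : bmeas `[a, b] (fun t => Re (circ q t)).
Proof.
rewrite (funext (Re_circ q)); apply: bmeas_sum => k; apply: bmeasZ; exact: bmeas_cosM.
Qed.

Lemma bmeas_Im_circ q (a b : R) : bmeas `[a, b] (fun t => Im (circ q t)).
Proof.
rewrite (funext (Im_circ q)); apply: bmeas_sum => k; apply: bmeasZ; exact: bmeas_sinM.
Qed.

(** Chebyshev polynomials of the first kind, carried as pairs (T_n, T_(n+1)) to make the three-term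
    recursion structural. *)
Fixpoint cheb2 (n : nat) : {poly R} * {poly R} :=
  if n is n'.+1 then
    let: (u, v) := cheb2 n' in (v, 2 *: 'X * v - u) else (1, 'X).
Definition cheb n := (cheb2 n).1.

Lemma cheb2E n : cheb2 n = (cheb n, cheb n.+1).
Proof. by rewrite /cheb /=; case: (cheb2 n). Qed.

Lemma chebSS n : cheb n.+2 = 2 *: 'X * cheb n.+1 - cheb n.
Proof. by rewrite {1}/cheb/= cheb2E. Qed.

Lemma cheb_cos n t : (cheb n).[cos t] = cos (n%:R * t).
Proof.
suff: (cheb n).[cos t] = cos (n%:R * t) /\ (cheb n.+1).[cos t] = cos (n.+1%:R * t).
  by case.
elim: n => [|n [IH1 IH2]].
  by rewrite /cheb/= hornerC mul0r cos0 hornerX mul1r.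
split=> //; rewrite chebSS hornerD hornerN hornerM hornerZ hornerX IH1 IH2.
rewrite -[n.+2%:R]natr1 -[n.+1%:R]natr1 !mulrDl !mul1r.
rewrite !cosD !sinD; apply/eqP; rewrite -subr_eq0; apply/eqP.
(* The two sides differ by cos (n t) times a multiple of cos^2 t + sin^2 t - 1; the zero is
   rewritten into that form before [ring]. *)
rewrite -[RHS](mulr0 (cos (n%:R * t))) -[X in _ = _ * X](subrr 1).
rewrite -[X in _ * (X - 1)](cos2Dsin2 t); ring.
Qed.

Lemma size_cheb n : (size (cheb n) <= n.+1)%N.
Proof.
suff: (size (cheb n) <= n.+1)%N /\ (size (cheb n.+1) <= n.+2)%N by case.
elim: n => [|n [IH1 IH2]]; first by rewrite /cheb/= size_poly1 size_polyX.
split=> //; rewrite chebSS (leq_trans (size_polyD _ _))// geq_max size_polyN.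
apply/andP; split; last by rewrite (leq_trans IH1)// ltnW.
rewrite -scalerAl.
rewrite (leq_trans (size_scale_leq _ _))// (leq_trans (size_polyMleq _ _))//.
by rewrite size_polyX.
Qed.

Lemma coef_cheb n : (cheb n.+1)`_n.+1 = 2 ^+ n.
Proof.
elim: n => [|n IH]; first by rewrite /cheb/= coefX expr0.
rewrite chebSS coefB -scalerAl coefZ coefXM/= IH.
by rewrite [(cheb n)`_ _]nth_default ?subr0 ?exprS// (leq_trans (size_cheb n)).
Qed.

(* In [x = Re z], [|z| = 1], this is [Re (z^n conj (q z))]. *)
Definition rev_cheb q n : {poly R} := \sum_(k < size q) q`_k *: cheb (n - k).

(** The bound on the size makes the truncated subtraction [n - k] a true one, after which the
    subtraction formula for the cosine applies. *)
Lemma rev_cheb_cos q n t : (size q <= n)%N -> (rev_cheb q n).[cos t] =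
  cos (n%:R * t) * Re (circ q t) + sin (n%:R * t) * Im (circ q t).
Proof.
move=> qn; rewrite /rev_cheb horner_sum Re_circ Im_circ !mulr_sumr -big_split/=.
apply: eq_bigr => k _; rewrite hornerZ cheb_cos natrB; last first.
  by rewrite ltnW// (leq_trans (ltn_ord k)).
by rewrite mulrBl cosB; ring.
Qed.

Lemma size_rev_cheb q n : (size (rev_cheb q n) <= n.+1)%N.
Proof.
rewrite (leq_trans (size_sum _ _ _))//; apply/bigmax_leqP => k _.
rewrite (leq_trans (size_scale_leq _ _))// (leq_trans (size_cheb _))//.
by rewrite ltnS leq_subr.
Qed.

(** Only the term k = 0 reaches degree n, and T_n has leading coefficient 2^(n-1). *)
Lemma coef_rev_cheb q n : q`_0 = 1 -> (size q <= n)%N ->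
  (rev_cheb q n)`_n = 2 ^+ n.-1.
Proof.
move=> q0 qn.
have sq : (0 < size q)%N.
  by rewrite lt0n size_poly_eq0; apply/eqP => q00; move: q0; rewrite q00 coef0 => /esym/eqP; rewrite oner_eq0.
case: n qn => [|n] qn; first by rewrite leqNgt sq in qn.
rewrite /rev_cheb coef_sum; case: (size q) sq qn => // m _ mn.
rewrite big_ord_recl/= subn0 coefZ q0 mul1r coef_cheb big1 ?addr0// => k _.
rewrite coefZ [(cheb _)`_ _]nth_default ?mulr0// (leq_trans (size_cheb _))//.
by rewrite /bump/= add1n subSS ltnS leq_subr.
Qed.

End TrigPoly.

(** * Polynomial approximation of inverse products of distances on the circle *)

Section LogSeries.
Context {R : realType}.
Implicit Types (r x psi : R).

(* [|1 - r e^{i psi}|^2] *)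
Definition eqd r psi : R := 1 - 2 * r * cos psi + r ^+ 2.

Lemma eqdE r psi : eqd r psi = (1 - r) ^+ 2 + r * (2 - 2 * cos psi).
Proof. by rewrite /eqd; ring. Qed.

Lemma eqd_ge r psi : 0 <= r -> (1 - r) ^+ 2 <= eqd r psi.
Proof. by move=> r0; rewrite eqdE; have := cos_le1 psi; nra. Qed.

Lemma eqd_gt0 r psi : 0 <= r < 1 -> 0 < eqd r psi.
Proof.
move=> /andP[r0 r1]; rewrite (lt_le_trans _ (eqd_ge _ r0))//.
by rewrite exprn_gt0// subr_gt0.
Qed.

Lemma eqd1_ge0 psi : 0 <= eqd 1 psi.
Proof. by rewrite eqdE; have := cos_le1 psi; nra. Qed.

(** Triangle inequality: |1 - e^(i psi)| <= |1 - r e^(i psi)| + |1 - r|, and |1 - r| <= |1 - r e^(i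
    psi)|. The constant is independent of r, which later provides the domination. *)
Lemma eqd1_le4 r psi : 0 <= r -> eqd 1 psi <= 4 * eqd r psi.
Proof.
move=> r0; rewrite /eqd; have c1 := cos_le1 psi; have c2 := cos_geN1 psi.
have h1 : 0 <= (1 + cos psi) * (1 - r) ^+ 2 by rewrite mulr_ge0 ?sqr_ge0//; lra.
have h2 : 0 <= (1 - cos psi) * (2 * r + r ^+ 2) by rewrite mulr_ge0//; nra.
by nra.
Qed.

Lemma sum_geo_cos K r psi :
  (\sum_(k < K) r ^+ k * cos (k.+1%:R * psi)) * eqd r psi =
  cos psi - r - r ^+ K * cos (K.+1%:R * psi) + r ^+ K.+1 * cos (K%:R * psi).
Proof.
elim: K => [|K IH].
  by rewrite big_ord0 mul0r mul0r cos0 expr0 mul1r expr1 mul1r; ring.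
rewrite big_ord_recr/= mulrDl IH /eqd.
have -> : cos (K.+2%:R * psi) = 2 * cos psi * cos (K.+1%:R * psi) - cos (K%:R * psi).
  by rewrite -!cheb_cos chebSS hornerD hornerN hornerM hornerZ hornerX.
rewrite !exprS; ring.
Qed.

Lemma is_derive_exprn n x :
  is_derive x 1 (fun r : R => r ^+ n.+1) (n.+1%:R * x ^+ n).
Proof.
have := @is_deriveX R R id n.+1 x 1 1 (is_derive_id x 1).
rewrite scaler1; congr is_derive; apply/funext => r; elim: n => [|n IH].
  by rewrite expr1.
by rewrite exprS [in RHS]exprS -IH.
Qed.

Lemma is_derive_powsum K (c : nat -> R) x :
  is_derive x 1 (fun r : R => \sum_(k < K) c k / k.+1%:R * r ^+ k.+1)
    (\sum_(k < K) x ^+ k * c k).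
Proof.
elim: K => [|K IH].
  rewrite big_ord0; under eq_fun do rewrite big_ord0; exact: is_derive_cst.
rewrite big_ord_recr/=; under eq_fun do rewrite big_ord_recr/=.
apply: is_deriveD; apply: is_derive_eq.
  by apply: (is_deriveZ (c K / K.+1%:R) (is_derive_exprn K x)).
by rewrite /GRing.scale/= mulrA divfK ?pnatr_eq0// mulrC.
Qed.

(** Truncation of the series -log |1 - r e^(i psi)| = sum of r^k cos (k psi) / k. The derivative in
    r of the difference is the remainder of a geometric sum, given by [sum_geo_cos]; the mean value
    theorem on [0, r] does the rest. *)
Lemma log_series K r psi : 0 <= r < 1 ->
  `|\sum_(k < K) cos (k.+1%:R * psi) / k.+1%:R * r ^+ k.+1 + ln (eqd r psi) / 2|
    <= 2 * r ^+ K / (1 - r) ^+ 2.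
Proof.
move=> /andP[]; rewrite le_eqVlt => /predU1P[<- _|r0 r1].
  rewrite big1 => [|k _]; last by rewrite expr0n mulr0.
  rewrite /eqd mulr0 mul0r subr0 expr0n addr0 ln1 mul0r addr0 normr0.
  by rewrite divr_ge0 ?mulr_ge0 ?exprn_ge0// subr_ge0.
pose c k : R := cos (k.+1%:R * psi).
pose F (x : R) := \sum_(k < K) c k / k.+1%:R * x ^+ k.+1 + ln (eqd x psi) / 2.
pose dF x := (x ^+ K.+1 * cos (K%:R * psi) - x ^+ K * c K) / eqd x psi.
have dFE x : 0 <= x < 1 -> is_derive x 1 F (dF x).
  move=> x01; have e0 := eqd_gt0 psi x01.
  have deqd : is_derive x 1 (fun y => eqd y psi) (2 * (x - cos psi)).
    have := is_deriveD (is_deriveD (is_derive_exprn 1 x)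
      (is_deriveZ (- 2 * cos psi) (is_derive_id x 1))) (is_derive_cst (1 : R) x 1).
    rewrite (_ : _ + _ + _ = fun y => eqd y psi); last first.
      apply/funext => y; rewrite /eqd !fctE /= -[_ *: y]/(_ * y); ring.
    move=> h; apply: (is_derive_eq h).
    by rewrite -[_%:A]/(_ * 1) expr1; ring.
  apply: is_derive_eq.
    apply: is_deriveD; first exact: is_derive_powsum.
    rewrite (_ : (fun x => _) = 2^-1 \*: (@ln R \o eqd^~ psi)); last first.
      by apply/funext => y /=; rewrite mulrC.
    apply: is_deriveZ.
    exact: (@is_derive1_comp _ _ (eqd^~ psi) x _ _ (is_derive1_ln e0) deqd).
  rewrite /dF /c /GRing.scale/=.
  have /(canRL (mulfK (lt0r_neq0 e0))) -> := sum_geo_cos K x psi.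
  by field; rewrite lt0r_neq0.
have [|| d] := @MVT R F dF 0 r r0.
- by move=> x; rewrite in_itv/= => /andP[x0 xr]; apply: dFE; rewrite ltW//= (lt_trans xr).
- apply: derivable_within_continuous => x; rewrite in_itv/= => /andP[x0 xr].
  by have [] := dFE x _; rewrite ?x0 ?(le_lt_trans xr).
rewrite in_itv/= => /andP[d0 dr].
have -> : F 0 = 0.
  rewrite /F big1 => [|k _]; last by rewrite expr0n mulr0.
  by rewrite /eqd mulr0 mul0r subr0 expr0n addr0 ln1 mul0r addr0.
rewrite !subr0 => FrE; rewrite -[X in `|X|]/(F r) FrE.
have d01 : 0 <= d < 1 by rewrite (ltW d0) (lt_trans dr).
have e0 := eqd_gt0 psi d01.
have lee : (1 - r) ^+ 2 <= eqd d psi.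
  by rewrite (le_trans _ (eqd_ge psi (ltW d0)))// lerXn2r ?nnegrE; lra.
rewrite normrM (gtr0_norm r0) (le_trans _ (ler_piMr _ (ltW r1)))//; last first.
  by rewrite divr_ge0 ?mulr_ge0 ?exprn_ge0 ?subr_ge0// ltW.
rewrite ler_wpM2r ?(ltW r0)// /dF normrM normfV (gtr0_norm e0).
rewrite ler_pM ?lef_pV2 ?posrE ?exprn_gt0 ?subr_gt0// ?invr_ge0 ?(ltW e0)//.
have dK : d ^+ K <= r ^+ K by rewrite lerXn2r ?nnegrE ?ltW.
have c1 := cos_max (K.+1%:R * psi); have c2 := cos_max (K%:R * psi).
rewrite (le_trans (ler_normB _ _))// exprS !normrM normrX (gtr0_norm d0).
have := exprn_ge0 K (ltW d0); rewrite -/(c K) in c1 *.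
move: dK c1 c2 d01; move: (d ^+ K) (r ^+ K) => D E.
rewrite /c; move: `|cos _| `|cos _| => v u DE u1 v1 /andP[_ d1] D0.
have dD0 : 0 <= d * D by rewrite mulr_ge0// ltW.
have h1 : d * D * v <= d * D * 1 by rewrite ler_wpM2l.
have h2 : D * u <= D * 1 by rewrite ler_wpM2l.
have h3 : d * D <= 1 * D by rewrite ler_wpM2r// ltW.
by lra.
Qed.

Lemma circ_le (q : {poly R}) : exists2 M, 0 <= M &
  forall t, `|Re (circ q t)| <= M /\ `|Im (circ q t)| <= M.
Proof.
exists (\sum_(k < size q) `|q`_k|); first by apply: sumr_ge0.
move=> t; rewrite Re_circ Im_circ.
by split; rewrite (le_trans (ler_norm_sum _ _ _))//; apply: ler_sum => k _;
  rewrite normrM ler_piMr// ?cos_max ?sin_max.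
Qed.

(* [1 + u] lies between [exp (u - 2 u^2)] and [exp u] when [u >= -1/2]. *)
Lemma expR_le1Dx (u : R) : - 2^-1 <= u -> expR (u - 2 * u ^+ 2) <= 1 + u.
Proof.
move=> u0; have v1 : 0 < 1 - (u - 2 * u ^+ 2) by nra.
rewrite -[leLHS]invrK -expRN (@le_trans _ _ (1 - (u - 2 * u ^+ 2))^-1)//.
  by rewrite lef_pV2 ?posrE ?expR_gt0// expR_ge1Dx.
rewrite -div1r ler_pdivrMr//.
have : 0 <= u ^+ 2 * (1 + 2 * u) by rewrite mulr_ge0 ?sqr_ge0//; lra.
by nra.
Qed.

(** The polynomial (1 + h/n)^n stands for e^h, whose squared modulus is e^(2 Re h). Its constant
    term is 1 because that of h is 0. *)
Lemma exp_circ (h : {poly R}) (eps : R) : h`_0 = 0 -> 0 < eps ->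
  exists2 q : {poly R}, q`_0 = 1 & forall t,
    expR (2 * Re (circ h t) - eps) <= nsq (circ q t) <= expR (2 * Re (circ h t) + eps).
Proof.
move=> h0 e0; have [M M0 hM] := circ_le h.
(* The first summand keeps the accumulated quadratic errors below [eps]; the second gives |u| <=
   1/2, as [expR_le1Dx] requires. *)
have [n nM] : exists n : nat, 4 * M ^+ 2 / eps + 2 * M < n%:R.
  by exists (Num.truncn (4 * M ^+ 2 / eps + 2 * M)).+1; exact: truncnS_gt.
have X0 : 0 <= 4 * M ^+ 2 / eps by rewrite divr_ge0 ?(ltW e0)// mulr_ge0 ?sqr_ge0.
have n0 : 0 < n%:R :> R by lra.
have nM1 : 2 * M <= n%:R by lra.
have nM2 : 4 * M ^+ 2 <= n%:R * eps by rewrite -ler_pdivrMr//; lra.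
exists ((1 + n%:R^-1 *: h) ^+ n).
  by rewrite -horner_coef0 horner_exp hornerD hornerZ hornerC horner_coef0 h0 mulr0 addr0 expr1n.
move=> t; have [] := hM t.
rewrite circX nsqX circD -mul_polyC circM !circC.
case: (circ h t) => a b /=; rewrite -[nsq _]/((1 + (n%:R^-1 * a - 0 * b)) ^+ 2 +
  (0 + (n%:R^-1 * b + 0 * a)) ^+ 2) !mul0r subr0 addr0 add0r.
set u := n%:R^-1 * a; set v := n%:R^-1 * b => aM bM.
have aE : a = n%:R * u by rewrite /u mulrA divff ?mul1r ?lt0r_neq0.
have bE : b = n%:R * v by rewrite /v mulrA divff ?mul1r ?lt0r_neq0.
have a2 : n%:R * (n%:R * u ^+ 2) <= M ^+ 2.
  rewrite (_ : _ * _ = a ^+ 2); last by rewrite aE; ring.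
  by rewrite -real_normK ?num_real// lerXn2r ?nnegrE.
have b2 : n%:R * (n%:R * v ^+ 2) <= M ^+ 2.
  rewrite (_ : _ * _ = b ^+ 2); last by rewrite bE; ring.
  by rewrite -real_normK ?num_real// lerXn2r ?nnegrE.
have nu : 4 * (n%:R * u ^+ 2) <= eps.
  by rewrite -(ler_pM2l n0) mulrCA (le_trans _ nM2)// ler_wpM2l.
have nv : 4 * (n%:R * v ^+ 2) <= eps.
  by rewrite -(ler_pM2l n0) mulrCA (le_trans _ nM2)// ler_wpM2l.
apply/andP; split; last first.
  rewrite (@le_trans _ _ (expR (2 * u + u ^+ 2 + v ^+ 2) ^+ n))//.
    rewrite lerXn2r ?nnegrE ?expR_ge0 ?addr_ge0 ?sqr_ge0//.
    by rewrite (le_trans _ (expR_ge1Dx _))// ; nra.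
  by rewrite -expRM_natl ler_expR aE; nra.
rewrite (@le_trans _ _ (expR (2 * (u - 2 * u ^+ 2)) ^+ n))//.
  by rewrite -expRM_natl ler_expR aE; nra.
rewrite lerXn2r ?nnegrE ?expR_ge0 ?addr_ge0 ?sqr_ge0//.
rewrite expRM_natl (@le_trans _ _ ((1 + u) ^+ 2)) ?lerDl ?sqr_ge0//.
have hu : `|u| <= 2^-1.
  by rewrite -(ler_pM2l n0) -[X in X * `|u|](gtr0_norm n0) -normrM -aE; lra.
have /andP[hu1 hu2] : - 2^-1 <= u <= 2^-1 by rewrite -ler_norml.
by rewrite lerXn2r ?nnegrE ?expR_ge0 ?expR_le1Dx//; lra.
Qed.

(** The angles [l.1] and [- l.1] occur together, so the product is even in t and real polynomials
    can approximate its inverse. At r = 1 each factor is a power of |2 (cos t - cos l.1)|; for r < 1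
    the logarithmic series converges uniformly. *)
Definition eqd_prod (L : seq (R * R)) (r t : R) : R :=
  \prod_(l <- L) ((eqd r (t - l.1) * eqd r (t + l.1)) `^ l.2).

Lemma circ_sumX K (c : nat -> R) t : Re (circ (\sum_(k < K) c k *: 'X^(k.+1)) t) =
  \sum_(k < K) c k * cos (k.+1%:R * t).
Proof.
elim: K => [|K IH]; first by rewrite !big_ord0 -[0 : {poly R}]/(0%:P) circC.
rewrite !big_ord_recr/= circD -IH; case: (circ _ t) => a b.
by rewrite -mul_polyC circM circC circX circ_X expiX/=; congr (_ + _); rewrite mul0r subr0.
Qed.

(* [q = (1 + h / m) ^ m], where [h] is a truncation of the logarithmic series of the
   product and has no constant term. *)
Lemma eqd_prod_approx (L : seq (R * R)) (r eps : R) : 0 <= r < 1 ->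
  (forall l, l \in L -> 0 <= l.2) -> 0 < eps ->
  exists2 q : {poly R}, q`_0 = 1 & forall t,
    expR (- eps) <= nsq (circ q t) * eqd_prod L r t <= expR eps.
Proof.
move=> r01 L0 e0; pose S := \sum_(l <- L) l.2.
have S0 : 0 <= S by rewrite /S big_seq sumr_ge0.
have [K hK] : exists K, S * (8 * r ^+ K / (1 - r) ^+ 2) <= eps / 2.
  pose C := S * 8 / (1 - r) ^+ 2.
  have C0 : 0 <= C by apply: divr_ge0; [exact: mulr_ge0|exact: sqr_ge0].
  have /andP[r0 r1] := r01.
  have := @cvg_expr R r; rewrite ger0_norm// => /(_ r1)/cvgrPdist_le.
  have d0 : 0 < eps / 2 / (C + 1) by rewrite divr_gt0 ?divr_gt0//; lra.
  move=> /(_ _ d0)[N _ /(_ N (leqnn N))]; rewrite sub0r normrN ger0_norm ?exprn_ge0// => hN.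
  exists N; have -> : S * (8 * r ^+ N / (1 - r) ^+ 2) = r ^+ N * C by rewrite /C; ring.
  rewrite ler_pdivlMr in hN; last lra.
  by rewrite (le_trans _ hN)// ler_wpM2l ?exprn_ge0//; lra.
(* The angles l.1 and -l.1 together contribute 2 cos (k l.1) cos (k t) at frequency k. With these
   coefficients 2 Re h is minus the logarithm of the product, up to truncation. *)
pose c k := \sum_(l <- L) l.2 * (2 * (r ^+ k.+1 / k.+1%:R * cos (k.+1%:R * l.1))).
pose h := \sum_(k < K) c k *: 'X^(k.+1) : {poly R}.
have h0 : h`_0 = 0.
  by rewrite coef_sum big1// => k _; rewrite coefZ coefXn mulr0.
have e2 : 0 < eps / 2 by rewrite divr_gt0.
have [q q0 hq] := exp_circ h0 e2.
exists q => // t.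
have Phi0 : 0 < eqd_prod L r t.
  by apply: prodr_gt0 => l _; rewrite powR_gt0// mulr_gt0// eqd_gt0.
have lnPhi : ln (eqd_prod L r t) =
    \sum_(l <- L) l.2 * (ln (eqd r (t - l.1)) + ln (eqd r (t + l.1))).
  rewrite /eqd_prod; elim: (L) => [|l L' IH]; first by rewrite !big_nil ln1.
  rewrite !big_cons lnM ?posrE ?powR_gt0 ?mulr_gt0 ?eqd_gt0//; last first.
    by apply: prodr_gt0 => ? _; rewrite powR_gt0// mulr_gt0// eqd_gt0.
  by rewrite IH ln_powR lnM ?posrE ?eqd_gt0.
have main : `|2 * Re (circ h t) + ln (eqd_prod L r t)| <= eps / 2.
  pose F x := \sum_(k < K) cos (k.+1%:R * x) / k.+1%:R * r ^+ k.+1 + ln (eqd r x) / 2.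
  have -> : 2 * Re (circ h t) + ln (eqd_prod L r t) =
      \sum_(l <- L) l.2 * (2 * (F (t - l.1) + F (t + l.1))).
    rewrite lnPhi circ_sumX mulr_sumr.
    under eq_bigr do rewrite mulr_suml mulr_sumr.
    rewrite exchange_big/= -big_split/=; apply: eq_bigr => l _.
    rewrite -!mulr_sumr; set X := \sum_(i < K) _.
    have -> : X =
      l.2 * (\sum_(k < K) cos (k.+1%:R * (t - l.1)) / k.+1%:R * r ^+ k.+1 +
             \sum_(k < K) cos (k.+1%:R * (t + l.1)) / k.+1%:R * r ^+ k.+1).
      rewrite -big_split mulr_sumr/=; apply: eq_bigr => i _.
      by rewrite mulrBr [_ * (t + _)]mulrDr cosB cosD; ring.
    by rewrite /F; set A := \sum_(k < K) _ ; set B := \sum_(k < K) _; field.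
  rewrite (le_trans (ler_norm_sum _ _ _))// (le_trans _ hK)// /S mulr_suml.
  rewrite big_seq [leRHS]big_seq; apply: ler_sum => l lL.
  rewrite normrM (ger0_norm (L0 _ lL)) ler_wpM2l ?L0//.
  have h1 := log_series K (t - l.1) r01; have h2 := log_series K (t + l.1) r01.
  rewrite normrM ger0_norm// (le_trans (ler_wpM2l _ (ler_normD _ _)))//.
  by rewrite /F; lra.
move: main (hq t); rewrite ler_norml => /andP[m1 m2] /andP[q1 q2].
rewrite -[eqd_prod L r t]lnK ?posrE//.
apply/andP; split.
  by rewrite (le_trans _ (ler_wpM2r (expR_ge0 _) q1))// -expRD ler_expR; lra.
by rewrite (le_trans (ler_wpM2r (expR_ge0 _) q2))// -expRD ler_expR; lra.
Qed.

End LogSeries.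

(** * Polynomials q_j with |q_j|^2 converging to the inverse of a product on the circle *)

Section SzegoSequence.
Context {R : realType}.
Implicit Types (L : seq (R * R)) (r t : R).

Lemma eqd_prod_ge0 L r t : 0 <= eqd_prod L r t.
Proof. by apply: prodr_ge0 => l _; exact: powR_ge0. Qed.

Lemma eqd_prod_gt0 L r t : 0 <= r < 1 -> 0 < eqd_prod L r t.
Proof. by move=> r01; apply: prodr_gt0 => l _; rewrite powR_gt0// mulr_gt0// eqd_gt0. Qed.

Lemma eqd_prod1_le L r t : 0 <= r < 1 -> (forall l, l \in L -> 0 <= l.2) ->
  eqd_prod L 1 t <= \prod_(l <- L) (16 `^ l.2) * eqd_prod L r t.
Proof.
move=> r01 L0; rewrite /eqd_prod -big_split/= big_seq [leRHS]big_seq.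
have [r0 r1] := andP r01.
apply: ler_prod => l lL; rewrite powR_ge0/= -powRM//; last first.
  by rewrite ltW// mulr_gt0 ?eqd_gt0.
rewrite ge0_ler_powR ?L0// ?nnegrE ?mulr_ge0 ?eqd1_ge0// ?(ltW (eqd_gt0 _ _))//.
have h1 := eqd1_le4 (t - l.1) r0; have h2 := eqd1_le4 (t + l.1) r0.
rewrite (_ : 16 * _ = (4 * eqd r (t - l.1)) * (4 * eqd r (t + l.1))); last ring.
by rewrite ler_pM ?eqd1_ge0.
Qed.

Lemma continuous_powR (c x : R) : 0 < x -> {for x, continuous (fun y => y `^ c)}.
Proof.
move=> x0; apply: differentiable_continuous; apply/derivable1_diffP.
by have [] := is_derive1_powR c x0.
Qed.

Lemma cvg_eqd_prod L (r : nat -> R) t : r @ \oo --> (1 : R) -> 0 < eqd_prod L 1 t ->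
  eqd_prod L (r j) t @[j --> \oo] --> eqd_prod L 1 t.
Proof.
move=> r1; have ce psi : eqd (r j) psi @[j --> \oo] --> eqd 1 psi.
  rewrite /eqd; apply: cvgD; last by rewrite expr2; under eq_fun do rewrite expr2; exact: cvgM.
  apply: cvgB; first exact: cvg_cst.
  by apply: cvgM; [apply: cvgM => //; exact: cvg_cst|exact: cvg_cst].
rewrite /eqd_prod; elim: L => [|l L IH].
  by move=> _; rewrite big_nil; under eq_fun do rewrite big_nil; exact: cvg_cst.
rewrite big_cons => Phi0; under eq_fun do rewrite big_cons.
have := Phi0; rewrite lt_def mulf_eq0 negb_or => /andP[/andP[p1 p2] _].
apply: cvgM; last by apply: IH; rewrite lt_def p2 eqd_prod_ge0.
have [->|l0] := eqVneq l.2 0.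
  by rewrite powRr0; under eq_fun do rewrite powRr0; exact: cvg_cst.
have b0 : eqd 1 (t - l.1) * eqd 1 (t + l.1) != 0.
  by apply: contraNneq p1 => ->; rewrite powR0.
have b1 : 0 < eqd 1 (t - l.1) * eqd 1 (t + l.1).
  by rewrite lt_def b0 mulr_ge0 ?eqd1_ge0.
have h : eqd (r j) (t - l.1) * eqd (r j) (t + l.1) @[j --> \oo] -->
    eqd 1 (t - l.1) * eqd 1 (t + l.1) by apply: cvgM.
apply: (@cvg_comp _ _ _ _ (fun y : R => y `^ l.2) _ _ _ h).
have cb := @continuous_powR l.2 _ b1.
exact cb.
Qed.

(** Diagonal choice: radius 1 - 1/(j+1) and tolerance 1/(j+1). Nonnegative exponents allow the
    product at radius 1 to be dominated by the one at radius r_j through [eqd_prod1_le]; this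
    uniform bound is what dominated convergence will use. *)
Lemma szego_sequence L : (forall l, l \in L -> 0 <= l.2) ->
  exists2 q : nat -> {poly R}, (forall j, (q j)`_0 = 1) &
  (exists C, forall j t, nsq (circ (q j) t) * eqd_prod L 1 t <= C) /\
  (forall t, 0 < eqd_prod L 1 t ->
    nsq (circ (q j) t) * eqd_prod L 1 t @[j --> \oo] --> (1 : R)).
Proof.
move=> L0; pose r j : R := 1 - j.+1%:R^-1; pose eps j : R := j.+1%:R^-1.
have r01 j : 0 <= r j < 1.
  by rewrite /r subr_ge0 invf_le1// ler1n/= gtrBl invr_gt0.
have eps0 j : 0 < eps j by rewrite invr_gt0.
have /choice[q hq] j : exists q : {poly R}, q`_0 = 1 /\ forall t,
    expR (- eps j) <= nsq (circ q t) * eqd_prod L (r j) t <= expR (eps j).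
  by have [q q0 hq] := eqd_prod_approx (r01 j) L0 (eps0 j); exists q.
exists q => [j|]; first by have [] := hq j.
split.
  exists (expR 1 * \prod_(l <- L) (16 `^ l.2)) => j t.
  have [_ /(_ t)/andP[_ h]] := hq j.
  rewrite (le_trans (ler_wpM2l (nsq_ge0 _) (eqd_prod1_le t (r01 j) L0)))//.
  rewrite mulrCA mulrC ler_wpM2r//; first by apply: prodr_ge0 => l _; exact: powR_ge0.
  by rewrite (le_trans h)// ler_expR invf_le1// ler1n.
move=> t Phi0.
have cr : r @ \oo --> (1 : R).
  rewrite -[X in _ --> X]subr0; apply: cvgB; [exact: cvg_cst|exact: cvg_harmonic].
have -> : (fun j => nsq (circ (q j) t) * eqd_prod L 1 t) = (fun j =>
    nsq (circ (q j) t) * eqd_prod L (r j) t * ((eqd_prod L (r j) t)^-1 * eqd_prod L 1 t)).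
  apply/funext => j; rewrite mulrA mulfK//; by rewrite lt0r_neq0// eqd_prod_gt0.
rewrite -[X in _ --> X]mulr1 -[X in _ * X](mulVf (lt0r_neq0 Phi0)).
apply: cvgM; last first.
  apply: cvgM; last exact: cvg_cst.
  by apply: cvgV; [rewrite lt0r_neq0|exact: cvg_eqd_prod].
have ce : eps @ \oo --> (0 : R) by exact: cvg_harmonic.
apply: (@squeeze_cvgr _ _ _ _ (fun j => expR (- eps j)) (fun j => expR (eps j))).
- by apply: nearW => j; have [_ /(_ t)] := hq j.
- rewrite -[X in _ --> X]expR0 -oppr0; apply: continuous_cvg; first exact: continuous_expR.
  exact: cvgN.
- rewrite -[X in _ --> X]expR0; apply: continuous_cvg; first exact: continuous_expR.
  exact: ce.
Qed.
End SzegoSequence.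

(** * Oscillating integrals over [0, pi] *)

Section Functionals.
Context {R : realType}.
Notation mu := (@lebesgue_measure R).
Implicit Types (D : set R) (f g v : R -> R).

Lemma integrable_bmeasM D f v : measurable D -> bmeas D f ->
  mu.-integrable D (EFin \o v) -> mu.-integrable D (EFin \o (fun x => f x * v x)).
Proof.
move=> mD [mf [M fM]] iv.
have mv : measurable_fun D v by apply/measurable_EFinP; exact: measurable_int iv.
apply: (@le_integrable _ _ _ mu D mD _ (fun x => (M * v x)%:E)).
- apply/measurable_EFinP; apply: measurable_funM => //; exact: measurable_funTS.
- move=> x Dx; rewrite /= lee_fin !normrM ler_wpM2r//.
  by rewrite (le_trans (fM _ Dx))// ler_norm.
- under eq_fun do rewrite EFinM; exact: integrableZl.
Qed.

Lemma posfun_weight D v : measurable D -> mu.-integrable D (EFin \o v) ->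
  (forall x, D x -> 0 <= v x) -> posfun D (fun f => \int[mu]_(x in D) (f x * v x)).
Proof.
move=> mD iv v0; split.
- move=> f g bf bg; rewrite -RintegralD//; try exact: integrable_bmeasM.
  by apply: eq_Rintegral => x _; rewrite mulrDl.
- move=> c f bf; rewrite -RintegralZl//; last exact: integrable_bmeasM.
  by apply: eq_Rintegral => x _; rewrite mulrA.
- move=> f g bf bg fg; apply: le_Rintegral => //; try exact: integrable_bmeasM.
  by move=> x Dx; rewrite ler_wpM2r ?v0 ?fg.
Qed.

Lemma integrable_cst1 D : measurable D -> (mu D < +oo)%E ->
  mu.-integrable D (EFin \o (fun=> 1 : R)).
Proof.
move=> mD Doo; apply/integrableP; split; first exact: measurable_cst.
by under eq_integral do rewrite /= normr1; rewrite integral_cst// mul1e.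
Qed.

Lemma integrable_bmeas D f : measurable D -> (mu D < +oo)%E -> bmeas D f ->
  mu.-integrable D (EFin \o f).
Proof.
move=> mD Doo bf; have := integrable_bmeasM mD bf (integrable_cst1 mD Doo).
by under [X in integrable _ _ (_ \o X)]eq_fun do rewrite mulr1.
Qed.

Lemma posfun_Rintegral D : measurable D -> (mu D < +oo)%E ->
  posfun D (fun f => \int[mu]_(x in D) f x).
Proof.
move=> mD Doo; have := posfun_weight mD (integrable_cst1 mD Doo) (fun x _ => ler01).
congr posfun; apply/funext => f; apply: eq_Rintegral => x _; exact: mulr1.
Qed.

(** Bessel's inequality: the squared coefficients have bounded partial sums, hence are summable and
    tend to 0. The residual [r N] is the part of G left after N projections. *)
Lemma bessel_cvg0 D (I : (R -> R) -> R) (phi : nat -> R -> R) (c : R) G :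
  posfun D I -> (forall n, bmeas D (phi n)) -> 0 < c ->
  (forall n m, I (fun x => phi n x * phi m x) = c * (n == m)%:R) ->
  bmeas D G -> I (fun x => G x * phi n x) @[n --> \oo] --> (0 : R).
Proof.
move=> pI bphi c0 ortho bG; pose a n := I (fun x => G x * phi n x).
pose r N x := G x - \sum_(n < N) a n / c * phi n x.
have bs N : bmeas D (fun x => \sum_(n < N) a n / c * phi n x).
  by apply: bmeas_sum => n; exact: bmeasZ.
have br N : bmeas D (r N) by exact: bmeasB.
have rphi N : I (fun x => r N x * phi N x) = a N.
  have bsp : bmeas D (fun x => \sum_(n < N) a n / c * (phi n x * phi N x)).
    by apply: bmeas_sum => n; apply: bmeasZ; exact: bmeasM.
  rewrite (_ : (fun x => _) = fun x => G x * phi N x -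
      \sum_(n < N) a n / c * (phi n x * phi N x)); last first.
    apply/funext => x; rewrite /r mulrBl mulr_suml; congr (_ - _).
    by apply: eq_bigr => n _; rewrite mulrA.
  rewrite (posfunB pI)//; last exact: bmeasM.
  rewrite (posfun_sum pI); last by move=> n; apply: bmeasZ; exact: bmeasM.
  rewrite big1 ?subr0// => n _; rewrite (posfunZ pI) ?ortho; last exact: bmeasM.
  by rewrite ltn_eqF ?mulr0.
have rr N : I (fun x => r N x ^+ 2) = I (fun x => G x ^+ 2) - \sum_(n < N) a n ^+ 2 / c.
  elim: N => [|N IH].
    by rewrite big_ord0 subr0; congr I; apply/funext => x; rewrite /r big_ord0 subr0.
  rewrite big_ord_recr/= (_ : (fun x => _) = fun x => r N x ^+ 2 +
      ((- 2 * (a N / c)) * (r N x * phi N x) + (a N / c) ^+ 2 * (phi N x * phi N x))).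
    have b1 := bmeasX 2 (br N); have b2 := bmeasM (br N) (bphi N).
    have b3 := bmeasM (bphi N) (bphi N).
    rewrite (posfunD pI) ?(posfunD pI) ?(posfunZ pI) ?rphi ?ortho ?IH ?eqxx//;
      try by [exact: bmeasZ|apply: bmeasD; exact: bmeasZ].
    rewrite mulr1; set S := \sum_(n < N) _; move: (a N) => aN.
    by field; rewrite lt0r_neq0.
  by apply/funext => x; rewrite /r big_ord_recr/=; ring.
have bnd N : \sum_(n < N) a n ^+ 2 <= c * I (fun x => G x ^+ 2).
  have : 0 <= I (fun x => r N x ^+ 2).
    by apply: (posfun_ge0 pI); [exact: bmeasX|move=> x _; exact: sqr_ge0].
  by rewrite rr -mulr_suml subr_ge0 ler_pdivrMr// mulrC.
have cs : cvgn (series (fun n => a n ^+ 2)).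
  apply: nondecreasing_is_cvgn.
    by apply/nondecreasing_seqP => n; rewrite seriesSr lerDl sqr_ge0.
  exists (c * I (fun x => G x ^+ 2)) => _ [N _ <-].
  by rewrite /series/= big_mkord.
have /cvgrPdist_lt a2 := cvg_series_cvg_0 cs.
apply/cvgrPdist_lt => e e0; near=> n.
have : `|0 - a n ^+ 2| < e ^+ 2 by near: n; apply: a2; rewrite exprn_gt0.
by rewrite !sub0r !normrN normrX ltr_pXn2r ?nnegrE ?(ltW e0).
Unshelve. all: by end_near. Qed.

Definition Ipi (f : R -> R) : R := \int[mu]_(x in `[0, (pi : R)]) f x.
Notation D := `[0, (pi : R)]%classic.

Lemma posfun_Ipi : posfun D Ipi.
Proof.
apply: posfun_Rintegral => //.
by rewrite lebesgue_measure_itv/= lte_fin pi_gt0 -EFinD ltry.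
Qed.

Lemma sin_pin n : sin (n%:R * pi) = 0 :> R.
Proof.
elim: n => [|n IH]; first by rewrite mul0r sin0.
by rewrite -natr1 mulrDl mul1r sinDpi IH oppr0.
Qed.

Lemma Ipi_cst c : Ipi (fun=> c) = c * pi.
Proof.
rewrite /Ipi Rintegral_cst//= lebesgue_measure_itv/= lte_fin pi_gt0.
by rewrite -EFinD/= subr0.
Qed.

Lemma is_derive_sinM (c x : R) : is_derive x 1 (fun y => sin (c * y)) (c * cos (c * x)).
Proof.
have h := @is_derive1_comp _ sin ( *%R c) x _ _ (is_derive_sin (c * x))
  (is_deriveZ c (is_derive_id x 1)).
by apply: (is_derive_eq h); rewrite mulrC [_%:A]mulr1.
Qed.

Lemma derivable_oo_LRcontinuousW (F : R -> R) (a b : R) :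
  (forall x, derivable F x 1) -> derivable_oo_LRcontinuous F a b.
Proof.
move=> dF; have cF x : {for x, continuous F}.
  by apply: differentiable_continuous; exact/derivable1_diffP.
split; first by move=> x _.
- by apply: cvg_at_right_filter; exact: cF.
- by apply: cvg_at_left_filter; exact: cF.
Qed.

Lemma Ipi_cos n : Ipi (fun x => cos (n.+1%:R * x)) = 0.
Proof.
rewrite /Ipi /Rintegral.
have n0 : n.+1%:R != 0 :> R by rewrite pnatr_eq0.
have dF (x : R) : is_derive x 1 (n.+1%:R^-1 \*: (fun x => sin (n.+1%:R * x))) (cos (n.+1%:R * x)).
  apply: (is_derive_eq (is_deriveZ _ (is_derive_sinM n.+1%:R x))).
  by rewrite /GRing.scale/= mulKf.
rewrite (@continuous_FTC2 R _ (n.+1%:R^-1 \*: (fun x => sin (n.+1%:R * x)))) ?pi_gt0//.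
- by rewrite /= sin_pin mulr0 sin0 scaler0 subrr.
- apply: continuous_subspaceT => x; apply: continuous_comp; first exact: mulrl_continuous.
  exact: continuous_cos.
- by apply: derivable_oo_LRcontinuousW => x; have [] := dF x.
- by move=> x _; rewrite derive1E; have [_ ->] := dF x.
Qed.

Lemma Ipi_cos0 n : Ipi (fun x => cos (n%:R * x)) = pi * (n == 0%N)%:R.
Proof.
case: n => [|n]; last by rewrite Ipi_cos mulr0.
under eq_fun do rewrite mul0r cos0.
by rewrite Ipi_cst mul1r mulr1.
Qed.

Lemma Ipi_cosB n m : Ipi (fun x => cos ((n%:R - m%:R) * x)) = pi * (n == m)%:R.
Proof.
have [nm|mn] := leqP n m.
  have [k ->] : exists k, m = (n + k)%N by exists (m - n)%N; rewrite subnKC.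
  have -> : (fun x => cos ((n%:R - (n + k)%:R) * x)) = fun x => cos (k%:R * x) :> R.
    by apply/funext => x; rewrite natrD opprD addNKr mulNr cosN.
  by rewrite Ipi_cos0 -[X in X == (n + k)%N]addn0 eqn_add2l eq_sym.
have [k ->] : exists k, n = (k + m)%N by exists (n - m)%N; rewrite subnK// ltnW.
under eq_fun do rewrite natrD addrK.
by rewrite Ipi_cos0 -[X in (k + m)%N == X]add0n eqn_add2r.
Qed.

Lemma bmeas_Ipi_cos (c : R) : bmeas D (fun x => cos (c * x)).
Proof. exact: bmeas_cosM. Qed.

Lemma Ipi_coscos n m :
  Ipi (fun x => cos (n.+1%:R * x) * cos (m.+1%:R * x)) = pi / 2 * (n == m)%:R.
Proof.
have -> : (fun x => cos (n.+1%:R * x) * cos (m.+1%:R * x)) =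
    fun x => 2^-1 * cos ((n.+1%:R - m.+1%:R) * x) + 2^-1 * cos ((n.+1 + m.+1)%:R * x) :> R.
  by apply/funext => x; rewrite [(_ + _.+1)%:R]natrD [(_ - _) * x]mulrBl [(_ + _) * x]mulrDl cosB cosD; field.
rewrite (posfunD posfun_Ipi) ?(posfunZ posfun_Ipi); try exact: bmeas_Ipi_cos;
  try by apply: bmeasZ; exact: bmeas_Ipi_cos.
rewrite Ipi_cosB Ipi_cos0 addSn mulr0 mulr0 addr0 eqSS; ring.
Qed.

Lemma Ipi_sinsin n m :
  Ipi (fun x => sin (n.+1%:R * x) * sin (m.+1%:R * x)) = pi / 2 * (n == m)%:R.
Proof.
have -> : (fun x => sin (n.+1%:R * x) * sin (m.+1%:R * x)) =
    fun x => 2^-1 * cos ((n.+1%:R - m.+1%:R) * x) + (- 2^-1) * cos ((n.+1 + m.+1)%:R * x) :> R.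
  by apply/funext => x; rewrite [(_ + _.+1)%:R]natrD [(_ - _) * x]mulrBl [(_ + _) * x]mulrDl cosB cosD; field.
rewrite (posfunD posfun_Ipi) ?(posfunZ posfun_Ipi); try exact: bmeas_Ipi_cos;
  try by apply: bmeasZ; exact: bmeas_Ipi_cos.
rewrite Ipi_cosB Ipi_cos0 addSn mulr0 mulr0 addr0 eqSS; ring.
Qed.

(** Bessel's inequality for the frequencies n + 1; the shift removes the constant function, whose
    norm differs from the others. *)
Lemma riemann_lebesgue_cos G : bmeas D G ->
  Ipi (fun x => G x * cos (n%:R * x)) @[n --> \oo] --> (0 : R).
Proof.
move=> bG; rewrite -cvg_shiftS.
apply: (bessel_cvg0 posfun_Ipi _ _ Ipi_coscos) => //; last by rewrite divr_gt0 ?pi_gt0.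
by move=> n; exact: bmeas_Ipi_cos.
Qed.

Lemma riemann_lebesgue_sin G : bmeas D G ->
  Ipi (fun x => G x * sin (n%:R * x)) @[n --> \oo] --> (0 : R).
Proof.
move=> bG; rewrite -cvg_shiftS.
apply: (bessel_cvg0 posfun_Ipi _ _ Ipi_sinsin) => //; last by rewrite divr_gt0 ?pi_gt0.
by move=> n; exact: bmeas_sinM.
Qed.

(** The identity 2 cos x cos ((m+1) x) = cos ((m+2) x) + cos (m x) lowers the power of cos x by one.
    Frequencies above the degree therefore integrate to 0, and the top one acquires a factor 1/2 at
    each step. *)
Lemma Ipi_horner_cos (p : {poly R}) n : (size p <= n.+2)%N ->
  Ipi (fun x => p.[cos x] * cos (n.+1%:R * x)) = pi * p`_n.+1 / 2 ^+ n.+1.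
Proof.
pose J k m := Ipi (fun x => cos x ^+ k * cos (m%:R * x)).
have bJ k m : bmeas D (fun x => cos x ^+ k * cos (m%:R * x)).
  apply: bmeasM; last exact: bmeas_Ipi_cos.
  by apply: bmeasX; apply: bmeas_continuous; exact: continuous_cos.
have JS k m : J k.+1 m.+1 = 2^-1 * J k m.+2 + 2^-1 * J k m.
  rewrite -!(posfunZ posfun_Ipi)// -(posfunD posfun_Ipi); try exact: bmeasZ.
  congr Ipi; apply/funext => x.
  have -> : m%:R * x = m.+1%:R * x - x by rewrite -natr1; ring.
  have -> : m.+2%:R * x = m.+1%:R * x + x by rewrite -[m.+2%:R]natr1; ring.
  by rewrite cosD cosB exprS; field.
have J0 k m : (k < m)%N -> J k m = 0.
  elim: k m => [|k IH] [|m]//.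
    by move=> _; rewrite -[RHS](Ipi_cos m); congr Ipi; apply/funext => x; rewrite expr0 mul1r.
  by rewrite ltnS => km; rewrite JS !IH ?mulr0 ?addr0// leqW// leqW.
have Jd k : J k.+1 k.+1 = pi / 2 ^+ k.+1.
  elim: k => [|k IH].
    rewrite JS J0// mulr0 add0r expr1 mulrC; congr (_ * _).
    rewrite -[RHS]mul1r -Ipi_cst; congr Ipi; apply/funext => x.
    by rewrite mul0r cos0 expr0 mulr1.
  by rewrite JS J0// mulr0 add0r IH [in RHS]exprS; field; rewrite expf_neq0.
move=> sp.
have -> : (fun x => p.[cos x] * cos (n.+1%:R * x)) =
    fun x => \sum_(k < n.+2) p`_k * (cos x ^+ k * cos (n.+1%:R * x)).
  by apply/funext => x; rewrite (horner_coef_wide _ sp) mulr_suml; apply: eq_bigr => k _; rewrite mulrA.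
rewrite (posfun_sum posfun_Ipi); last by move=> k; exact: bmeasZ.
rewrite big_ord_recr big1/= => [|k _].
  by rewrite add0r (posfunZ posfun_Ipi)// -/(J n.+1 n.+1) Jd mulrCA mulrA.
by rewrite (posfunZ posfun_Ipi)// -/(J k n.+1) J0 ?mulr0.
Qed.

End Functionals.

(** * Limits of integrals with rapidly oscillating factors *)

Section ThetaLimits.
Context {R : realType}.
Notation mu := (@lebesgue_measure R).
Notation D := `[0, (pi : R)]%classic.

Lemma Ipi_dominated (F : nat -> R -> R) (G : R -> R) (C : R) (A : set R) :
  (forall j, bmeas D (F j)) -> bmeas D G ->
  (forall j x, D x -> `|F j x| <= C) -> countable A ->
  (forall x, D x -> ~ A x -> F j x @[j --> \oo] --> G x) ->
  Ipi (F j) @[j --> \oo] --> Ipi G.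
Proof.
move=> bF bG FC cA FG.
have mD : measurable D by exact: measurable_itv.
have Doo : (mu D < +oo)%E by rewrite lebesgue_measure_itv/= lte_fin pi_gt0 -EFinD ltry.
have nA : mu.-negligible A.
  exists A; split=> //; last exact: countable_lebesgue_measure0.
  by apply: countable_measurable => // x _; exact: measurable_set1.
have iD f : bmeas D f -> mu.-integrable D (EFin \o f) by exact: integrable_bmeas.
have := @dominated_convergence _ _ _ mu D mD (fun j x => (F j x)%:E)
  (fun x => (G x)%:E) (cst C%:E).
move=> /(_ (fun j => measurable_int mu (iD _ (bF j))) (measurable_int mu (iD _ bG)))[].
- exists A; split; [exact: countable_measurable|exact: countable_lebesgue_measure0|].
  move=> x /= /not_implyP[Dx nFG]; apply: contrapT => nAx; apply: nFG.
  by apply: cvg_EFin; [exact: nearW|exact: FG].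
- exact: (iD _ (bmeas_cst _ C)).
- by apply: aeW => x j Dx; rewrite lee_fin FC.
move=> _ _ cv; apply: fine_cvg.
by rewrite /Ipi /Rintegral fineK//; exact: integrable_fin_num (iD _ bG).
Qed.

Lemma cvg_double (u : nat -> R) (l : R) : u @ \oo --> l -> u n.*2 @[n --> \oo] --> l.
Proof.
move=> ul; apply: (cvg_comp _ _ _ ul) => /=.
move=> A [N _ NA]; exists N => // n /= Nn; apply: NA => /=.
by rewrite (leq_trans Nn)// -addnn leq_addr.
Qed.

(** The real part of e^(inx) (a - ib). The pair (-b, a) in place of (a, b) gives the imaginary part,
    that is, the harmonic conjugate. *)
Definition osc (a b : R -> R) n x := cos (n%:R * x) * a x + sin (n%:R * x) * b x.

Section Osc.
Context (a b g : R -> R).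
Context (ga : bmeas D (fun x => g x * a x ^+ 2))
  (gb : bmeas D (fun x => g x * b x ^+ 2)) (gab : bmeas D (fun x => g x * (a x * b x))).

Let cos2n n x : cos (n.*2%:R * x) = cos (n%:R * x) ^+ 2 - sin (n%:R * x) ^+ 2 :> R.
Proof. by rewrite -addnn natrD mulrDl cosD !expr2. Qed.

Let sin2n n x : sin (n.*2%:R * x) = 2 * sin (n%:R * x) * cos (n%:R * x) :> R.
Proof. by rewrite -addnn natrD mulrDl sinD; ring. Qed.

Let mcos n x : cos (n%:R * x) ^+ 2 = 1 - sin (n%:R * x) ^+ 2 :> R.
Proof. exact: cos2sin2. Qed.

Lemma osc_norm n x : osc a b n x ^+ 2 <= a x ^+ 2 + b x ^+ 2.
Proof.
have : 0 <= (sin (n%:R * x) * a x - cos (n%:R * x) * b x) ^+ 2 by exact: sqr_ge0.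
have := cos2Dsin2 (n%:R * x); rewrite /osc.
set c := cos _; set s := sin _ => cs h.
rewrite -subr_ge0 (_ : _ - _ = (s * a x - c * b x) ^+ 2)//.
have -> : a x ^+ 2 + b x ^+ 2 = (c ^+ 2 + s ^+ 2) * (a x ^+ 2 + b x ^+ 2) by rewrite cs mul1r.
by ring.
Qed.

(** The square is its mean (a^2 + b^2)/2 plus terms of frequency 2n, which vanish by
    Riemann-Lebesgue. Boundedness is assumed of g a^2, g b^2 and g a b only, since g will be a
    weight that may blow up at the endpoints. *)
Lemma cvg_osc_sq : Ipi (fun x => g x * osc a b n x ^+ 2) @[n --> \oo] -->
  2^-1 * Ipi (fun x => g x * (a x ^+ 2 + b x ^+ 2)).
Proof.
pose G1 x := g x * a x ^+ 2 + g x * b x ^+ 2.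
pose G2 x := g x * a x ^+ 2 - g x * b x ^+ 2.
pose G3 x := g x * (a x * b x).
have bG1 : bmeas D G1 by exact: bmeasD.
have bG2 : bmeas D G2 by exact: bmeasB.
have bc n : bmeas D (fun x => cos (n%:R * x)) by exact: bmeas_cosM.
have bs n : bmeas D (fun x => sin (n%:R * x)) by exact: bmeas_sinM.
have -> : (fun n => Ipi (fun x => g x * osc a b n x ^+ 2)) = (fun n =>
   2^-1 * Ipi G1 + (2^-1 * Ipi (fun x => G2 x * cos (n.*2%:R * x)) +
   Ipi (fun x => G3 x * sin (n.*2%:R * x)))).
  apply/funext => n.
  have b2 := bmeasM bG2 (bc n.*2); have b3 := bmeasM gab (bs n.*2).
  rewrite -!(posfunZ posfun_Ipi)// -!(posfunD posfun_Ipi)//;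
    try by repeat (first [exact: bmeasZ|apply: bmeasD]).
  congr Ipi; apply/funext => x.
  by rewrite /osc /G1 /G2 /G3 cos2n sin2n !sqrrD !exprMn mcos; field.
have -> : (fun x => g x * (a x ^+ 2 + b x ^+ 2)) = G1.
  by apply/funext => x; rewrite /G1 mulrDr.
rewrite -[X in _ --> X]addr0 -[X in _ + X]addr0 -[X in _ + (X + _)](mulr0 2^-1).
apply: cvgD; first exact: cvg_cst.
apply: cvgD; last exact: (cvg_double (riemann_lebesgue_sin gab)).
by apply: cvgM; [exact: cvg_cst|exact: (cvg_double (riemann_lebesgue_cos bG2))].
Qed.

(** The two oscillations are a quarter period apart, so that their product has no mean, only terms
    of frequency 2n. *)
Lemma cvg_osc_conj :
  Ipi (fun x => g x * (osc a b n x * osc (fun y => - b y) a n x)) @[n --> \oo] --> (0 : R).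
Proof.
pose G2 x := g x * a x ^+ 2 - g x * b x ^+ 2.
pose G3 x := - (g x * (a x * b x)).
have bG2 : bmeas D G2 by exact: bmeasB.
have bG3 : bmeas D G3 by exact: bmeasN.
have bc n : bmeas D (fun x => cos (n%:R * x)) by exact: bmeas_cosM.
have bs n : bmeas D (fun x => sin (n%:R * x)) by exact: bmeas_sinM.
have -> : (fun n => Ipi (fun x => g x * (osc a b n x * osc (fun y => - b y) a n x))) = (fun n =>
   2^-1 * Ipi (fun x => G2 x * sin (n.*2%:R * x)) + Ipi (fun x => G3 x * cos (n.*2%:R * x))).
  apply/funext => n.
  have b2 := bmeasM bG2 (bs n.*2); have b3 := bmeasM bG3 (bc n.*2).
  rewrite -!(posfunZ posfun_Ipi)// -!(posfunD posfun_Ipi)//;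
    try by repeat (first [exact: bmeasZ|apply: bmeasD]).
  congr Ipi; apply/funext => x.
  by rewrite /osc /G2 /G3 cos2n sin2n; field.
rewrite -[X in _ --> X]addr0 -[X in _ --> X + _](mulr0 2^-1).
apply: cvgD; last exact: (cvg_double (riemann_lebesgue_cos bG3)).
by apply: cvgM; [exact: cvg_cst|exact: (cvg_double (riemann_lebesgue_sin bG2))].
Qed.

End Osc.
End ThetaLimits.

(** * Jacobi weights with point masses *)

Section SzegoFunctions.
Context {R : realType}.
Notation D := `[0, (pi : R)]%classic.
Implicit Types (s t x y : R).

(** At x = cos y the bases are |1 - e^(iy)|^2 and |1 + e^(iy)|^2; the factors 2 make the weight
    match [eqd_prod] without constants. *)
Definition wgt s t x := (2 - 2 * x) `^ s * (2 + 2 * x) `^ t.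

Lemma wgt_ge0 s t x : 0 <= wgt s t x.
Proof. by rewrite mulr_ge0 ?powR_ge0. Qed.

Lemma wgtV s t x : -1 < x < 1 -> wgt s t x * wgt (- s) (- t) x = 1.
Proof.
move=> /andP[x1 x2]; rewrite /wgt mulrACA -!powRD ?subrr ?powRr0 ?mulr1//;
  by rewrite eqxx/=; lra.
Qed.

Lemma measurable_wgt s t : measurable_fun setT (wgt s t).
Proof.
apply: measurable_funM; apply: (measurableT_comp (measurable_powR _));
  [apply: measurable_funB|apply: measurable_funD] => //; exact: measurable_funM.
Qed.

Lemma measurable_wgt_cos s t : measurable_fun setT (fun y => wgt s t (cos y)).
Proof.
apply: (measurableT_comp (measurable_wgt s t)).
by apply: continuous_measurable_fun; exact: continuous_cos.
Qed.

Lemma eqd1M t psi : eqd 1 (t - psi) * eqd 1 (t + psi) = (2 * (cos t - cos psi)) ^+ 2 :> R.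
Proof.
transitivity (4 * (1 - 2 * cos t * cos psi + cos t ^+ 2 * cos psi ^+ 2 -
    sin t ^+ 2 * sin psi ^+ 2)); first by rewrite /eqd cosB cosD; ring.
by rewrite !sin2cos2; ring.
Qed.

Lemma eqd_prod1 (L : seq (R * R)) t :
  eqd_prod L 1 t = \prod_(l <- L) ((2 * (cos t - cos l.1)) ^+ 2) `^ l.2.
Proof. by apply: eq_bigr => l _; rewrite eqd1M. Qed.

Lemma eqd_prod1_gt0 (L : seq (R * R)) t :
  (forall l, l \in L -> cos t != cos l.1) -> 0 < eqd_prod L 1 t.
Proof.
move=> tL; rewrite eqd_prod1 big_seq; apply: prodr_gt0 => l lL.
by rewrite powR_gt0// exprn_even_gt0//= mulf_neq0// subr_eq0 tL.
Qed.

Lemma bmeas_eqd_prod1 (L : seq (R * R)) : (forall l, l \in L -> 0 <= l.2) ->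
  bmeas D (eqd_prod L 1).
Proof.
move=> L0; rewrite (funext (eqd_prod1 L)); apply: bmeas_prod => l lL.
split; last first.
  exists (16 `^ l.2) => t _; rewrite ger0_norm ?powR_ge0//.
  rewrite ge0_ler_powR ?nnegrE ?sqr_ge0 ?L0//.
  have := cos_le1 t; have := cos_geN1 t; have := cos_le1 l.1; have := cos_geN1 l.1.
  move: (cos t) (cos l.1) => x y h1 h2 h3 h4.
  rewrite (_ : 16 = 4 ^+ 2 :> R); last ring.
  by rewrite -[leLHS]real_normK ?num_real// lerXn2r ?nnegrE// ler_norml; lra.
apply: (measurableT_comp (measurable_powR _)); apply: measurable_funX.
apply: measurable_funM => //; apply: measurable_funB => //.
by apply: continuous_measurable_fun; exact: continuous_cos.
Qed.


(** Pointwise convergence can fail only at the finitely many zeros of the product, a null set, and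
    the uniform bound gives the domination. *)
Lemma szego_weighted (L : seq (R * R)) :
  (forall l, l \in L -> 0 <= l.2 /\ D l.1) ->
  exists2 q : nat -> {poly R}, (forall j, (q j)`_0 = 1) &
  (exists C, forall j t, nsq (circ (q j) t) * eqd_prod L 1 t <= C) /\
  (forall g, bmeas D g ->
    Ipi (fun t => g t * (nsq (circ (q j) t) * eqd_prod L 1 t)) @[j --> \oo] --> Ipi g).
Proof.
move=> L0; have [l /L0[]//|q q0 [[C hC] hq]] := @szego_sequence _ L.
exists q => //; split; first by exists C.
move=> g bg; have [_ [M gM]] := bg.
apply: (@Ipi_dominated _ _ _ (M * C) [set` [seq l.1 | l <- L]]) => //.
- move=> j; apply: bmeasM => //; apply: bmeasM; last first.
    by apply: bmeas_eqd_prod1 => l /L0[].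
  by apply: bmeasD; apply: bmeasX; [exact: bmeas_Re_circ|exact: bmeas_Im_circ].
- move=> j t Dt; rewrite normrM ler_pM ?gM// ger0_norm ?hC//.
  by rewrite mulr_ge0 ?nsq_ge0 ?eqd_prod_ge0.
- exact: finite_set_countable.
- move=> t Dt tL; rewrite -[X in _ --> X]mulr1; apply: cvgM; first exact: cvg_cst.
  apply: hq; apply: eqd_prod1_gt0 => l lL; apply: contra_not_neq tL => /cos_inj ->.
  + by rewrite /= map_f.
  + exact: Dt.
  + by have [] := L0 _ lL.
Qed.

Lemma sqr_powR_half y c : 0 <= y -> (y ^+ 2) `^ (c / 2) = y `^ c.
Proof.
move=> y0; rewrite -powR_mulrn// -powRrM; congr (_ `^ _); by field.
Qed.

Lemma nsq_circ_1DX t : nsq (circ (1 + 'X) t) = 2 + 2 * cos t :> R.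
Proof.
rewrite circD -[1 : {poly R}]/(1%:P) circC circ_X /nsq /= add0r sin2cos2; ring.
Qed.

Lemma nsq_circ_1BX t : nsq (circ (1 - 'X) t) = 2 - 2 * cos t :> R.
Proof.
rewrite circD circN -[1 : {poly R}]/(1%:P) circC circ_X /nsq /= add0r sqrrN sin2cos2; ring.
Qed.

Lemma nsq_circ_root (a t : R) :
  nsq (circ (1 - (2 * a) *: 'X + 'X ^+ 2) t) = (2 * (cos t - a)) ^+ 2.
Proof.
rewrite !circD circN circX -mul_polyC circM -[1 : {poly R}]/(1%:P) !circC circ_X.
rewrite expr2 /nsq/= !mul0r !subr0 !add0r.
have -> : 1 - 2 * a * cos t + (cos t * cos t - sin t * sin t) = 2 * cos t * (cos t - a).
  by rewrite -!expr2 sin2cos2; ring.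
rewrite addr0; have -> : - (2 * a * sin t) + (cos t * sin t + sin t * cos t) =
  2 * sin t * (cos t - a) by ring.
by rewrite !exprMn sin2cos2; ring.
Qed.

(** Here t may be negative, so W is first multiplied by |u|^2, where u is (1 + X) times the product
    of the 1 - 2 a_i X + X^2. The factor 1 + X raises the exponent at pi to t + 1 > 0, and the
    others create the zeros at e^(i acos a_i). The sequence is u times polynomials approximating the
    inverse of |u|^2 W. *)
Lemma szego_upper s t (k : nat) (a : 'I_k -> R) : 0 < s -> -1 < t ->
  (forall i, -1 <= a i <= 1) ->
  exists q : nat -> {poly R}, [/\ forall j, (q j)`_0 = 1,
    forall j i, nsq (circ (q j) (acos (a i))) = 0,
    exists C, forall j y, nsq (circ (q j) y) * wgt s t (cos y) <= C &
    forall g, bmeas D g ->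
      Ipi (fun y => g y * (nsq (circ (q j) y) * wgt s t (cos y))) @[j --> \oo] --> Ipi g].
Proof.
move=> s0 t1 a1.
pose L := [:: (0, s / 2), (pi, (t + 1) / 2) & [seq (acos (a i), 1) | i <- enum 'I_k]].
have L0 l : l \in L -> 0 <= l.2 /\ D l.1.
  rewrite !inE => /or3P[/eqP->|/eqP->|/mapP[i _ ->]] /=.
  - by rewrite in_itv/= lexx pi_ge0 divr_ge0// ltW.
  - by rewrite in_itv/= lexx pi_ge0 divr_ge0//; lra.
  - by rewrite in_itv/= acos_ge0// acos_lepi.
have [q q0 [[C hC] hq]] := szego_weighted L0.
pose u : {poly R} := (1 + 'X) * \prod_(i <- enum 'I_k) (1 - (2 * a i) *: 'X + 'X ^+ 2).
have u0 : u`_0 = 1.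
  rewrite -horner_coef0 hornerM horner_prod big1 => [|i _].
    by rewrite !hornerE ?addr0 ?mulr1.
  by rewrite !hornerE ?mulr0 ?subr0 ?expr0n ?addr0.
have uE y : nsq (circ u y) * wgt s t (cos y) = eqd_prod L 1 y.
  rewrite eqd_prod1 !big_cons big_map cos0 cospi circM nsqM nsq_circ_1DX circ_prod nsq_prod/=.
  have c1 : 0 <= 2 - 2 * cos y by have := cos_le1 y; lra.
  have c2 : 0 <= 2 + 2 * cos y by have := cos_geN1 y; lra.
  have -> : (2 * (cos y - 1)) ^+ 2 = (2 - 2 * cos y) ^+ 2 by ring.
  have -> : (2 * (cos y - -1)) ^+ 2 = (2 + 2 * cos y) ^+ 2 by ring.
  rewrite !sqr_powR_half// powRD; last by rewrite gt_eqF//; lra.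
  rewrite powRr1// /wgt.
  have -> : \prod_(i <- enum 'I_k) ((2 * (cos y - cos (acos (a i)))) ^+ 2) `^ 1 =
      \prod_(i <- enum 'I_k) nsq (circ (1 - (2 * a i) *: 'X + 'X ^+ 2) y).
    apply: eq_bigr => i _; rewrite nsq_circ_root powRr1 ?sqr_ge0// acosK//.
    by rewrite in_itv/= a1.
  by ring.
have uqE j y : nsq (circ (u * q j) y) * wgt s t (cos y) = nsq (circ (q j) y) * eqd_prod L 1 y.
  by rewrite -uE circM nsqM; ring.
exists (fun j => u * q j); split.
- by move=> j; rewrite coef0M u0 q0 mulr1.
- move=> j i; rewrite !circM !nsqM circ_prod nsq_prod.
  suff -> : \prod_(i0 <- enum 'I_k) nsq (circ (1 - (2 * a i0) *: 'X + 'X ^+ 2) (acos (a i))) = 0.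
    by rewrite mulr0 mul0r.
  apply/eqP; rewrite prodf_seq_eq0; apply/hasP; exists i; first by rewrite mem_enum.
  by rewrite /= nsq_circ_root acosK ?in_itv/= ?a1// subrr mulr0 expr0n.
- by exists C => j y; rewrite uqE hC.
- by move=> g bg; under [X in X @ _ --> _]eq_fun do under eq_fun do rewrite uqE; exact: hq.
Qed.

(** The weight 1/W may blow up at both ends; ((1 - X)(1 + X))^m with m > max(s, t) makes both
    exponents m - s and m - t positive. *)
Lemma szego_lower s t :
  exists r : nat -> {poly R}, [/\ forall j, (r j)`_0 = 1,
    exists C, forall j y, nsq (circ (r j) y) * wgt (- s) (- t) (cos y) <= C &
    Ipi (fun y => nsq (circ (r j) y) * wgt (- s) (- t) (cos y)) @[j --> \oo] --> (pi : R)].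
Proof.
have [m [ms mt m0]] : exists m : nat, [/\ s < m%:R, t < m%:R & (0 < m)%N].
  exists (Num.truncn (Num.max s t)).+1; split=> //.
    by rewrite (le_lt_trans _ (truncnS_gt _))// le_max lexx.
  by rewrite (le_lt_trans _ (truncnS_gt _))// le_max lexx orbT.
pose L := [:: ((0 : R), (m%:R - s) / 2); ((pi : R), (m%:R - t) / 2)].
have L0 l : l \in L -> 0 <= l.2 /\ D l.1.
  rewrite !inE => /orP[/eqP->|/eqP->] /=.
  - by rewrite in_itv/= lexx pi_ge0 divr_ge0//; lra.
  - by rewrite in_itv/= lexx pi_ge0 divr_ge0//; lra.
have [q q0 [[C hC] hq]] := szego_weighted L0.
pose u : {poly R} := ((1 - 'X) * (1 + 'X)) ^+ m.
have u0 : u`_0 = 1.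
  by rewrite -horner_coef0 horner_exp hornerM !hornerE ?subr0 ?addr0 ?mulr1 expr1n.
have uE y : nsq (circ u y) * wgt (- s) (- t) (cos y) = eqd_prod L 1 y.
  rewrite eqd_prod1 !big_cons big_nil cos0 cospi circX nsqX circM nsqM nsq_circ_1DX nsq_circ_1BX/=.
  have c1 : 0 <= 2 - 2 * cos y by have := cos_le1 y; lra.
  have c2 : 0 <= 2 + 2 * cos y by have := cos_geN1 y; lra.
  have -> : (2 * (cos y - 1)) ^+ 2 = (2 - 2 * cos y) ^+ 2 by ring.
  have -> : (2 * (cos y - -1)) ^+ 2 = (2 + 2 * cos y) ^+ 2 by ring.
  rewrite !sqr_powR_half// !powRD; try by rewrite gt_eqF//; lra.
  by rewrite !powR_mulrn// exprMn /wgt; ring.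
have uqE j y : nsq (circ (u * q j) y) * wgt (- s) (- t) (cos y) = nsq (circ (q j) y) * eqd_prod L 1 y.
  by rewrite -uE circM nsqM; ring.
exists (fun j => u * q j); split.
- by move=> j; rewrite coef0M u0 q0 mulr1.
- by exists C => j y; rewrite uqE hC.
- have h := hq (fun=> 1) (bmeas_cst _ _); rewrite Ipi_cst mul1r in h.
  under eq_fun do under eq_fun do rewrite uqE -[_ * _]mul1r.
  exact: h.
Qed.

End SzegoFunctions.

(** * The substitution x = cos y *)

Section ChangeOfVariables.
Context {R : realType}.
Notation mu := (@lebesgue_measure R).
Notation X := `[-1, (1 : R)]%classic.
Implicit Types (alpha beta : R) (h : R -> R).

Lemma measurable_jweight alpha beta : measurable_fun setT (@jweight R alpha beta).
Proof.
apply: measurable_funM; apply: (measurableT_comp (measurable_powR _));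
  [exact: measurable_funB|exact: measurable_funD].
Qed.

Lemma jweight_ge0 alpha beta x : 0 <= @jweight R alpha beta x.
Proof. by rewrite mulr_ge0 ?powR_ge0. Qed.

Lemma continuous_jweight alpha beta x : -1 < x < 1 ->
  {for x, continuous (@jweight R alpha beta)}.
Proof.
move=> /andP[x0 x1].
have c1 : {for 1 - x, continuous (fun y : R => y `^ alpha)}.
  by apply: continuous_powR; lra.
have c2 : {for 1 + x, continuous (fun y : R => y `^ beta)}.
  by apply: continuous_powR; lra.
apply: continuousM.
- apply: (@continuous_comp _ _ _ (fun y : R => 1 - y) (fun y => y `^ alpha)) => //.
  by apply: continuousB; [exact: cst_continuous|move=> ?].
- apply: (@continuous_comp _ _ _ (fun y : R => 1 + y) (fun y => y `^ beta)) => //.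
  by apply: continuousD; [exact: cst_continuous|move=> ?].
Qed.

(** The Jacobian sin y adds 1/2 to both exponents, and replacing 1 -+ x by 2 -+ 2x costs 2^(s + t) =
    2^(alpha + beta + 1). *)
Definition c0 alpha beta : R := 2 `^ (- (alpha + beta + 1)).

Lemma c0_gt0 alpha beta : 0 < c0 alpha beta.
Proof. by rewrite powR_gt0. Qed.

Lemma cos_itv_oo y : 0 < y < (pi : R) -> -1 < cos y < 1.
Proof.
move=> /andP[y0 y1]; apply/andP; split.
  by rewrite -cospi ltr_cos ?in_itv/= ?lexx ?pi_ge0 ?(ltW y0) ?(ltW y1).
by rewrite -[ltRHS]cos0 ltr_cos ?in_itv/= ?lexx ?pi_ge0 ?(ltW y0) ?(ltW y1).
Qed.

Lemma jweight_cos alpha beta y : 0 < y < pi ->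
  jweight alpha beta (cos y) * sin y =
  c0 alpha beta * wgt (alpha + 1 / 2) (beta + 1 / 2) (cos y) :> R.
Proof.
move=> y0; have /andP[c1 c2] := cos_itv_oo y0.
have -> : sin y = (1 - cos y) `^ (1 / 2) * (1 + cos y) `^ (1 / 2).
  have [/andP[y1 y2]] := y0; rewrite -powRM; [|lra|lra].
  rewrite (_ : (1 - cos y) * (1 + cos y) = sin y `^ 2%:R); last first.
    by rewrite powR_mulrn ?sin2cos2 ?sin_ge0_pi// ?(ltW y1) ?(ltW y2)//; ring.
  rewrite -powRrM (_ : _ * _ = 1); last by field.
  by rewrite powRr1// sin_ge0_pi// (ltW y1) (ltW y2).
rewrite /jweight mulrACA -!powRD; [|by apply/implyP => _; lra|by apply/implyP => _; lra].
rewrite /wgt (_ : 2 - 2 * cos y = 2 * (1 - cos y)); last ring.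
rewrite (_ : 2 + 2 * cos y = 2 * (1 + cos y)); last ring.
rewrite !powRM//; try lra.
have cE : c0 alpha beta * (2 `^ (alpha + 1 / 2) * 2 `^ (beta + 1 / 2)) = 1.
  rewrite /c0 -!powRD; try by rewrite pnatr_eq0 implybT.
  by rewrite (_ : _ + _ = 0) ?powRr0//; field.
set u := (1 - cos y) `^ _; set v := (1 + cos y) `^ _.
by rewrite -[LHS]mul1r -[X in X * _ = _]cE; ring.
Qed.

Lemma cov_cos h y1 y2 : 0 < y1 -> y1 <= y2 -> y2 < pi ->
  {within `[cos y2, cos y1], continuous h} ->
  (\int[mu]_(x in `[cos y2, cos y1]) (h x)%:E =
   \int[mu]_(y in `[y1, y2]) (h (cos y) * sin y)%:E)%E.
Proof.
move=> y10 y12 y2pi ch.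
have dcos (x : R) : derive1 (@cos R) x = - sin x.
  by rewrite derive1E; have [_ ->] := is_derive_cos x.
rewrite (@integration_by_substitution_decreasing R cos h y1 y2)//.
- by apply: eq_integral => y _; rewrite !fctE dcos opprK.
- move=> x y; rewrite !in_itv/= => /andP[xa xb] /andP[ya yb] xy.
  by rewrite ltr_cos ?in_itv//=; apply/andP; split; lra.
- rewrite (funext dcos) => x _; apply: continuousN; exact: continuous_sin.
- rewrite (funext dcos); apply: cvgP; apply: cvg_at_right_filter.
  by apply: cvgN; exact: continuous_sin.
- rewrite (funext dcos); apply: cvgP; apply: cvg_at_left_filter.
  by apply: cvgN; exact: continuous_sin.
- by apply: derivable_oo_LRcontinuousW => x; exact: derivable_cos.
Qed.

(** Compact subintervals of (0, pi) make the weight continuous, which the substitution theorem asks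
    for. *)
Lemma jweight_cov alpha beta h y1 y2 : 0 < y1 -> y1 <= y2 -> y2 < pi ->
  {within `[cos y2, cos y1], continuous h} ->
  (\int[mu]_(x in `[cos y2, cos y1]) (h x * jweight alpha beta x)%:E =
   \int[mu]_(y in `[y1, y2])
     (c0 alpha beta * (h (cos y) * wgt (alpha + 1 / 2) (beta + 1 / 2) (cos y)))%:E)%E.
Proof.
move=> y10 y12 y2pi ch.
have in_oo y : y \in `[y1, y2] -> 0 < y < pi.
  rewrite in_itv/= => /andP[ya yb].
  by rewrite (lt_le_trans y10)// (le_lt_trans yb).
rewrite (cov_cos y10 y12 y2pi).
  apply: eq_integral => y; rewrite inE/= => yy.
  by rewrite -mulrA jweight_cos ?in_oo// mulrCA.
have cj : {within `[cos y2, cos y1], continuous (jweight alpha beta)}.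
  apply: continuous_in_subspaceT => x; rewrite inE/= in_itv/= => /andP[xa xb].
  apply: continuous_jweight.
  have /andP[h1 _] : -1 < cos y2 < 1 by apply: cos_itv_oo; rewrite y2pi andbT; lra.
  have /andP[_ h2] : -1 < cos y1 < 1 by apply: cos_itv_oo; rewrite y10/=; lra.
  by rewrite (lt_le_trans h1)// (le_lt_trans xb).
by move=> x; apply: continuousM; [exact: ch|exact: cj].
Qed.
End ChangeOfVariables.

(** * The measure nu as a positive functional *)

Section NuFunctional.
Context {R : realType}.
Notation mu := (@lebesgue_measure R).
Notation D := `[0, (pi : R)]%classic.
Notation X := `[-1, (1 : R)]%classic.
Implicit Types (h g : R -> R).

Lemma bmeas_within (x1 x2 : R) h : measurable_fun setT h ->
  {within `[x1, x2], continuous h} -> bmeas `[x1, x2] h.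
Proof.
move=> mh ch; split=> //.
have [x12|x21] := leP x1 x2; last first.
  exists 0 => x /=; rewrite in_itv/= => /andP[ax xb].
  by move: (le_trans ax xb); rewrite leNgt x21.
have cn : {within `[x1, x2], continuous (fun x => `|h x|)}.
  move=> x; apply: (@continuous_comp (subspace _) _ _ h Num.norm); first exact: ch.
  exact: norm_continuous.
have [c _ cM] := EVT_max x12 cn.
by exists (`|h c|) => x /cM.
Qed.

Lemma bmeas_indicM (A D' : set R) h : measurable A -> bmeas A h ->
  bmeas D' (fun x => \1_A x * h x).
Proof.
move=> mA [mh [M hM]]; split; first by apply: measurable_funM => //; exact: measurable_indic.
exists `|M| => x _; rewrite indicE; case: (boolP (x \in A)) => [|_].
  by rewrite inE mul1r => /hM/le_trans; apply; exact: ler_norm.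
by rewrite mul0r normr0.
Qed.

Lemma continuous_wgt s t (x : R) : -1 < x < 1 -> {for x, continuous (wgt s t)}.
Proof.
move=> /andP[x0 x1].
have c1 : {for 2 - 2 * x, continuous (fun y : R => y `^ s)} by apply: continuous_powR; lra.
have c2 : {for 2 + 2 * x, continuous (fun y : R => y `^ t)} by apply: continuous_powR; lra.
apply: continuousM.
- apply: (@continuous_comp _ _ _ (fun y : R => 2 - 2 * y) (fun y => y `^ s)) => //.
  by apply: continuousB; [exact: cst_continuous|exact: mulrl_continuous].
- apply: (@continuous_comp _ _ _ (fun y : R => 2 + 2 * y) (fun y => y `^ t)) => //.
  by apply: continuousD; [exact: cst_continuous|exact: mulrl_continuous].
Qed.

Lemma bmeas_wgt_itv s t (y1 y2 : R) : 0 < y1 -> y1 <= y2 -> y2 < pi ->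
  bmeas `[cos y2, cos y1] (wgt s t).
Proof.
move=> y10 y12 y2pi; apply: bmeas_within; first exact: measurable_wgt.
apply: continuous_in_subspaceT => x; rewrite inE/= in_itv/= => /andP[xa xb].
apply: continuous_wgt.
have /andP[h1 _] : -1 < cos y2 < 1 by apply: cos_itv_oo; rewrite y2pi andbT; lra.
have /andP[_ h2] : -1 < cos y1 < 1 by apply: cos_itv_oo; rewrite y10/=; lra.
by rewrite (lt_le_trans h1)// (le_lt_trans xb).
Qed.

Lemma cos_itv (y1 y2 y : R) : 0 <= y1 -> y2 <= pi ->
  y \in `[y1, y2] -> cos y \in `[cos y2, cos y1].
Proof.
move=> y10 y2pi; rewrite !in_itv/= => /andP[ya yb].
by apply/andP; split; rewrite leNgt ltr_cos -?leNgt ?in_itv//=; apply/andP; split; lra.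
Qed.

Lemma bmeas_comp_cos (y1 y2 : R) g : 0 <= y1 -> y2 <= pi ->
  bmeas `[cos y2, cos y1] g -> bmeas `[y1, y2] (fun y => g (cos y)).
Proof.
move=> y10 y2pi [mg [M gM]]; split.
  by apply: (measurableT_comp mg); apply: continuous_measurable_fun; exact: continuous_cos.
by exists M => y yy; apply: gM; exact: cos_itv.
Qed.

Lemma Rintegral_indicM (A B : set R) g : measurable A -> A `<=` B ->
  \int[mu]_(x in B) (\1_A x * g x) = \int[mu]_(x in A) g x.
Proof.
move=> mA AB; rewrite -[in RHS](setIidr AB) Rintegral_mkcondr.
apply: eq_Rintegral => x _; rewrite patchE indicE.
by case: ifP => xA; rewrite ?mul1r ?mul0r.
Qed.

Context (alpha beta : R) (k : nat) (a M : 'I_k -> R).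
Context (a1 : forall i, -1 <= a i <= 1) (M0 : forall i, 0 < M i)
  (ij : mu.-integrable X (EFin \o jweight alpha beta)).
Notation s := (alpha + 1 / 2).
Notation t := (beta + 1 / 2).

Definition nuR g := fine (nu_int alpha beta a M g).

Lemma nu_intE g : bmeas X g -> nu_int alpha beta a M g =
  (\int[mu]_(x in X) (g x * jweight alpha beta x) + \sum_(i < k) M i * g (a i))%:E.
Proof.
move=> bg; rewrite /nu_int EFinD sumEFin; congr (_ + _)%E.
by rewrite /Rintegral fineK//; apply: integrable_fin_num => //; exact: integrable_bmeasM.
Qed.

Lemma nuRE g : bmeas X g -> nuR g =
  \int[mu]_(x in X) (g x * jweight alpha beta x) + \sum_(i < k) M i * g (a i).
Proof. by move=> bg; rewrite /nuR nu_intE. Qed.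

Lemma nu_int_nuR g : bmeas X g -> nu_int alpha beta a M g = (nuR g)%:E.
Proof. by move=> bg; rewrite nuRE// nu_intE. Qed.

Lemma posfun_nu : posfun X nuR.
Proof.
have pw : posfun X (fun f => \int[mu]_(x in X) (f x * jweight alpha beta x)).
  by apply: posfun_weight => // x _; exact: jweight_ge0.
split.
- move=> f g bf bg; rewrite !nuRE//; last exact: bmeasD.
  rewrite (posfunD pw)// [X in _ + X = _](_ : _ =
    \sum_(i < k) M i * f (a i) + \sum_(i < k) M i * g (a i)); first by rewrite addrACA.
  by rewrite -big_split/=; apply: eq_bigr => i _; rewrite mulrDr.
- move=> c f bf; rewrite !nuRE//; last exact: bmeasZ.
  rewrite (posfunZ pw)// mulrDr mulr_sumr; congr (_ + _).
  by apply: eq_bigr => i _; rewrite mulrCA.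
- move=> f g bf bg fg; rewrite !nuRE//; apply: lerD; first exact: (posfun_le pw).
  by apply: ler_sum => i _; rewrite ler_wpM2l ?(ltW (M0 _)) ?fg//= in_itv/= a1.
Qed.

Section Itv.
Context (y1 y2 : R) (y10 : 0 < y1) (y12 : y1 <= y2) (y2pi : y2 < pi) (h : R -> R).
Context (mh : measurable_fun setT h) (ch : {within `[cos y2, cos y1], continuous h}).
Let A : set R := `[cos y2, cos y1].

Lemma bmeas_itv_cos : bmeas `[y1, y2] (fun y => h (cos y) * wgt s t (cos y)).
Proof.
apply: (@bmeas_comp_cos _ _ (fun x => h x * wgt s t x)); [exact: ltW|exact: ltW|].
by apply: bmeasM; [exact: bmeas_within|exact: bmeas_wgt_itv].
Qed.

Lemma weight_itv :
  \int[mu]_(x in X) (\1_A x * h x * jweight alpha beta x) =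
  c0 alpha beta * Ipi (fun y => \1_`[y1, y2] y * (h (cos y) * wgt s t (cos y))).
Proof.
rewrite -(posfunZ posfun_Ipi); last by apply: bmeas_indicM => //; exact: bmeas_itv_cos.
have SD : `[y1, y2] `<=` D by apply: subset_itv; rewrite bnd_simp ltW.
have AX : A `<=` X by apply: subset_itv; rewrite bnd_simp ?cos_geN1 ?cos_le1.
transitivity (\int[mu]_(x in A) (h x * jweight alpha beta x)).
  rewrite -(Rintegral_indicM _ (measurable_itv _) AX).
  by apply: eq_Rintegral => x _; rewrite -mulrA.
rewrite /Ipi; transitivity (\int[mu]_(y in `[y1, y2])
    (c0 alpha beta * (h (cos y) * wgt s t (cos y)))).
  by rewrite /Rintegral jweight_cov.
rewrite -(Rintegral_indicM _ (measurable_itv _) SD).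
by apply: eq_Rintegral => y _; rewrite mulrCA.
Qed.

Lemma bmeas_indic_within : bmeas X (fun x => \1_A x * h x).
Proof. by apply: bmeas_indicM; [exact: measurable_itv|exact: (bmeas_within mh ch)]. Qed.

Lemma nu_itv : (forall i, ~ A (a i)) -> nuR (fun x => \1_A x * h x) =
  c0 alpha beta * Ipi (fun y => \1_`[y1, y2] y * (h (cos y) * wgt s t (cos y))).
Proof.
move=> aA; rewrite nuRE ?weight_itv; last exact: bmeas_indic_within.
rewrite big1 ?addr0// => i _; rewrite indicE memNset ?mul0r ?mulr0//.
Qed.

(** The masses contribute nonnegatively, so this half of [nu_itv] holds even when mass points lie in
    the interval. *)
Lemma nu_itv_ge : (forall x, A x -> 0 <= h x) ->
  c0 alpha beta * Ipi (fun y => \1_`[y1, y2] y * (h (cos y) * wgt s t (cos y))) <=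
  nuR (fun x => \1_A x * h x).
Proof.
move=> h0; rewrite nuRE ?weight_itv; last exact: bmeas_indic_within.
rewrite lerDl sumr_ge0// => i _; rewrite mulr_ge0 ?(ltW (M0 _))// indicE.
by case: (boolP (_ \in _)) => [/set_mem/h0|_]; rewrite ?mul1r ?mul0r.
Qed.

End Itv.
End NuFunctional.

(** * From compact subintervals to the whole of [-1, 1] *)

Section Exhaustion.
Context {R : realType}.
Notation mu := (@lebesgue_measure R).
Notation D := `[0, (pi : R)]%classic.
Notation X := `[-1, (1 : R)]%classic.

(** Monotone convergence along the images of [1/(n+1), pi - 1/(n+1)], which increase to (-1, 1). *)
Lemma integral_exhaust (g : R -> R) (C : R) : measurable_fun X g ->
  (forall x, X x -> 0 <= g x) ->
  (forall y1 y2, 0 < y1 -> y1 <= y2 -> y2 < pi ->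
    (\int[mu]_(x in `[cos y2, cos y1]) (g x)%:E <= C%:E)%E) ->
  (\int[mu]_(x in X) (g x)%:E <= C%:E)%E.
Proof.
move=> mg g0 gC; pose e n : R := n.+1%:R^-1.
have e0 n : 0 < e n by rewrite invr_gt0.
have e1 n : e n <= 1 by rewrite invf_le1// ler1n.
have pi2 := pi_ge2 R.
pose A n : set R := `[cos (pi - e n), cos (e n)]%classic.
have AX n : A n `<=` X by apply: subset_itv; rewrite bnd_simp ?cos_geN1 ?cos_le1.
have AE : \bigcup_n A n = `]-1, (1 : R)[%classic.
  apply/seteqP; split=> x.
    move=> [n _]; rewrite /A /= !in_itv/= => /andP[xa xb].
    have en := e0 n; have en1 := e1 n.
    have /andP[h1 _] : -1 < cos (pi - e n) < 1 by apply: cos_itv_oo; apply/andP; split; lra.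
    have /andP[_ h2] : -1 < cos (e n) < 1 by apply: cos_itv_oo; apply/andP; split; lra.
    by rewrite (lt_le_trans h1)// (le_lt_trans xb).
  rewrite /= in_itv/= => /andP[xa xb].
  have x1 : -1 <= x <= 1 by rewrite !ltW.
  have y0 : 0 < acos x by rewrite acos_gt0// ltW.
  have ypi : acos x < pi by rewrite acos_ltpi// xa ltW.
  have m0 : 0 < Num.min (acos x) (pi - acos x) by rewrite lt_min y0 subr_gt0.
  exists (Num.truncn (Num.min (acos x) (pi - acos x))^-1) => //.
  have : e (Num.truncn (Num.min (acos x) (pi - acos x))^-1) <= Num.min (acos x) (pi - acos x).
    rewrite /e -[leRHS]invrK lef_pV2 ?posrE ?invr_gt0//.
    by rewrite ltW// truncnS_gt.
  rewrite le_min; set n := Num.truncn _ => /andP[ea eb].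
  have en := e0 n.
  have h : acos x \in `[e n, pi - e n] by rewrite in_itv/=; apply/andP; split; lra.
  have hpi : pi - e n <= pi by lra.
  have := cos_itv (ltW en) hpi h; rewrite acosK; last by rewrite in_itv/= x1.
  by [].
have -> : (\int[mu]_(x in X) (g x)%:E = \int[mu]_(x in \bigcup_n A n) (g x)%:E)%E.
  rewrite AE integral_itv_bndo_bndc; last first.
    apply/measurable_EFinP; apply: measurable_funS mg => //.
    by apply: subset_itv; rewrite bnd_simp.
  rewrite integral_itv_obnd_cbnd//.
  apply/measurable_EFinP; apply: measurable_funS mg => //.
  by apply: subset_itv; rewrite bnd_simp.
have mA n : measurable (A n) by exact: measurable_itv.
have cv : (\int[mu]_(x in A n) (g x)%:E @[n --> \oo] -->
    \int[mu]_(x in \bigcup_n A n) (g x)%:E)%E.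
  apply: ge0_nondecreasing_set_cvg_integral => //.
  - move=> n m nm; rewrite subsetEset; apply: subset_itv; rewrite bnd_simp.
    + have := e0 n; have := e0 m; have := e1 n; have := e1 m.
      have : e m <= e n by rewrite lef_pV2 ?posrE ?ltr0n// ler_nat.
      move=> *; rewrite leNgt ltr_cos -?leNgt ?in_itv/=; try (apply/andP; split); lra.
    + have := e0 n; have := e0 m; have := e1 n; have := e1 m.
      have : e m <= e n by rewrite lef_pV2 ?posrE ?ltr0n// ler_nat.
      move=> *; rewrite leNgt ltr_cos -?leNgt ?in_itv/=; try (apply/andP; split); lra.
  - by move=> n; apply/measurable_EFinP; apply: measurable_funS mg => //; exact: measurable_itv.
  - by move=> n x Ax; rewrite lee_fin g0//; exact: AX Ax.
rewrite -(cvg_lim _ cv)//; apply: lime_le; first by apply: cvgP cv.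
apply: nearW => n; apply: gC => //.
- by have := e1 n; lra.
- by have := e0 n; lra.
Qed.

Context (alpha beta : R) (k : nat) (a M : 'I_k -> R).
Notation s := (alpha + 1 / 2).
Notation t := (beta + 1 / 2).

(* A non-integrable weight would give [P 0] an infinite norm. *)
Lemma integrable_jweight (P : nat -> {poly R}) : orthonormal_family alpha beta a M P ->
  mu.-integrable X (EFin \o jweight alpha beta).
Proof.
move=> [sP [_ oP]]; have [c c0 Pc] : exists2 c, c != 0 & P 0%N = c%:P.
  by have /eqP/size_poly1P := sP 0%N.
have := oP 0%N 0%N; rewrite Pc eqxx /nu_int sumEFin => nu1.
have fin : (\int[mu]_(x in X) (c * c * jweight alpha beta x)%:E < +oo)%E.
  move: nu1; under eq_integral do rewrite !hornerC.
  by case: (integral _ _ _) => //= r; rewrite ltry.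
have mj : measurable_fun X (jweight alpha beta) by apply: measurable_funTS; exact: measurable_jweight.
have ic : mu.-integrable X (EFin \o (fun x => c * c * jweight alpha beta x)).
  apply/integrableP; split; first by apply/measurable_EFinP; apply: measurable_funM.
  rewrite (_ : integral _ _ _ = integral mu X (fun x => (c * c * jweight alpha beta x)%:E))//.
  apply: eq_integral => x _; rewrite /= ger0_norm//.
  by rewrite mulr_ge0 ?jweight_ge0// -expr2 sqr_ge0.
have mX : measurable X by exact: measurable_itv.
have := integrable_bmeasM mX (bmeas_cst X (c * c)^-1) ic.
rewrite (_ : (fun x => _) = jweight alpha beta)//.
by apply/funext => x; rewrite mulKf ?mulf_neq0.
Qed.

Context (ij : mu.-integrable X (EFin \o jweight alpha beta)).
Notation nuR := (nuR alpha beta a M).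

Lemma bmeas_hornerX (p : {poly R}) : bmeas X (fun x => p.[x]).
Proof.
apply: bmeas_horner; exists 1 => x; rewrite /= in_itv/= => /andP[h1 h2].
by rewrite ler_norml h1.
Qed.

(** The masses drop out because p vanishes at every [a i]. Exhaustion gives the inequality in the
    direction needed, an upper bound for the norm. *)
Lemma nu_sq_le (p : {poly R}) : (forall i, p.[a i] = 0) ->
  bmeas D (fun y => p.[cos y] ^+ 2 * wgt s t (cos y)) ->
  nuR (fun x => p.[x] ^+ 2) <= c0 alpha beta * Ipi (fun y => p.[cos y] ^+ 2 * wgt s t (cos y)).
Proof.
move=> pa bG; have bp : bmeas X (fun x => p.[x] ^+ 2) by apply: bmeasX; exact: bmeas_hornerX.
rewrite nuRE// [X in _ + X]big1 ?addr0 => [|i _]; last by rewrite pa expr0n mulr0.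
rewrite -lee_fin /Rintegral fineK; last first.
  by apply: integrable_fin_num => //; exact: integrable_bmeasM.
have mj : measurable_fun X (jweight alpha beta) by apply: measurable_funTS; exact: measurable_jweight.
have c00 := c0_gt0 alpha beta.
have Doo : (mu D < +oo)%E by rewrite lebesgue_measure_itv/= lte_fin pi_gt0 -EFinD ltry.
have mD : measurable D by [].
apply: integral_exhaust.
- by apply: measurable_funM => //; apply: measurable_funTS; case: bp.
- by move=> x _; rewrite mulr_ge0 ?sqr_ge0 ?jweight_ge0.
move=> y1 y2 y10 y12 y2pi; rewrite jweight_cov//; last first.
  apply: continuous_subspaceT => x.
  apply: (@continuous_comp _ _ _ (fun x => p.[x]) (fun z : R => z ^+ 2)).
    exact: continuous_horner.
  exact: exprn_continuous.
rewrite -(posfunZ posfun_Ipi)// /Ipi /Rintegral fineK; last first.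
  by apply: integrable_fin_num => //; apply: integrable_bmeas => //; exact: bmeasZ.
apply: ge0_subset_integral => //.
- by apply/measurable_EFinP; apply: measurable_funTS; have [] := bmeasZ (c0 alpha beta) bG.
- by move=> x _; rewrite lee_fin mulr_ge0 ?(ltW c00)// mulr_ge0 ?sqr_ge0// wgt_ge0.
- by apply: subset_itv; rewrite bnd_simp ltW.
Qed.

End Exhaustion.

(** * Mean-square asymptotics of the orthonormal polynomials *)

Section StrongAsymptotics.
Context {R : realType}.
Notation D := `[0, (pi : R)]%classic.
Notation X := `[-1, (1 : R)]%classic.
Context (alpha beta : R) (k : nat) (a M : 'I_k -> R) (P : nat -> {poly R}).
Context (a1 : forall i, -1 <= a i <= 1) (M0 : forall i, 0 < M i).
Context (oP : orthonormal_family alpha beta a M P).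
Notation s := (alpha + 1 / 2).
Notation t := (beta + 1 / 2).
Notation N := (nuR alpha beta a M).
Notation c0 := (c0 alpha beta).

Let ij := integrable_jweight oP.
Let pN : posfun X N := posfun_nu a1 M0 ij.
Let sP n : size (P n) = n.+1 := oP.1 n.

Let bP (p : {poly R}) : bmeas X (fun x => p.[x]) := bmeas_hornerX p.

Lemma bmeas_hornerM (p q : {poly R}) : bmeas X (fun x => p.[x] * q.[x]).
Proof. exact: bmeasM. Qed.

Lemma nu_orthonormal j l : N (fun x => (P j).[x] * (P l).[x]) = (j == l)%:R.
Proof. by rewrite /nuR oP.2.2. Qed.

Definition lead n := lead_coef (P n).

Lemma lead_gt0 n : 0 < lead n. Proof. exact: oP.2.1. Qed.

Lemma orthonormal_span n (p : {poly R}) : (size p <= n)%N ->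
  exists c : nat -> R, p = \sum_(j < n) c j *: P j.
Proof.
elim: n p => [|n IH] p sp.
  by exists (fun=> 0); rewrite big_ord0; apply/eqP; rewrite -size_poly_leq0.
have [|c pc] := IH (p - (p`_n / lead n) *: P n).
  apply/leq_sizeP => j; rewrite leq_eqVlt => /predU1P[<-|nj].
    rewrite coefB coefZ; have -> : (P n)`_n = lead n by rewrite /lead lead_coefE sP.
    by rewrite divfK ?subrr// lt0r_neq0// lead_gt0.
  rewrite coefB coefZ [(P n)`_j]nth_default ?sP// [p`_j]nth_default ?mulr0 ?subrr//.
  exact: leq_trans sp nj.
exists (fun j => if (j < n)%N then c j else p`_n / lead n).
rewrite big_ord_recr/= ltnn -[LHS](subrK ((p`_n / lead n) *: P n)) pc; congr (_ + _).
by apply: eq_bigr => j _; rewrite ltn_ord.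
Qed.

Lemma nu_orthogonal n (p : {poly R}) : (size p <= n)%N ->
  N (fun x => (P n).[x] * p.[x]) = 0.
Proof.
move=> /orthonormal_span[c ->].
rewrite (_ : (fun x => _) = fun x => \sum_(j < n) c j * ((P n).[x] * (P j).[x])); last first.
  apply/funext => x; rewrite horner_sum mulr_sumr; apply: eq_bigr => j _.
  by rewrite hornerZ mulrCA.
rewrite (posfun_sum pN) => [|j]; last by apply: bmeasZ; exact: bmeas_hornerM.
apply: big1 => j _; rewrite (posfunZ pN); last exact: bmeas_hornerM.
by rewrite nu_orthonormal gtn_eqF ?mulr0.
Qed.

(** Subtracting the right multiple of [P n] lowers the degree, and what remains is orthogonal to
    [P n]. *)
Lemma nu_lead n (p : {poly R}) : (size p <= n.+1)%N ->
  N (fun x => (P n).[x] * p.[x]) = p`_n / lead n.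
Proof.
move=> sp; pose q := p - (p`_n / lead n) *: P n.
have sq : (size q <= n)%N.
  apply/leq_sizeP => j; rewrite leq_eqVlt => /predU1P[<-|nj].
    rewrite coefB coefZ; have -> : (P n)`_n = lead n by rewrite /lead lead_coefE sP.
    by rewrite divfK ?subrr// lt0r_neq0// lead_gt0.
  rewrite coefB coefZ [(P n)`_j]nth_default ?sP// [p`_j]nth_default ?mulr0 ?subrr//.
  exact: leq_trans sp nj.
have -> : (fun x => (P n).[x] * p.[x]) = fun x =>
    (P n).[x] * q.[x] + (p`_n / lead n) * ((P n).[x] * (P n).[x]).
  by apply/funext => x; rewrite /q hornerD hornerN hornerZ; set e := _ / _; ring.
rewrite (posfunD pN); [|exact: bmeas_hornerM|by apply: bmeasZ; exact: bmeas_hornerM].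
rewrite nu_orthogonal// (posfunZ pN); last exact: bmeas_hornerM.
by rewrite nu_orthonormal eqxx mulr1 add0r.
Qed.

(** Twice the inner product of [P n] with R_n, see [nu_rev_cheb]; a lower bound for it is what
    forces the two to be close. *)
Definition kap n : R := 2 ^+ n / lead n.

Lemma kap_gt0 n : 0 < kap n.
Proof. by rewrite divr_gt0 ?lead_gt0// exprn_gt0. Qed.

Lemma nu_rev_cheb (q : {poly R}) n : q`_0 = 1 -> (size q <= n.+1)%N ->
  N (fun x => (P n.+1).[x] * (rev_cheb q n.+1).[x]) = kap n.+1 / 2.
Proof.
move=> q0 sq; rewrite nu_lead ?size_rev_cheb// coef_rev_cheb// /kap exprS.
by field; rewrite lt0r_neq0// lead_gt0.
Qed.

Definition circ_osc (q : {poly R}) := osc (fun y => Re (circ q y)) (fun y => Im (circ q y)).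

Lemma rev_cheb_osc (q : {poly R}) n y : (size q <= n)%N ->
  (rev_cheb q n).[cos y] = circ_osc q n y.
Proof. exact: rev_cheb_cos. Qed.

Lemma circ_osc_le q n y : circ_osc q n y ^+ 2 <= nsq (circ q y).
Proof. exact: osc_norm. Qed.

Lemma rev_cheb_sq_le (q : {poly R}) n y : (size q <= n)%N ->
  (rev_cheb q n).[cos y] ^+ 2 <= nsq (circ q y).
Proof. by move=> /rev_cheb_osc->; exact: circ_osc_le. Qed.

Section Upper.
Context (q : {poly R}) (qa : forall i, nsq (circ q (acos (a i))) = 0).
Context (C : R) (qC : forall y, nsq (circ q y) * wgt s t (cos y) <= C).

Lemma bmeas_wgt_le (f : R -> R) : measurable_fun setT f ->
  (forall y, `|f y| <= nsq (circ q y)) -> bmeas D (fun y => wgt s t (cos y) * f y).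
Proof.
move=> mf fq; split.
  by apply: measurable_funM => //; exact: measurable_wgt_cos.
exists C => y _; rewrite normrM ger0_norm ?wgt_ge0//.
by rewrite (le_trans _ (qC y))// mulrC ler_wpM2r ?wgt_ge0.
Qed.

Let mRe : measurable_fun setT (fun y => Re (circ q y)) := (bmeas_Re_circ q 0 1).1.
Let mIm : measurable_fun setT (fun y => Im (circ q y)) := (bmeas_Im_circ q 0 1).1.

Lemma bmeas_wgt_Re : bmeas D (fun y => wgt s t (cos y) * Re (circ q y) ^+ 2).
Proof.
apply: bmeas_wgt_le => [|y]; first exact: measurable_funX.
by rewrite ger0_norm ?sqr_ge0// lerDl sqr_ge0.
Qed.

Lemma bmeas_wgt_Im : bmeas D (fun y => wgt s t (cos y) * Im (circ q y) ^+ 2).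
Proof.
apply: bmeas_wgt_le => [|y]; first exact: measurable_funX.
by rewrite ger0_norm ?sqr_ge0// lerDr sqr_ge0.
Qed.

Lemma bmeas_wgt_ReIm : bmeas D (fun y => wgt s t (cos y) * (Re (circ q y) * Im (circ q y))).
Proof.
apply: bmeas_wgt_le => [|y]; first exact: measurable_funM.
rewrite /nsq; move: (Re _) (Im _) => u v.
by rewrite ler_norml; have := sqr_ge0 (u + v); have := sqr_ge0 (u - v); nra.
Qed.

Lemma nu_rev_cheb_sq_le n : (size q <= n)%N ->
  N (fun x => (rev_cheb q n).[x] ^+ 2) <=
  c0 * Ipi (fun y => wgt s t (cos y) * circ_osc q n y ^+ 2).
Proof.
move=> qn.
have E : (fun y => wgt s t (cos y) * circ_osc q n y ^+ 2) =
    fun y => (rev_cheb q n).[cos y] ^+ 2 * wgt s t (cos y).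
  by apply/funext => y; rewrite rev_cheb_osc// mulrC.
rewrite E.
apply: nu_sq_le => // [i|].
  (* R_n(a_i)^2 is at most |q|^2 at e^(i acos a_i), which is 0. *)
  apply/eqP; rewrite -sqrf_eq0 eq_le sqr_ge0 andbT -(qa i).
  by rewrite -{1}[a i](acosK) ?in_itv/= ?a1// rev_cheb_sq_le.
rewrite -E.
apply: bmeas_wgt_le => [|y]; last by rewrite ger0_norm ?sqr_ge0// circ_osc_le.
apply: measurable_funX; apply: measurable_funD; apply: measurable_funM => //.
- exact: (bmeas_cosM n%:R 0 1).1.
- exact: (bmeas_sinM n%:R 0 1).1.
Qed.

Lemma cvg_wgt_osc_sq : Ipi (fun y => wgt s t (cos y) * circ_osc q n y ^+ 2) @[n --> \oo] -->
  2^-1 * Ipi (fun y => nsq (circ q y) * wgt s t (cos y)).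
Proof.
have -> : (fun y => nsq (circ q y) * wgt s t (cos y)) = fun y =>
    wgt s t (cos y) * (Re (circ q y) ^+ 2 + Im (circ q y) ^+ 2).
  by apply/funext => y; rewrite mulrC.
exact: (cvg_osc_sq bmeas_wgt_Re bmeas_wgt_Im bmeas_wgt_ReIm).
Qed.

End Upper.

Section Lower.
Context (r : {poly R}) (r0 : r`_0 = 1).
Context (C : R) (rC : forall y, nsq (circ r y) * wgt (- s) (- t) (cos y) <= C).

(* [Re (e^{i n y} r(e^{i y}))]: multiplying by [r] only raises frequencies, so
   pairing with a polynomial of degree [n] in [cos y] sees its leading coefficient alone. *)
Definition fwd_osc := osc (fun y => Re (circ r y)) (fun y => - Im (circ r y)).

Lemma fwd_oscE n y : fwd_osc n y = \sum_(j < size r) r`_j * cos ((n + j)%:R * y).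
Proof.
rewrite /fwd_osc /osc Re_circ Im_circ -sumrN !mulr_sumr -big_split/=.
by apply: eq_bigr => j _; rewrite natrD mulrDl cosD; ring.
Qed.

Lemma bmeas_fwd_osc n : bmeas D (fwd_osc n).
Proof.
apply: bmeasD; apply: bmeasM; [exact: bmeas_cosM|exact: bmeas_Re_circ|exact: bmeas_sinM|].
by apply: bmeasN; exact: bmeas_Im_circ.
Qed.

Lemma bmeas_horner_cos (p : {poly R}) : bmeas D (fun y => p.[cos y]).
Proof.
apply: bmeas_continuous => y; apply: (@continuous_comp _ _ _ cos (fun x => p.[x])).
  exact: continuous_cos.
exact: continuous_horner.
Qed.

Lemma Ipi_fwd_osc n (p : {poly R}) : (size p <= n.+2)%N ->
  Ipi (fun y => p.[cos y] * fwd_osc n.+1 y) = pi * p`_n.+1 / 2 ^+ n.+1.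
Proof.
move=> sp.
have -> : (fun y => p.[cos y] * fwd_osc n.+1 y) = fun y =>
    \sum_(j < size r) r`_j * (p.[cos y] * cos ((n + j).+1%:R * y)).
  apply/funext => y; rewrite fwd_oscE mulr_sumr; apply: eq_bigr => j _.
  by rewrite mulrCA addSn.
have b j : bmeas D (fun y => p.[cos y] * cos ((n + j).+1%:R * y)).
  by apply: bmeasM; [exact: bmeas_horner_cos|exact: bmeas_cosM].
rewrite (posfun_sum posfun_Ipi) => [|j]; last exact: bmeasZ.
have sr : (0 < size r)%N.
  by rewrite lt0n size_poly_eq0; apply/eqP => r00; move: r0; rewrite r00 coef0 => /esym/eqP; rewrite oner_eq0.
case: (size r) sr => // m _; rewrite big_ord_recl (posfunZ posfun_Ipi)// addn0 r0 mul1r.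
rewrite Ipi_horner_cos// big1 ?addr0// => j _; rewrite (posfunZ posfun_Ipi)// Ipi_horner_cos.
  by rewrite [p`_ _]nth_default ?mulr0 ?mul0r ?mulr0// (leq_trans sp)// lift0 addnS !ltnS leq_addr.
by rewrite (leq_trans sp)// !ltnS leq_addr.
Qed.

Lemma bmeas_fwd_wgt n : bmeas D (fun y => wgt (- s) (- t) (cos y) * fwd_osc n y ^+ 2).
Proof.
split.
  apply: measurable_funM; first exact: measurable_wgt_cos.
  by apply: measurable_funX; exact: (bmeas_fwd_osc n).1.
exists C => y _; rewrite normrM !ger0_norm ?wgt_ge0 ?sqr_ge0//.
rewrite (le_trans _ (rC y))// mulrC ler_wpM2r ?wgt_ge0//.
by rewrite (le_trans (osc_norm _ _ _ _))// sqrrN.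
Qed.

(** Cauchy-Schwarz with the weight split as W^(1/2) W^(-1/2): the pairing sees the leading
    coefficient, and c0 times the integral of (P_n)^2 W is at most the nu-norm, which is 1. W^(1/2)
    may be unbounded at the ends, so the estimate is made on [1/(j+1), pi - 1/(j+1)] and then j
    tends to infinity. *)
Lemma kap_lower n : (pi / kap n.+1) ^+ 2 <=
  c0^-1 * Ipi (fun y => wgt (- s) (- t) (cos y) * fwd_osc n.+1 y ^+ 2).
Proof.
set B := c0^-1 * _.
pose p := P n.+1.
have c00 : 0 < c0 by exact: c0_gt0.
have IE : Ipi (fun y => p.[cos y] * fwd_osc n.+1 y) = pi / kap n.+1.
  rewrite Ipi_fwd_osc ?sP// /kap invf_div mulrA.
  by rewrite (_ : p`_n.+1 = lead n.+1)// /lead lead_coefE sP.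
pose e j : R := j.+1%:R^-1.
have e0 j : 0 < e j by rewrite invr_gt0.
have e1 j : e j <= 1 by rewrite invf_le1// ler1n.
have pi2 := pi_ge2 R.
pose S j : set R := `[e j, pi - e j]%classic.
have mS j : measurable (S j) by exact: measurable_itv.
have SD j : S j `<=` D by apply: subset_itv; rewrite bnd_simp; have := e0 j; lra.
have cv : Ipi (fun y => \1_(S j) y * (p.[cos y] * fwd_osc n.+1 y)) @[j --> \oo] --> pi / kap n.+1.
  have bpf : bmeas D (fun y => p.[cos y] * fwd_osc n.+1 y).
    by apply: bmeasM; [exact: bmeas_horner_cos|exact: bmeas_fwd_osc].
  have [_ [K hK]] := bpf.
  rewrite -IE; apply: (@Ipi_dominated _ _ _ K [set 0; pi]) => //.
  - by move=> j; apply: bmeas_indicM => //; apply: bmeasS bpf.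
  - move=> j y Dy; rewrite indicE; case: (_ \in _); rewrite ?mul1r ?mul0r; first exact: hK.
    by rewrite normr0 (le_trans _ (hK _ Dy)).
  - by apply: finite_set_countable; rewrite finite_setU; split; exact: finite_set1.
  - move=> y /=; rewrite in_itv/= => /andP[y0 ypi] /not_orP[yn0 ynpi].
    have y0' : 0 < y by rewrite lt_def y0 andbT; apply/eqP.
    have ypi' : y < pi by rewrite lt_def ypi andbT; apply/eqP => /esym.
    have ce : e @ \oo --> (0 : R) by exact: cvg_harmonic.
    have m0 : 0 < Num.min y (pi - y) by rewrite lt_min y0' subr_gt0.
    apply: cvg_near_cst; move/cvgrPdist_lt : ce => /(_ _ m0); apply: filterS => j.
    rewrite sub0r normrN (gtr0_norm (e0 j)) lt_min => /andP[ey epi].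
    rewrite indicE mem_set ?mul1r// /S /= in_itv/=; apply/andP; split; lra.
suff h j : Ipi (fun y => \1_(S j) y * (p.[cos y] * fwd_osc n.+1 y)) ^+ 2 <= B.
  have cv2 : Ipi (fun y => \1_(S j) y * (p.[cos y] * fwd_osc n.+1 y)) ^+ 2 @[j --> \oo] -->
      (pi / kap n.+1) ^+ 2.
    by rewrite expr2; under eq_fun do rewrite expr2; exact: cvgM.
  rewrite -(cvg_lim _ cv2)//; apply: limr_le; first exact: cvgP cv2.
  exact: nearW.
have ej := e0 j; have ej1 := e1 j.
pose f y := \1_(S j) y * (p.[cos y] * wgt (s / 2) (t / 2) (cos y)).
pose g y := fwd_osc n.+1 y * wgt (- (s / 2)) (- (t / 2)) (cos y).
have half u v x : wgt (u / 2) (v / 2) x ^+ 2 = wgt u v x.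
  rewrite /wgt exprMn; congr (_ * _);
    by rewrite -powR_mulrn ?powR_ge0// -powRrM divfK ?pnatr_eq0.
have fgE y : D y -> \1_(S j) y * (p.[cos y] * fwd_osc n.+1 y) = f y * g y.
  move=> _; rewrite /f /g indicE; case: (boolP (y \in S j)) => [|_]; last by rewrite !mul0r.
  rewrite inE /S/= in_itv/= => /andP[ya yb]; rewrite !mul1r mulrACA wgtV ?mulr1//.
  by apply: cos_itv_oo; apply/andP; split; lra.
have g2E y : g y ^+ 2 = wgt (- s) (- t) (cos y) * fwd_osc n.+1 y ^+ 2.
  by rewrite /g exprMn mulrC -!mulNr half.
have bf : bmeas D f.
  apply: bmeas_indicM => //; apply: bmeasM; first exact: bmeasS (bmeas_horner_cos p).
  by apply: (bmeas_comp_cos (g := wgt (s / 2) (t / 2))); [exact: ltW|lra|apply: bmeas_wgt_itv; lra].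
have bg : bmeas D g.
  split.
    by apply: measurable_funM; [exact: (bmeas_fwd_osc n.+1).1|exact: measurable_wgt_cos].
  have [_ [K hK]] := bmeas_fwd_wgt n.+1.
  exists (K + 1) => y Dy; have := hK _ Dy; rewrite -g2E normrX => gK.
  have := sqr_ge0 (`|g y| - 1); nra.
rewrite (posfun_eq posfun_Ipi _ _ fgE); first last.
- exact: bmeasM.
- apply: bmeas_indicM => //; apply: bmeasS (SD j) _.
  by apply: bmeasM; [exact: bmeas_horner_cos|exact: bmeas_fwd_osc].
rewrite (le_trans (posfun_cauchy_schwarz posfun_Ipi bf bg))// /B.
rewrite (funext g2E) ler_wpM2r//.
  apply: (posfun_ge0 posfun_Ipi); first exact: bmeas_fwd_wgt.
  by move=> y _; rewrite mulr_ge0 ?wgt_ge0 ?sqr_ge0.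
rewrite -[leRHS]mul1r ler_pdivlMr// mulrC.
have f2E y : f y ^+ 2 = \1_(S j) y * (p.[cos y] ^+ 2 * wgt s t (cos y)).
  rewrite /f exprMn [(_ * wgt _ _ _) ^+ 2]exprMn half indicE; case: (_ \in _); first by rewrite expr1n.
  by rewrite expr0n.
rewrite (funext f2E).
have mp2 : measurable_fun setT (fun x => p.[x] ^+ 2) by exact: (bmeasX 2 (bP p)).1.
have cp2 : continuous (fun x => p.[x] ^+ 2).
  move=> x; apply: (@continuous_comp _ _ _ (fun x => p.[x]) (fun z : R => z ^+ 2)).
    exact: continuous_horner.
  exact: exprn_continuous.
have := @nu_itv_ge _ alpha beta k a M M0 ij (e j) (pi - e j) ej _ _ (fun x => p.[x] ^+ 2) mp2
  (continuous_subspaceT cp2) (fun x _ => sqr_ge0 _).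
move=> /(_ _ _)/le_trans; apply; [lra|lra|].
have <- : N (fun x => p.[x] * p.[x]) = 1 by rewrite nu_orthonormal eqxx.
apply: (posfun_le pN); [apply: bmeas_indicM => //|exact: bmeas_hornerM|].
  by apply: bmeasS (bmeasX 2 (bP p)); apply: subset_itv; rewrite bnd_simp ?cos_geN1 ?cos_le1.
move=> x _; rewrite -expr2 indicE; case: (_ \in _); rewrite ?mul1r ?mul0r//.
exact: sqr_ge0.
Qed.

Lemma cvg_fwd_osc : Ipi (fun y => wgt (- s) (- t) (cos y) * fwd_osc n y ^+ 2) @[n --> \oo] -->
  2^-1 * Ipi (fun y => nsq (circ r y) * wgt (- s) (- t) (cos y)).
Proof.
have mRe : measurable_fun setT (fun y => Re (circ r y)) := (bmeas_Re_circ r 0 1).1.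
have mIm : measurable_fun setT (fun y => Im (circ r y)) := (bmeas_Im_circ r 0 1).1.
have b (f : R -> R) : measurable_fun setT f -> (forall y, `|f y| <= nsq (circ r y)) ->
    bmeas D (fun y => wgt (- s) (- t) (cos y) * f y).
  move=> mf fr; split.
    by apply: measurable_funM => //; exact: measurable_wgt_cos.
  exists C => y _; rewrite normrM ger0_norm ?wgt_ge0//.
  by rewrite (le_trans _ (rC y))// mulrC ler_wpM2r ?wgt_ge0.
have -> : (fun y => nsq (circ r y) * wgt (- s) (- t) (cos y)) = fun y =>
    wgt (- s) (- t) (cos y) * (Re (circ r y) ^+ 2 + (- Im (circ r y)) ^+ 2).
  by apply/funext => y; rewrite sqrrN mulrC.
apply: cvg_osc_sq; apply: b.
- exact: measurable_funX.
- by move=> y; rewrite ger0_norm ?sqr_ge0// lerDl sqr_ge0.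
- by apply: measurable_funX; exact: measurableT_comp.
- by move=> y; rewrite sqrrN ger0_norm ?sqr_ge0// lerDr sqr_ge0.
- by apply: measurable_funM => //; exact: measurableT_comp.
- move=> y; rewrite /nsq; move: (Re _) (Im _) => u v.
  by rewrite ler_norml; have := sqr_ge0 (u + v); have := sqr_ge0 (u - v); nra.
Qed.

End Lower.

(** The bound for the squared norm of R_n is close to c0 pi / 2, so this factor normalizes R_n. *)
Definition cst : R := Num.sqrt (2 / (pi * c0)).

Lemma cst_gt0 : 0 < cst.
Proof. by rewrite sqrtr_gt0 divr_gt0// mulr_gt0 ?pi_gt0 ?c0_gt0. Qed.

Lemma cst_sq : cst ^+ 2 = 2 / (pi * c0).
Proof. by rewrite sqr_sqrtr// divr_ge0// mulr_ge0 ?pi_ge0// ltW// c0_gt0. Qed.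

(** [kap_lower] gives (pi / kap)^2 <= pi (1 + 2e) / (2 c0), that is (cst kap)^2 >= 4 / (1 + 2e), and
    (1 - e)^2 (1 + 2e) <= 1. *)
Lemma kap_lower_near (e : R) : 0 < e -> e <= 1 ->
  \forall n \near \oo, 2 * (1 - e) <= cst * kap n.
Proof.
move=> e0 e1; have [r [r0 [C rC] rpi]] := @szego_lower R s t.
have pi0 := pi_gt0 R; have c00 := c0_gt0 alpha beta.
have d0 : 0 < pi * e by rewrite mulr_gt0.
have [j hj] : exists j, Ipi (fun y => nsq (circ (r j) y) * wgt (- s) (- t) (cos y)) <= pi * (1 + e).
  move/cvgrPdist_le : rpi => /(_ _ d0)[J _ /(_ J (leqnn J))]/=.
  by rewrite ler_distlC => /andP[_ h]; exists J; lra.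
have := cvg_fwd_osc (rC j) => /cvgrPdist_le/(_ (pi * e / 2)).
rewrite divr_gt0// => /(_ isT)[n0 _ hn0]; exists n0.+1 => // -[//|n] /= n0n.
have := hn0 n.+1 (ltnW n0n); rewrite ler_distlC => /andP[_ hn].
have := kap_lower (r0 j) (rC j) n.
have := cst_sq; have := cst_gt0; have := kap_gt0 n.+1.
move: hn hj; set B := Ipi _; set B' := Ipi _ => hn hj k0 cs0 csq.
rewrite expr_div_n ler_pdivrMr ?exprn_gt0// => main.
rewrite -(@ler_pXn2r _ 2) ?nnegrE ?mulr_ge0 ?(ltW cs0) ?(ltW k0) ?subr_ge0//.
rewrite [(cst * _) ^+ 2]exprMn csq; set Z := c0^-1 * kap n.+1 ^+ 2.
have Z0 : 0 <= Z by rewrite mulr_ge0 ?sqr_ge0// invr_ge0 ltW.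
have -> : 2 / (pi * c0) * kap n.+1 ^+ 2 = 2 * Z / pi.
  have F (w c x : R) : 0 < w -> 0 < c -> 2 / (w * c) * x = 2 * (c^-1 * x) / w.
    by move=> w0 c1; field; rewrite !lt0r_neq0.
  exact: F.
rewrite ler_pdivlMr//.
have h1 : pi ^+ 2 <= pi * ((1 + 2 * e) * Z / 2).
  rewrite (le_trans main)// (_ : c0^-1 * B * _ = B * Z); last by rewrite /Z; ring.
  rewrite [leRHS](_ : _ = (pi * (1 + 2 * e) / 2) * Z); last by rewrite !mulrA; ring.
  by rewrite ler_wpM2r//; lra.
have h2 : pi <= (1 + 2 * e) * Z / 2 by rewrite -(ler_pM2l pi0) -expr2.
have h3 : (1 - e) ^+ 2 * pi <= (1 - e) ^+ 2 * ((1 + 2 * e) * Z / 2).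
  by rewrite ler_wpM2l// sqr_ge0.
have h4 : (1 - e) ^+ 2 * (1 + 2 * e) <= 1 by nra.
have h5 : (1 - e) ^+ 2 * (1 + 2 * e) * Z <= 1 * Z by rewrite ler_wpM2r.
by rewrite exprMn; lra.
by rewrite invr_ge0 ltW// lead_gt0.
Qed.

Context (q : nat -> {poly R}) (q0 : forall j, (q j)`_0 = 1)
  (qa : forall j i, nsq (circ (q j) (acos (a i))) = 0)
  (C : R) (qC : forall j y, nsq (circ (q j) y) * wgt s t (cos y) <= C)
  (qI : forall g, bmeas D g ->
      Ipi (fun y => g y * (nsq (circ (q j) y) * wgt s t (cos y))) @[j --> \oo] --> Ipi g).

Definition err j n := N (fun x => ((P n).[x] - cst * (rev_cheb (q j) n).[x]) ^+ 2).

Lemma err_ge0 j n : 0 <= err j n.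
Proof.
apply: (posfun_ge0 pN) => [|x _]; last exact: sqr_ge0.
by apply: bmeasX; apply: bmeasB; [exact: bP|apply: bmeasZ; exact: bP].
Qed.

Lemma errE j n : (size (q j) <= n.+1)%N -> err j n.+1 =
  1 + cst ^+ 2 * N (fun x => (rev_cheb (q j) n.+1).[x] ^+ 2) - cst * kap n.+1.
Proof.
move=> qn; rewrite /err; set p := P n.+1; set r := rev_cheb _ _.
have -> : (fun x => (p.[x] - cst * r.[x]) ^+ 2) = fun x => (p.[x] * p.[x] +
    cst ^+ 2 * (r.[x] ^+ 2)) + (- 2 * cst) * (p.[x] * r.[x]).
  by apply/funext => x; ring.
have b1 := bmeas_hornerM p p; have b2 := bmeasX 2 (bP r); have b3 := bmeas_hornerM p r.
have b4 := bmeasZ (cst ^+ 2) b2; have b5 := bmeasZ (- 2 * cst) b3.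
rewrite (posfunD pN (bmeasD b1 b4) b5) (posfunD pN b1 b4) !(posfunZ pN)//.
rewrite nu_orthonormal eqxx nu_rev_cheb//.
by rewrite mulr1n; move: cst (N _) (kap _) => u v w; field.
Qed.

Lemma rev_norm_near (e : R) : 0 < e -> exists J, forall j, (J <= j)%N ->
  \forall n \near \oo, cst ^+ 2 * N (fun x => (rev_cheb (q j) n).[x] ^+ 2) <= 1 + e.
Proof.
move=> e0; have pi0 := pi_gt0 R; have c00 := c0_gt0 alpha beta.
have d0 : 0 < pi * e / 2 by rewrite divr_gt0// mulr_gt0.
have := qI (bmeas_cst D 1); rewrite Ipi_cst => /cvgrPdist_le/(_ _ d0)[J _ hJ].
exists J => j Jj; have := hJ j Jj; rewrite ler_distlC => /andP[_ hj].
have [n0 _ hn0] : \forall n \near \oo, Ipi (fun y => wgt s t (cos y) * circ_osc (q j) n y ^+ 2) <=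
    2^-1 * Ipi (fun y => nsq (circ (q j) y) * wgt s t (cos y)) + pi * e / 4.
  have := cvg_wgt_osc_sq (qC j) => /cvgrPdist_le/(_ (pi * e / 4)).
  rewrite divr_gt0 ?mulr_gt0// => /(_ isT); apply: filterS => n.
  by rewrite ler_distlC => /andP[_].
exists (maxn n0 (size (q j))) => // n /=; rewrite geq_max => /andP[n0n qn].
have h1 := nu_rev_cheb_sq_le (qa j) (qC j) qn.
have h2 := hn0 n n0n.
have {}hj : Ipi (fun y => nsq (circ (q j) y) * wgt s t (cos y)) <= pi + pi * e / 2.
  rewrite -[X in _ <= X + _]mul1r; apply: le_trans hj; rewrite le_eqVlt; apply/orP; left; apply/eqP; congr Ipi.
  by apply/funext => y; rewrite -[LHS]mul1r.
have h3 : Ipi (fun y => wgt s t (cos y) * circ_osc (q j) n y ^+ 2) <= pi * (1 + e) / 2 by lra.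
rewrite (le_trans (ler_wpM2l (sqr_ge0 _) h1))// cst_sq.
rewrite (le_trans (ler_wpM2l _ (ler_wpM2l _ h3)))//; [|by rewrite ltW|].
  by rewrite divr_ge0// mulr_ge0// ltW.
have F (w c : R) : 0 < w -> 0 < c -> 2 / (w * c) * (c * (w * (1 + e) / 2)) = 1 + e.
  by move=> w0 c1; field; rewrite !lt0r_neq0.
by rewrite F.
Qed.

(** By [errE] the squared error is at most 1 + (1 + d) - 2 (1 - d) = 3 d: an upper bound for the
    norm of R_n and a lower bound for [kap] are enough. *)
Lemma strong_asymptotics (e : R) : 0 < e -> exists J, forall j, (J <= j)%N ->
  \forall n \near \oo, err j n <= e.
Proof.
move=> e0; pose d := Num.min 1 (e / 3).
have d0 : 0 < d by rewrite lt_min ltr01 divr_gt0.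
have d1 : d <= 1 by rewrite ge_min lexx.
have de : d <= e / 3 by rewrite ge_min lexx orbT.
have [J hJ] := rev_norm_near d0.
exists J => j /hJ[n1 _ h1]; have [n2 _ h2] := kap_lower_near d0 d1.
exists (maxn (maxn n1 n2) (size (q j))).+1 => // -[//|n] /=.
rewrite ltnS !geq_max => /andP[/andP[n1n n2n] qn].
rewrite errE ?(leq_trans qn)//.
have := h1 n.+1 (leq_trans n1n (leqnSn _)); have /= := h2 n.+1 (leq_trans n2n (leqnSn _)).
by lra.
Qed.

(** The lower bound is [kap_lower_near] at e = 1/2. The upper one comes from [err] >= 0, which gives
    cst kap <= 1 + 2. *)
Lemma kap_bounds : \forall n \near \oo, 1 <= cst * kap n <= 4.
Proof.
have h2 : 0 < 2^-1 :> R by [].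
have h21 : 2^-1 <= 1 :> R by rewrite invf_le1// ler1n.
have [n1 _ h1] := kap_lower_near h2 h21.
have [J /(_ J (leqnn J))[n2 _ h3]] := rev_norm_near (@ltr01 R).
exists (maxn (maxn n1 n2) (size (q J))).+1 => // -[//|n] /=.
rewrite ltnS !geq_max => /andP[/andP[n1n n2n] qn].
have := h3 n.+1 (leq_trans n2n (leqnSn _)); have /= := h1 n.+1 (leq_trans n1n (leqnSn _)).
by have := err_ge0 J n.+1; rewrite errE ?(leq_trans qn)// => *; apply/andP; split; lra.
Qed.

End StrongAsymptotics.

(** * Iterated limits in two indices *)

Section DoubleLimit.
Context {R : realType}.
Implicit Types (x y : nat -> nat -> R) (l m : R) (Q : nat -> nat -> Prop).

(** The threshold for n depends on j. Closure under conjunction lets finitely many asymptotic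
    conditions be met by a single pair (j, n). *)
Definition ev2 Q := exists J, forall j, (J <= j)%N -> \forall n \near \oo, Q j n.

Lemma ev2_and Q Q' : ev2 Q -> ev2 Q' -> ev2 (fun j n => Q j n /\ Q' j n).
Proof.
move=> [J hJ] [J' hJ']; exists (maxn J J') => j; rewrite geq_max => /andP[j1 j2].
exact: filterI (hJ j j1) (hJ' j j2).
Qed.

Lemma ev2_imp Q Q' : ev2 Q -> (forall j n, Q j n -> Q' j n) -> ev2 Q'.
Proof. by move=> [J hJ] QQ'; exists J => j /hJ; apply: filterS => n; exact: QQ'. Qed.

Lemma ev2_near (T : nat -> Prop) : (\forall n \near \oo, T n) -> ev2 (fun _ n => T n).
Proof. by move=> hT; exists 0%N. Qed.

Lemma ev2_shift Q : ev2 Q -> ev2 (fun j n => Q j n.+1).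
Proof.
by move=> [J hJ]; exists J => j /hJ[n0 _ hn]; exists n0 => // n /= nn; apply: hn; exact: leqW.
Qed.

Lemma ev2_ex Q : ev2 Q -> exists j n, Q j n.
Proof. by move=> [J /(_ J (leqnn J))[n _ /(_ n (leqnn n))]]; exists J, n. Qed.

Definition lim2 x l := forall e, 0 < e -> ev2 (fun j n => `|x j n - l| <= e).

Lemma lim2_iter x (u : nat -> R) l : (forall j, x j n @[n --> \oo] --> u j) ->
  u @ \oo --> l -> lim2 x l.
Proof.
move=> xu ul e e0; have e2 : 0 < e / 2 by rewrite divr_gt0.
move/cvgrPdist_le : ul => /(_ _ e2)[J _ hJ]; exists J => j /hJ /= h.
move/cvgrPdist_le : (xu j) => /(_ _ e2); apply: filterS => n h'.
rewrite (_ : _ - _ = (x j n - u j) + (u j - l)); last ring.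
by rewrite (le_trans (ler_normD _ _))// distrC [`|u j - l|]distrC; lra.
Qed.

Lemma lim2D x y l m : lim2 x l -> lim2 y m -> lim2 (fun j n => x j n + y j n) (l + m).
Proof.
move=> xl ym e e0; have e2 : 0 < e / 2 by rewrite divr_gt0.
apply: ev2_imp (ev2_and (xl _ e2) (ym _ e2)) _ => j n [h1 h2].
rewrite (_ : _ - _ = (x j n - l) + (y j n - m)); last ring.
by rewrite (le_trans (ler_normD _ _))//; lra.
Qed.

Lemma lim2Z c x l : lim2 x l -> lim2 (fun j n => c * x j n) (c * l).
Proof.
move=> xl e e0; have e2 : 0 < e / (`|c| + 1) by rewrite divr_gt0// ltr_wpDl.
apply: ev2_imp (xl _ e2) _ => j n h; rewrite -mulrBr normrM.
rewrite (le_trans (ler_wpM2l (normr_ge0 _) h))// mulrCA ger_pMr// ler_pdivrMr ?ltr_wpDl//.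
by rewrite mul1r lerDl.
Qed.

Lemma lim2_norm_le x y l : lim2 y 0 -> ev2 (fun j n => `|x j n - l| <= y j n) -> lim2 x l.
Proof.
move=> y0 xy e e0; apply: ev2_imp (ev2_and (y0 _ e0) xy) _ => j n [h1 h2].
by rewrite (le_trans h2)// (le_trans (ler_norm _))// -[y j n]subr0.
Qed.

Lemma lim2_sqrt x : (forall j n, 0 <= x j n) -> lim2 x 0 -> lim2 (fun j n => Num.sqrt (x j n)) 0.
Proof.
move=> x0 xl e e0; have e2 : 0 < e ^+ 2 by rewrite exprn_gt0.
apply: ev2_imp (xl _ e2) _ => j n; rewrite !subr0 !ger0_norm ?sqrtr_ge0// => h.
by rewrite -(@ler_pXn2r _ 2) ?nnegrE ?sqrtr_ge0 ?(ltW e0)// sqr_sqrtr.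
Qed.

End DoubleLimit.

(** * Limits of inner products of the orthonormal polynomials with test functions *)

Section Pairings.
Context {R : realType}.
Notation D := `[0, (pi : R)]%classic.
Notation X := `[-1, (1 : R)]%classic.
Context (alpha beta : R) (k : nat) (a M : 'I_k -> R) (P : nat -> {poly R}).
Context (a1 : forall i, -1 <= a i <= 1) (M0 : forall i, 0 < M i).
Context (oP : orthonormal_family alpha beta a M P).
Notation s := (alpha + 1 / 2).
Notation t := (beta + 1 / 2).
Notation N := (nuR alpha beta a M).
Notation c0 := (c0 alpha beta).
Notation cst := (cst alpha beta).
Context (q : nat -> {poly R}) (q0 : forall j, (q j)`_0 = 1)
  (qa : forall j i, nsq (circ (q j) (acos (a i))) = 0)
  (C : R) (qC : forall j y, nsq (circ (q j) y) * wgt s t (cos y) <= C)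
  (qI : forall g, bmeas D g ->
      Ipi (fun y => g y * (nsq (circ (q j) y) * wgt s t (cos y))) @[j --> \oo] --> Ipi g).
Notation err := (err alpha beta a M P q).

Let ij := integrable_jweight oP.
Let pN : posfun X N := posfun_nu a1 M0 ij.
Let bP (p : {poly R}) : bmeas X (fun x => p.[x]) := bmeas_hornerX p.
Let rq j n := rev_cheb (q j) n.

Lemma ev2_size : ev2 (fun j n => (size (q j) <= n)%N).
Proof. by exists 0%N => j _; exists (size (q j)). Qed.

Lemma lim2_err : lim2 err 0.
Proof.
move=> e e0; have [J hJ] := strong_asymptotics a1 M0 oP q0 qa qC qI e0.
exists J => j /hJ; apply: filterS => n h.
by rewrite subr0 ger0_norm// err_ge0.
Qed.

(** Replacing [P] by [cst] R costs at most the square root of K [err], by Cauchy-Schwarz. The index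
    map f will be the identity or the successor. *)
Lemma lim2_orthonormal (f : nat -> nat) (u : nat -> nat -> R -> R) (K l : R) :
  lim2 (fun j n => err j (f n)) 0 ->
  (forall j n, bmeas X (u j n)) ->
  ev2 (fun j n => N (fun x => u j n x ^+ 2) <= K) ->
  lim2 (fun j n => N (fun x => (rq j (f n)).[x] * u j n x)) l ->
  lim2 (fun j n => N (fun x => (P (f n)).[x] * u j n x)) (cst * l).
Proof.
move=> e0 bu uK ul.
have -> : (fun j n => N (fun x => (P (f n)).[x] * u j n x)) = fun j n =>
    cst * N (fun x => (rq j (f n)).[x] * u j n x) +
    N (fun x => ((P (f n)).[x] - cst * (rq j (f n)).[x]) * u j n x).
  apply/funext => j; apply/funext => n.
  have b1 : bmeas X (fun x => (rq j (f n)).[x] * u j n x) by exact: bmeasM.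
  have b2 : bmeas X (fun x => ((P (f n)).[x] - cst * (rq j (f n)).[x]) * u j n x).
    by apply: bmeasM => //; apply: bmeasB => //; exact: bmeasZ.
  rewrite -(posfunZ pN)// -(posfunD pN)//; last exact: bmeasZ.
  by congr nuR; apply/funext => x; ring.
rewrite -[X in lim2 _ X]addr0; apply: lim2D; first exact: lim2Z.
have K0 : 0 <= `|K| + 1 by rewrite addr_ge0.
have le0 : lim2 (fun j n => (`|K| + 1) * err j (f n)) 0.
  by rewrite -(mulr0 (`|K| + 1)); exact: lim2Z.
have ne0 j n : 0 <= (`|K| + 1) * err j (f n) by rewrite mulr_ge0// err_ge0.
apply: (lim2_norm_le (lim2_sqrt ne0 le0)).
apply: ev2_imp uK _ => j n uK; rewrite subr0.
have b2 : bmeas X (fun x => (P (f n)).[x] - cst * (rq j (f n)).[x]).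
  by apply: bmeasB => //; exact: bmeasZ.
rewrite -(@ler_pXn2r _ 2) ?nnegrE ?sqrtr_ge0// sqr_sqrtr// real_normK ?num_real//.
rewrite (le_trans (posfun_cauchy_schwarz pN b2 (bu j n)))// mulrC ler_wpM2r//.
  exact: err_ge0.
by rewrite (le_trans uK)// (le_trans (ler_norm _))// lerDl.
Qed.

Let osc1 j := circ_osc (q j).
Let osc2 j := osc (fun y => - Im (circ (q j) y)) (fun y => Re (circ (q j) y)).
Let w j y := nsq (circ (q j) y) * wgt s t (cos y).

(** [osc1] and [osc2] are the real and imaginary parts of e^(iny) conj q; this is the real part
    after multiplication by e^(iy). *)
Lemma rev_chebS_osc j n y : (size (q j) <= n)%N ->
  (rq j n.+1).[cos y] = cos y * osc1 j n y - sin y * osc2 j n y.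
Proof.
move=> qn; rewrite /rq rev_cheb_osc ?leqW// /osc1 /osc2 /circ_osc /osc.
by rewrite -natr1 mulrDl mul1r cosD sinD; ring.
Qed.

Section Weighted.
Context (m : R -> R) (bm : bmeas D m).

Let bmRe j : bmeas D (fun y => m y * wgt s t (cos y) * Re (circ (q j) y) ^+ 2).
Proof.
have := bmeasM bm (bmeas_wgt_Re (qC j)); congr bmeas.
by apply/funext => y; exact: mulrA.
Qed.

Let bmIm j : bmeas D (fun y => m y * wgt s t (cos y) * Im (circ (q j) y) ^+ 2).
Proof.
have := bmeasM bm (bmeas_wgt_Im (qC j)); congr bmeas.
by apply/funext => y; exact: mulrA.
Qed.

Let bmReIm j : bmeas D (fun y => m y * wgt s t (cos y) * (Re (circ (q j) y) * Im (circ (q j) y))).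
Proof.
have := bmeasM bm (bmeas_wgt_ReIm (qC j)); congr bmeas.
by apply/funext => y; exact: mulrA.
Qed.

(** As n grows the square averages to |q_j|^2 / 2; then |q_j|^2 W tends to 1 as j grows. *)
Lemma lim2_osc1 :
  lim2 (fun j n => Ipi (fun y => m y * wgt s t (cos y) * osc1 j n y ^+ 2)) (2^-1 * Ipi m).
Proof.
apply: (lim2_iter (u := fun j => 2^-1 * Ipi (fun y => m y * w j y))) => [j|].
  have -> : (fun y => m y * w j y) = fun y =>
      m y * wgt s t (cos y) * (Re (circ (q j) y) ^+ 2 + Im (circ (q j) y) ^+ 2).
    by apply/funext => y; rewrite /w [RHS]mulrAC [LHS]mulrA.
  exact: cvg_osc_sq.
by apply: cvgM; [exact: cvg_cst|exact: qI].
Qed.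

Lemma lim2_osc2 :
  lim2 (fun j n => Ipi (fun y => m y * wgt s t (cos y) * osc2 j n y ^+ 2)) (2^-1 * Ipi m).
Proof.
apply: (lim2_iter (u := fun j => 2^-1 * Ipi (fun y => m y * w j y))) => [j|].
  have -> : (fun y => m y * w j y) = fun y =>
      m y * wgt s t (cos y) * ((- Im (circ (q j) y)) ^+ 2 + Re (circ (q j) y) ^+ 2).
    by apply/funext => y; rewrite /w /nsq sqrrN [X in _ = _ * X]addrC [RHS]mulrAC [LHS]mulrA.
  apply: cvg_osc_sq => //.
    by have := bmIm j; congr bmeas; apply/funext => y; rewrite sqrrN.
  by have := bmeasN (bmReIm j); congr bmeas; apply/funext => y; ring.
by apply: cvgM; [exact: cvg_cst|exact: qI].
Qed.

Lemma lim2_osc12 :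
  lim2 (fun j n => Ipi (fun y => m y * wgt s t (cos y) * (osc1 j n y * osc2 j n y))) 0.
Proof.
apply: (lim2_iter (u := fun=> 0)) => [j|]; last exact: cvg_cst.
exact: cvg_osc_conj.
Qed.

Let bcosM (c : R) : bmeas D (fun y => cos (c * y)).
Proof. exact: bmeas_cosM. Qed.

Let bsinM (c : R) : bmeas D (fun y => sin (c * y)).
Proof. exact: bmeas_sinM. Qed.

Lemma bmeas_wosc2 j n : bmeas D (fun y => m y * wgt s t (cos y) * osc2 j n y ^+ 2).
Proof.
pose c y := cos (n%:R * y) : R; pose d y := sin (n%:R * y) : R.
have h := bmeasD (bmeasD (bmeasM (bmeasX 2 (bcosM n%:R)) (bmIm j))
  (bmeasM (bmeasX 2 (bsinM n%:R)) (bmRe j)))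
  (bmeasM (bmeasZ (-2) (bmeasM (bcosM n%:R) (bsinM n%:R))) (bmReIm j)).
by move: h; congr bmeas; apply/funext => y; rewrite /osc2 /osc; ring.
Qed.

Lemma bmeas_wosc12 j n : bmeas D (fun y => m y * wgt s t (cos y) * (osc1 j n y * osc2 j n y)).
Proof.
have h := bmeasD (bmeasD (bmeasM (bmeasM (bcosM n%:R) (bsinM n%:R)) (bmRe j))
  (bmeasM (bmeasZ (-1) (bmeasM (bcosM n%:R) (bsinM n%:R))) (bmIm j)))
  (bmeasM (bmeasB (bmeasX 2 (bsinM n%:R)) (bmeasX 2 (bcosM n%:R))) (bmReIm j)).
by move: h; congr bmeas; apply/funext => y; rewrite /osc1 /circ_osc /osc2 /osc; ring.
Qed.

End Weighted.

Context (y1 y2 : R) (y10 : 0 < y1) (y12 : y1 <= y2) (y2pi : y2 < pi) (kk : R -> R).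
Context (mk : measurable_fun setT kk) (ck : {within `[cos y2, cos y1], continuous kk}).
Let A : set R := `[cos y2, cos y1].
Let S : set R := `[y1, y2].
Context (aA : forall i, ~ A (a i)).
Let kc y := \1_S y * kk (cos y).

Lemma bmeas_kc : bmeas D kc.
Proof.
apply: bmeas_indicM; first exact: measurable_itv.
by apply: (bmeas_comp_cos (g := kk)); [exact: ltW|exact: ltW|exact: bmeas_within].
Qed.

Lemma bmeas_kkp (p : {poly R}) : bmeas X (fun x => \1_A x * (kk x * p.[x])).
Proof.
apply: bmeas_indicM; first exact: measurable_itv.
apply: bmeasM; first exact: bmeas_within.
by apply: bmeasS (bP p); apply: subset_itv; rewrite bnd_simp ?cos_geN1 ?cos_le1.
Qed.

Lemma nu_kkp (p : {poly R}) : N (fun x => \1_A x * (kk x * p.[x])) =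
  c0 * Ipi (fun y => kc y * wgt s t (cos y) * p.[cos y]).
Proof.
rewrite (nu_itv M ij y10 y12 y2pi _ _ aA).
- by congr (_ * Ipi _); apply/funext => y; rewrite /kc; ring.
- by apply: measurable_funM => //; exact: (bP p).1.
- by move=> x; apply: continuousM; [exact: ck|apply: continuous_subspaceT; exact: continuous_horner].
Qed.


Definition phi j n x := \1_A x * (kk x * (rq j n).[x]).

Lemma bmeas_phi j n : bmeas X (phi j n).
Proof. exact: bmeas_kkp. Qed.

(* In the variable [y = acos x] this is [sin y] times the conjugate of [phi]. *)
Definition psi j n x := \1_A x * (kk x * (x * (rq j n).[x] - (rq j n.+1).[x])).

Let psiE j n : psi j n = fun x => \1_A x * (kk x * ('X * rq j n - rq j n.+1).[x]).
Proof. by apply/funext => x; rewrite /psi hornerD hornerN hornerM hornerX. Qed.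

Lemma bmeas_psi j n : bmeas X (psi j n).
Proof. rewrite psiE; exact: bmeas_kkp. Qed.

Lemma lim2_eq (x x' : nat -> nat -> R) (l : R) :
  lim2 x l -> ev2 (fun j n => x j n = x' j n) -> lim2 x' l.
Proof.
move=> xl xx' e e0; apply: ev2_imp (ev2_and (xl _ e0) xx') _ => j n [h <-].
exact: h.
Qed.

Let Kb := c0 * Ipi (fun y => C * kc y ^+ 2).

Lemma nu_kkp_sq (p : {poly R}) j : (forall y, p.[cos y] ^+ 2 <= nsq (circ (q j) y)) ->
  N (fun x => (\1_A x * (kk x * p.[x])) ^+ 2) <= Kb.
Proof.
move=> pq; have c00 := c0_gt0 alpha beta.
have -> : (fun x => (\1_A x * (kk x * p.[x])) ^+ 2) =
    fun x => \1_A x * (kk x ^+ 2 * (p * p).[x]).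
  apply/funext => x; rewrite hornerM indicE.
  by case: (_ \in _); rewrite ?mul1r ?mul0r ?expr0n// exprMn expr2.
have bk2 : bmeas D (fun y => C * kc y ^+ 2) by apply: bmeasZ; apply: bmeasX; exact: bmeas_kc.
have ck2 : {within `[cos y2, cos y1], continuous (fun x => kk x ^+ 2 * (p * p).[x])}.
  have ckk : {within `[cos y2, cos y1], continuous (fun x => kk x ^+ 2)}.
    move=> x; apply: (@continuous_comp (subspace _) _ _ kk (fun z : R => z ^+ 2)); first exact: ck.
    exact: exprn_continuous.
  move=> x; apply: (@continuousM R (subspace _) (fun x => kk x ^+ 2) (fun x => (p * p).[x])); first exact: ckk.
  by apply: continuous_subspaceT; exact: continuous_horner.
have mk2 : measurable_fun setT (fun x => kk x ^+ 2 * (p * p).[x]).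
  by apply: measurable_funM; [exact: measurable_funX|exact: (bP (p * p)).1].
rewrite (nu_itv M ij y10 y12 y2pi mk2 ck2 aA) /Kb ler_wpM2l// ?(ltW c00)//.
apply: (posfun_le posfun_Ipi) => //.
  apply: bmeas_indicM; first exact: measurable_itv.
  apply: (bmeas_comp_cos (g := fun x => kk x ^+ 2 * (p * p).[x] * wgt s t x)); [exact: ltW|exact: ltW|].
  by apply: bmeasM; [exact: bmeas_within|exact: bmeas_wgt_itv].
move=> y _; rewrite /kc exprMn; rewrite [\1_S y]indicE; case: (_ \in _); last first.
  by rewrite mul0r expr0n mul0r mulr0.
rewrite [X in X <= _]mul1r expr1n [X in C * X]mul1r hornerM -expr2 -mulrA mulrC.
by rewrite ler_wpM2r ?sqr_ge0// (le_trans _ (qC j y))// ler_wpM2r ?wgt_ge0.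
Qed.

Lemma osc2_le j n y : osc2 j n y ^+ 2 <= nsq (circ (q j) y).
Proof. by rewrite (le_trans (osc_norm _ _ _ _))// sqrrN addrC. Qed.

Lemma rev_cheb_conj j n y : (size (q j) <= n)%N ->
  ('X * rq j n - rq j n.+1).[cos y] = sin y * osc2 j n y.
Proof.
move=> qn; rewrite hornerD hornerN hornerM hornerX rev_chebS_osc//.
by rewrite [(rq j n).[_]]rev_cheb_osc// opprB addrCA subrr addr0.
Qed.

Lemma rev_cheb_conj_le j n y : (size (q j) <= n)%N ->
  ('X * rq j n - rq j n.+1).[cos y] ^+ 2 <= sin y ^+ 2 * nsq (circ (q j) y).
Proof.
by move=> qn; rewrite rev_cheb_conj// exprMn ler_wpM2l ?sqr_ge0// osc2_le.
Qed.

Lemma nu_phi_sq : ev2 (fun j n => N (fun x => phi j n x ^+ 2) <= Kb).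
Proof.
apply: ev2_imp ev2_size _ => j n qn; apply: (@nu_kkp_sq _ j) => y.
exact: rev_cheb_sq_le.
Qed.

Lemma nu_psi_sq : ev2 (fun j n => N (fun x => psi j n x ^+ 2) <= Kb).
Proof.
apply: ev2_imp ev2_size _ => j n qn; rewrite psiE; apply: (@nu_kkp_sq _ j) => y.
by rewrite (le_trans (rev_cheb_conj_le y qn))// ler_piMl ?nsq_ge0//.
Qed.

Lemma nu_kkpM (p r : {poly R}) : N (fun x => p.[x] * (\1_A x * (kk x * r.[x]))) =
  c0 * Ipi (fun y => kc y * wgt s t (cos y) * (p.[cos y] * r.[cos y])).
Proof.
rewrite (_ : (fun x => _) = fun x => \1_A x * (kk x * (p * r).[x])); last first.
  by apply/funext => x; rewrite hornerM; ring.
by rewrite nu_kkp; congr (_ * Ipi _); apply/funext => y; rewrite hornerM.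
Qed.

Lemma lim2_phi : lim2 (fun j n => N (fun x => (P n).[x] * phi j n x)) (cst * (c0 * (2^-1 * Ipi kc))).
Proof.
apply: (@lim2_orthonormal id phi) (lim2_err) bmeas_phi nu_phi_sq _.
apply: (lim2_eq (lim2Z c0 (lim2_osc1 bmeas_kc))).
apply: ev2_imp ev2_size _ => j n qn; rewrite nu_kkpM; congr (_ * Ipi _).
by apply/funext => y; rewrite /= [(rq j n).[_]]rev_cheb_osc// expr2.
Qed.

Let bsin : bmeas D (@sin R).
Proof. by apply: bmeas_continuous; exact: continuous_sin. Qed.

Let bcos : bmeas D (@cos R).
Proof. by apply: bmeas_continuous; exact: continuous_cos. Qed.

(** R_n and its conjugate are asymptotically orthogonal for every weight, by [lim2_osc12]. *)
Lemma lim2_psi0 : lim2 (fun j n => N (fun x => (P n).[x] * psi j n x)) 0.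
Proof.
rewrite -(mulr0 cst).
apply: (@lim2_orthonormal id psi) (lim2_err) bmeas_psi nu_psi_sq _.
rewrite -(mulr0 c0).
apply: (lim2_eq (lim2Z c0 (lim2_osc12 (bmeasM bmeas_kc bsin)))).
apply: ev2_imp ev2_size _ => j n qn; rewrite psiE nu_kkpM; congr (_ * Ipi _).
apply/funext => y; rewrite rev_cheb_conj// [(rq j n).[_]]rev_cheb_osc//.
by rewrite -/(osc1 j n y); ring.
Qed.

(** R_(n+1) contains the conjugate of R_n with the factor -sin y, and [psi] brings a second factor
    sin y; the other part of R_(n+1) averages out. *)
Lemma lim2_psi1 : lim2 (fun j n => N (fun x => (P n.+1).[x] * psi j n x))
  (cst * (c0 * (- (2^-1 * Ipi (fun y => kc y * sin y ^+ 2))))).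
Proof.
have e1 : lim2 (fun j n => err j n.+1) 0 by move=> e e0; exact: ev2_shift (lim2_err e0).
apply: (@lim2_orthonormal succn psi) e1 bmeas_psi nu_psi_sq _.
have b1 := bmeasM (bmeasM bmeas_kc bsin) bcos.
have b2 := bmeasM bmeas_kc (bmeasX 2 bsin).
rewrite -[- _]add0r -mulN1r.
apply: (lim2_eq (lim2Z c0 (lim2D (lim2_osc12 b1) (lim2Z (-1) (lim2_osc2 b2))))).
apply: ev2_imp ev2_size _ => j n qn; rewrite psiE nu_kkpM; congr (_ * _).
rewrite -(posfunZ posfun_Ipi); last exact: bmeas_wosc2.
rewrite -(posfunD posfun_Ipi); [|exact: bmeas_wosc12|by apply: bmeasZ; exact: bmeas_wosc2].
congr Ipi.
by apply/funext => y; rewrite rev_cheb_conj// rev_chebS_osc//; ring.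
Qed.

End Pairings.

(** * Weak-type bounds and partial sums *)

Section WeakType.
Context {R : realType}.
Notation mu := (@lebesgue_measure R).
Notation X := `[-1, (1 : R)]%classic.
Context (alpha beta : R) (k : nat) (a M : 'I_k -> R).
Context (a1 : forall i, -1 <= a i <= 1) (M0 : forall i, 0 < M i).
Context (ij : mu.-integrable X (EFin \o jweight alpha beta)).
Notation N := (nuR alpha beta a M).
Let pN : posfun X N := posfun_nu a1 M0 ij.

Lemma measurable_gt_norm (F : R -> R) (u : R) : measurable_fun setT F ->
  measurable [set x | u < `|F x|].
Proof.
move=> mF; have mn : measurable_fun setT (fun x => `|F x|) by exact: measurableT_comp.
rewrite (_ : [set x | _] = setT `&` (fun x => `|F x|) @^-1` `]u, +oo[%classic).
  by apply: mn => //; exact: measurable_itv.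
by apply/seteqP; split=> x /=; rewrite in_itv/= andbT//; case.
Qed.

Lemma bmeas_gt_norm (F : R -> R) (u : R) : measurable_fun setT F ->
  bmeas X (\1_[set x | u < `|F x|] : R -> R).
Proof. by move=> mF; apply: bmeas_indic; exact: measurable_gt_norm. Qed.

Lemma distribE (F : R -> R) (u : R) : measurable_fun setT F ->
  distrib alpha beta a M F u = (N (\1_[set x | u < `|F x|]))%:E.
Proof. by move=> mF; rewrite /distrib /nu_meas nu_int_nuR//; exact: bmeas_gt_norm. Qed.

Lemma weak_distrib_le (p Y : R) (F : R -> R) (u : R) : 0 < p -> 0 < Y -> 0 < u ->
  measurable_fun setT F -> (weak_Lp_norm alpha beta a M p F <= Y%:E)%E ->
  N (\1_[set x | u < `|F x|]) <= (Y / u) `^ p.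
Proof.
move=> p0 Y0 u0 mF wF; set n := N _; rewrite leNgt; apply/negP => yn.
(* A point strictly between the two sides. The rearrangement at t is at least u because t < n, and
   then the weak norm forces t <= (Y / u)^p. *)
pose t := (n + (Y / u) `^ p) / 2.
have Yu0 : 0 <= (Y / u) `^ p by exact: powR_ge0.
have t0 : 0 < t by rewrite /t; lra.
have tn : t < n by rewrite /t; lra.
have ru : (u%:E <= rearr alpha beta a M F t)%E.
  apply: le_ereal_inf_tmp => _ [v [v0 vt] <-]; move: vt; rewrite distribE// lee_fin => vt.
  rewrite lee_fin leNgt; apply/negP => vu.
  suff : n <= N (\1_[set x | v < `|F x|]) by lra.
  apply: (posfun_le pN); [exact: bmeas_gt_norm|exact: bmeas_gt_norm|].
  move=> x _; rewrite !indicE ler_nat.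
  case: (boolP (x \in [set x | u < _])) => //; rewrite inE/= => uF.
  by rewrite mem_set//= (lt_trans vu).
have : (((t `^ p^-1)%:E * u%:E) <= Y%:E)%E.
  apply: le_trans wF; apply: le_ereal_sup_tmp.
  exists ((t `^ p^-1)%:E * rearr alpha beta a M F t)%E; first by exists t.
  by rewrite lee_wpmul2l// lee_fin powR_ge0.
rewrite -EFinM lee_fin -ler_pdivlMr// => h.
have : t <= (Y / u) `^ p.
  rewrite -[t](powRr1 (ltW t0)) -(mulVf (lt0r_neq0 p0)) powRrM.
  by rewrite ge0_ler_powR ?nnegrE ?powR_ge0 ?divr_ge0// ltW.
by rewrite /t; lra.
Qed.

(** Each level 2^i l lying below f adds its own height, which is what doubling the truncation level
    requires. *)
Lemma dyadic_le (f l : R) K : 0 <= l -> Num.min f (2 ^+ K * l) <=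
  l + \sum_(i < K) 2 ^+ i * l * (2 ^+ i * l < f)%R%:R.
Proof.
move=> l0; elim: K => [|K IH].
  by rewrite big_ord0 expr0 mul1r addr0 ge_min lexx orbT.
rewrite big_ord_recr/= addrA.
have h0 : 0 <= 2 ^+ K * l by rewrite mulr_ge0 ?exprn_ge0.
have [fl|lf] := leP f (2 ^+ K * l).
  rewrite mulr0 addr0 (le_trans _ IH)// le_min ge_min lexx/= ge_min fl//.
rewrite mulr1 (le_trans _ (lerD IH (lexx _)))//.
by rewrite (min_idPr (ltW lf)) ge_min exprS -mulrA mulr_natl mulr2n lexx orbT.
Qed.

Lemma sum_geo_le (z : R) K : 0 <= z < 1 -> \sum_(i < K) z ^+ i <= (1 - z)^-1.
Proof.
move=> /andP[z0 z1]; rewrite -[leRHS]mul1r ler_pdivlMr ?subr_gt0//.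
rewrite mulrC (_ : _ * _ = 1 - z ^+ K); first by rewrite gerBl exprn_ge0.
by rewrite -[RHS]opprB subrX1 -mulNr opprB.
Qed.

(* The constant of a dyadic decomposition over the level sets of [F]. *)
Definition weak_cst (p : R) := 1 + (1 - 2 `^ (1 - p))^-1.

(** Below the level l the integral is controlled by nu(B), above it by the dyadic level sets of F,
    whose contributions decay like 2^((1-p) i). *)
Lemma weak_pairing (p Y G : R) (F g : R -> R) (B : set R) : 1 < p -> 0 < Y ->
  bmeas X F -> (weak_Lp_norm alpha beta a M p F <= Y%:E)%E ->
  bmeas X g -> measurable B -> (forall x, X x -> `|g x| <= G * \1_B x) ->
  0 < N (\1_B) -> 0 <= G ->
  `|N (fun x => F x * g x)| <= weak_cst p * Y * G * (N (\1_B)) `^ (1 - p^-1).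
Proof.
move=> p1 Y0 bF wF bg mB gB; set v := N (\1_B) => v0 G0.
have p0 : 0 < p by lra.
have mF := bF.1; have [_ [L FL]] := bF.
(* The level at which the two controls agree: (Y / l)^p = nu(B). *)
pose l := Y * v `^ (- p^-1).
have l0 : 0 < l by rewrite mulr_gt0 ?powR_gt0.
have [K hK] : exists K, L <= 2 ^+ K * l.
  exists (Num.truncn (`|L| / l)).+1; rewrite -ler_pdivrMr//.
  rewrite (@le_trans _ _ (`|L| / l))//; first by rewrite ler_wpM2r ?ler_norm// invr_ge0 ltW.
  rewrite (le_trans (ltW (truncnS_gt _)))// -natrX ler_nat.
  exact/ltnW/ltn_expl.
pose E i : set R := [set x | 2 ^+ i * l < `|F x|].
have bE i : bmeas X (\1_(E i)) by exact: bmeas_gt_norm.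
have bB : bmeas X (\1_B : R -> R) by exact: bmeas_indic.
pose H x := G * (l * \1_B x + \sum_(i < K) 2 ^+ i * l * \1_(E i) x).
have bs : bmeas X (fun x => \sum_(i < K) 2 ^+ i * l * \1_(E i) x).
  by apply: bmeas_sum => i; exact: bmeasZ.
have bH0 : bmeas X (fun x => l * \1_B x + \sum_(i < K) 2 ^+ i * l * \1_(E i) x).
  by apply: bmeasD => //; exact: bmeasZ.
have bH : bmeas X H by exact: bmeasZ.
have FgH : `|N (fun x => F x * g x)| <= N H.
  apply: (posfun_norm_le pN) => //; first exact: bmeasM.
  move=> x Xx; rewrite normrM /H; have := gB x Xx.
  have sE : \sum_(i < K) 2 ^+ i * l * \1_(E i) x = \sum_(i < K) 2 ^+ i * l * (2 ^+ i * l < `|F x|)%R%:R.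
    apply: eq_bigr => i _; rewrite indicE; congr (_ * (nat_of_bool _)%:R).
    by apply/idP/idP => [/set_mem|h]; [|exact: mem_set].
  have s0 : 0 <= \sum_(i < K) 2 ^+ i * l * \1_(E i) x.
    by apply: sumr_ge0 => i _; rewrite indicE mulr_ge0 ?ler0n// mulr_ge0 ?exprn_ge0 ?(ltW l0).
  rewrite indicE; case: (x \in B) => /=; rewrite ?mulr1 ?mulr0.
    move=> gG; rewrite mulrC ler_pM// sE.
    rewrite (le_trans _ (dyadic_le _ _ (ltW l0)))// le_min lexx/=.
    exact: le_trans (FL _ Xx) hK.
  rewrite normr_le0 => /eqP->; rewrite normr0 mulr0 add0r.
  by rewrite mulr_ge0.
rewrite (le_trans FgH)// /H (posfunZ pN)//.
rewrite [leRHS](_ : _ = G * (weak_cst p * (Y * v `^ (1 - p^-1)))); last ring.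
rewrite ler_wpM2l//.
rewrite (posfunD pN)//; last exact: bmeasZ.
rewrite (posfunZ pN)// (posfun_sum pN); last by move=> i; exact: bmeasZ.
have lv : l * v = Y * v `^ (1 - p^-1).
  rewrite /l -mulrA; congr (_ * _).
  transitivity (v `^ (- p^-1) * v `^ 1); first by rewrite powRr1// ltW.
  by rewrite -powRD ?(lt0r_neq0 v0) ?implybT// addrC.
pose z : R := 2 `^ (1 - p).
have z01 : 0 <= z < 1.
  rewrite powR_ge0/= /z (_ : 1 - p = -1 * (p - 1)); last ring.
  have e1 : (1 : R) `^ (p - 1) = 1 by rewrite powR1.
  rewrite powRrM -[ltRHS]e1 gt0_ltr_powR ?nnegrE ?powR_ge0 ?subr_gt0//.
  by rewrite powR_inv1// invf_lt1// ltr1n.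
have Ei (i : nat) : N (\1_(E i)) * (2 ^+ i * l) <= l * v * z ^+ i.
  have i0 : 0 < 2 ^+ i * l by rewrite mulr_gt0// exprn_gt0.
  have h := weak_distrib_le p0 Y0 i0 mF wF.
  rewrite (le_trans (ler_wpM2r (ltW i0) h))//.
  have -> : Y / (2 ^+ i * l) = v `^ p^-1 * 2 `^ (- i%:R).
    rewrite /l !powRN powR_mulrn//.
    have : 0 < v `^ p^-1 by rewrite powR_gt0.
    have : 0 < 2 ^+ i :> R by rewrite exprn_gt0.
    by move: (v `^ _) (2 ^+ i) => c d c0 d0; field; rewrite !lt0r_neq0.
  rewrite powRM ?powR_ge0// -!powRrM mulVf ?lt0r_neq0// powRr1 ?(ltW v0)//.
  rewrite -[2 ^+ i]powR_mulrn// /z -powR_mulrn ?powR_ge0// -powRrM.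
  rewrite (_ : (1 - p) * i%:R = - i%:R * p + i%:R); last ring.
  rewrite powRD ?pnatr_eq0 ?implybT//.
  rewrite le_eqVlt; apply/orP; left; apply/eqP; ring.
rewrite -lv /weak_cst mulrDl mul1r lerD2l (@le_trans _ _ (\sum_(i < K) l * v * z ^+ i))//.
  by apply: ler_sum => i _; rewrite (posfunZ pN)// mulrC Ei.
rewrite -mulr_sumr mulrC ler_wpM2r//; first by rewrite mulr_ge0 ?ltW.
exact: sum_geo_le.
Qed.

End WeakType.

(** * Partial sums and their commutator with multiplication by x *)

Section PartialSums.
Context {R : realType}.
Notation X := `[-1, (1 : R)]%classic.
Context (alpha beta : R) (k : nat) (a M : 'I_k -> R) (P : nat -> {poly R}).
Context (a1 : forall i, -1 <= a i <= 1) (M0 : forall i, 0 < M i).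
Context (oP : orthonormal_family alpha beta a M P).
Notation N := (nuR alpha beta a M).
Notation S := (Sn alpha beta a M P).
Let ij := integrable_jweight oP.
Let pN : posfun X N := posfun_nu a1 M0 ij.
Let bP (p : {poly R}) : bmeas X (fun x => p.[x]) := bmeas_hornerX p.

Definition fcoef j (f : R -> R) := N (fun x => (P j).[x] * f x).

Lemma SnE n f : bmeas X f -> S n f = fun x => (\sum_(j < n.+1) fcoef j f *: P j).[x].
Proof.
move=> bf; apply/funext => x.
transitivity (N (fun y => \sum_(j < n.+1) (P j).[x] * ((P j).[y] * f y))).
  rewrite /Sn /nuR; congr (fine (nu_int _ _ _ _ _)).
  by apply/funext => y; rewrite /CD_kernel mulr_suml; apply: eq_bigr => j _; rewrite mulrA.
rewrite (posfun_sum pN) => [|j]; last by apply: bmeasZ; exact: bmeasM.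
rewrite horner_sum; apply: eq_bigr => j _.
rewrite hornerZ mulrC (posfunZ pN); last exact: bmeasM.
by [].
Qed.

Lemma bmeas_Sn n f : bmeas X f -> bmeas X (S n f).
Proof. by move=> bf; rewrite (SnE _ bf); exact: bP. Qed.

Lemma nu_Sn n f g : bmeas X f -> bmeas X g ->
  N (fun x => S n f x * g x) = \sum_(j < n.+1) fcoef j f * fcoef j g.
Proof.
move=> bf bg; rewrite SnE//.
have -> : (fun x => (\sum_(j < n.+1) fcoef j f *: P j).[x] * g x) =
    fun x => \sum_(j < n.+1) fcoef j f * ((P j).[x] * g x).
  by apply/funext => x; rewrite horner_sum mulr_suml; apply: eq_bigr => j _; rewrite hornerZ mulrA.
rewrite (posfun_sum pN) => [|j]; last by apply: bmeasZ; exact: bmeasM.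
by apply: eq_bigr => j _; rewrite (posfunZ pN)//; exact: bmeasM.
Qed.

Lemma nu_Sn_diff n f g : bmeas X f -> bmeas X g ->
  N (fun x => S n.+1 f x * g x) - N (fun x => S n f x * g x) =
  fcoef n.+1 f * fcoef n.+1 g.
Proof. by move=> bf bg; rewrite !nu_Sn// big_ord_recr/= addrAC subrr add0r. Qed.

Definition jacobi j i := N (fun x => x * (P j).[x] * (P i).[x]).

Lemma jacobiC j i : jacobi j i = jacobi i j.
Proof. by congr nuR; apply/funext => x; rewrite mulrAC. Qed.

(** The degree of x P_j is j + 1, so only j = n meets P_(n+1), through the leading coefficients. *)
Lemma jacobi_above n j : (j <= n)%N ->
  jacobi j n.+1 = (j == n)%:R * (lead P n / lead P n.+1).
Proof.
move=> jn; rewrite jacobiC.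
have -> : jacobi n.+1 j = N (fun x => (P n.+1).[x] * ('X * P j).[x]).
  by congr nuR; apply/funext => x; rewrite hornerM hornerX; ring.
have sX : size ('X * P j) = j.+2.
  have P0 : P j != 0 by rewrite -size_poly_eq0 oP.1.
  by rewrite mulrC size_mulX// oP.1.
have lE m : lead P m = (P m)`_m by rewrite /lead lead_coefE oP.1.
rewrite (nu_lead a1 M0 oP) ?sX// coefXM/=.
have [->|jn'] := eqVneq j n; first by rewrite mul1r [in RHS]lE !lE.
by rewrite mul0r nth_default ?mul0r// oP.1 ltn_neqAle jn' jn.
Qed.

Lemma mulX_jacobi n j : (j <= n)%N -> 'X * P j = \sum_(i < n.+2) jacobi j i *: P i.
Proof.
move=> jn; have sX : (size ('X * P j)%R <= n.+2)%N.
  have P0 : P j != 0 by rewrite -size_poly_eq0 oP.1.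
  by rewrite mulrC size_mulX// oP.1.
have [c cE] := orthonormal_span oP sX.
rewrite cE; apply: eq_bigr => i _; congr (_ *: _).
have -> : jacobi j i = N (fun x => \sum_(l < n.+2) c l * ((P l).[x] * (P i).[x])).
  congr nuR; apply/funext => x.
  have -> : x * (P j).[x] = ('X * P j).[x] by rewrite hornerM hornerX.
  rewrite cE horner_sum mulr_suml; apply: eq_bigr => l _.
  by rewrite hornerZ mulrA.
rewrite (posfun_sum pN) => [|l]; last by apply: bmeasZ; exact: bmeasM.
rewrite (bigD1 i)//= big1 ?addr0 => [|l li]; rewrite (posfunZ pN) ?(nu_orthonormal oP);
  try by exact: bmeasM.
  by rewrite eqxx mulr1.
by rewrite (_ : (l == i :> nat) = false) ?mulr0//; exact: negbTE li.
Qed.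

Lemma bmeasX_mul f : bmeas X f -> bmeas X (fun x => x * f x).
Proof.
move=> bf; apply: bmeasM => //; have := bP 'X; congr bmeas.
by apply/funext => x; rewrite hornerX.
Qed.

Lemma fcoef_mulX n j f : (j <= n)%N -> bmeas X f ->
  fcoef j (fun x => x * f x) = \sum_(i < n.+2) jacobi j i * fcoef i f.
Proof.
move=> jn bf; rewrite /fcoef.
have -> : (fun x => (P j).[x] * (x * f x)) =
    fun x => \sum_(i < n.+2) jacobi j i * ((P i).[x] * f x).
  apply/funext => x; rewrite mulrCA mulrA.
  have -> : x * (P j).[x] = ('X * P j).[x] by rewrite hornerM hornerX.
  rewrite (mulX_jacobi jn) horner_sum mulr_suml; apply: eq_bigr => i _.
  by rewrite hornerZ mulrA.
rewrite (posfun_sum pN) => [|i]; last by apply: bmeasZ; exact: bmeasM.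
by apply: eq_bigr => i _; rewrite (posfunZ pN)//; exact: bmeasM.
Qed.

(* The Christoffel-Darboux formula, as the rank-two commutator of [S n] with
   multiplication by [x]. *)
Lemma nu_Sn_commutator n f g : bmeas X f -> bmeas X g ->
  N (fun x => S n f x * (x * g x)) - N (fun x => S n (fun y => y * f y) x * g x) =
  lead P n / lead P n.+1 * (fcoef n f * fcoef n.+1 g - fcoef n.+1 f * fcoef n g).
Proof.
move=> bf bg; have bXf := bmeasX_mul bf; have bXg := bmeasX_mul bg.
rewrite !nu_Sn// -sumrB.
pose T j i := jacobi j i * (fcoef j f * fcoef i g - fcoef i f * fcoef j g).
have -> : \sum_(j < n.+1) (fcoef j f * fcoef j (fun x => x * g x) -
    fcoef j (fun y => y * f y) * fcoef j g) = \sum_(j < n.+1) \sum_(i < n.+2) T j i.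
  apply: eq_bigr => j _; have jn : (j <= n)%N by rewrite -ltnS.
  rewrite (fcoef_mulX jn bf) (fcoef_mulX jn bg) mulr_sumr mulr_suml -sumrB.
  by apply: eq_bigr => i _; rewrite /T; ring.
under eq_bigr do rewrite big_ord_recr/=.
rewrite big_split/= [X in X + _](_ : _ = 0) ?add0r.
  rewrite big_ord_recr/= big1 ?add0r => [|j _]; rewrite /T jacobi_above//.
    by rewrite eqxx mul1r.
  by rewrite ltn_eqF// !mul0r.
  by rewrite ltnW.
(* The column i = n + 1 has been split off. On the remaining square block [T] is antisymmetric,
   since [jacobi] is symmetric, so the block equals its own negative. *)
set U := \sum_(j < n.+1) _.
suff : U = - U by move/eqP; rewrite -addr_eq0 -mulr2n mulrn_eq0 => /eqP.
rewrite {1}/U exchange_big -sumrN; apply: eq_bigr => i _; rewrite -sumrN.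
by apply: eq_bigr => j _; rewrite /T jacobiC; ring.
Qed.

End PartialSums.

(** * Explicit integrals and measures of intervals *)

Section Explicit.
Context {R : realType}.
Notation mu := (@lebesgue_measure R).
Notation D := `[0, (pi : R)]%classic.
Notation X := `[-1, (1 : R)]%classic.
Implicit Types (x y e p : R).

Lemma wgtD e1 e2 d1 d2 x : -1 < x < 1 -> wgt e1 e2 x * wgt d1 d2 x = wgt (e1 + d1) (e2 + d2) x.
Proof.
move=> /andP[x1 x2]; rewrite /wgt mulrACA -!powRD//; apply/implyP => _; lra.
Qed.

Lemma wgt_powR e1 e2 p x : wgt e1 e2 x `^ p = wgt (e1 * p) (e2 * p) x.
Proof. by rewrite /wgt powRM ?powR_ge0// -!powRrM. Qed.

Lemma wgt_half e1 e2 x : wgt (e1 / 2) (e2 / 2) x ^+ 2 = wgt e1 e2 x.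
Proof.
by rewrite /wgt exprMn; congr (_ * _); rewrite -powR_mulrn ?powR_ge0// -powRrM divfK ?pnatr_eq0.
Qed.

Lemma powR_ge1_le4 e x : 1 <= x <= 4 -> x `^ e <= 4 `^ `|e|.
Proof.
move=> /andP[x1 x4]; rewrite (@le_trans _ _ (x `^ `|e|))//.
  by rewrite ler_powR// ler_norm.
by rewrite ge0_ler_powR ?nnegrE//; lra.
Qed.

Lemma powR_ge4V e x : 1 <= x <= 4 -> 4 `^ (- `|e|) <= x `^ e.
Proof.
move=> x14; have x0 : 0 < x by case/andP: x14 => *; lra.
have := powR_ge1_le4 (- e) x14; rewrite normrN => h.
by rewrite -[X in _ <= x `^ X]opprK [x `^ _]powRN [4 `^ _]powRN lef_pV2 ?posrE ?powR_gt0.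
Qed.

(** This weight is the derivative of ln (1 - cos y); it is the source of the logarithm in both
    cases. *)
Lemma wgt_cos_half y : 0 < y < pi -> wgt (- 2^-1) 2^-1 (cos y) = sin y / (1 - cos y) :> R.
Proof.
move=> y0; have /andP[c1 c2] := cos_itv_oo y0; have [/andP[y1 y2]] := y0.
have s0 : 0 <= sin y by rewrite sin_ge0_pi// !ltW.
apply/eqP; rewrite -(@eqrXn2 _ 2)//; last first.
- by rewrite divr_ge0//; lra.
- exact: wgt_ge0.
have -> : wgt (- 2^-1) 2^-1 (cos y) = wgt ((-1) / 2) (1 / 2) (cos y) :> R.
  by congr wgt; field.
rewrite wgt_half /wgt powR_inv1 ?powRr1; try lra.
rewrite expr_div_n sin2cos2; apply/eqP; field.
by apply/andP; split; apply: lt0r_neq0; lra.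
Qed.

Lemma Ipi_sin_div y1 y2 : 0 < y1 -> y1 < y2 -> y2 < pi ->
  Ipi (fun y => \1_`[y1, y2] y * (sin y / (1 - cos y))) =
  ln (1 - cos y2) - ln (1 - cos y1).
Proof.
move=> y10 y12 y2pi.
have SD : `[y1, y2] `<=` D by apply: subset_itv; rewrite bnd_simp ltW.
rewrite /Ipi (Rintegral_indicM _ (measurable_itv _) SD) /Rintegral.
have c1 y : y1 <= y -> y <= y2 -> 0 < 1 - cos y.
  move=> h1 h2; have /andP[_ h] : -1 < cos y < 1 by apply: cos_itv_oo; apply/andP; split; lra.
  by lra.
have dF y : y1 <= y -> y <= y2 ->
    is_derive y 1 (fun y : R => ln (1 - cos y)) (sin y / (1 - cos y)).
  move=> h1 h2; have d1 : is_derive y 1 (fun z : R => 1 - cos z) (sin y).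
    have h := is_deriveB (is_derive_cst (1 : R) y 1) (is_derive_cos y).
    by apply: (is_derive_eq h); rewrite sub0r opprK.
  have h := @is_derive1_comp _ _ (fun z : R => 1 - cos z) y _ _ (is_derive1_ln (c1 y h1 h2)) d1.
  by apply: (is_derive_eq h); rewrite mulrC.
have cF y : y1 <= y -> y <= y2 -> {for y, continuous (fun y : R => ln (1 - cos y))}.
  move=> h1 h2; apply: differentiable_continuous; apply/derivable1_diffP.
  by have [] := dF y h1 h2.
rewrite (@continuous_FTC2 R _ (fun y => ln (1 - cos y)))//.
- apply: continuous_in_subspaceT => y; rewrite inE/= in_itv/= => /andP[h1 h2].
  apply: (@continuousM R R (@sin R) (fun z => (1 - cos z)^-1)); first exact: continuous_sin.
  apply: continuousV; first by rewrite gt_eqF// c1.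
  by apply: continuousB; [exact: cst_continuous|exact: continuous_cos].
- split.
  + by move=> y; rewrite in_itv/= => /andP[h1 h2]; have [] := dF y (ltW h1) (ltW h2).
  + by apply: cvg_at_right_filter; apply: cF => //; exact: ltW.
  + by apply: cvg_at_left_filter; apply: cF => //; exact: ltW.
- move=> y; rewrite in_itv/= => /andP[h1 h2]; rewrite derive1E.
  by have [_ ->] := dF y (ltW h1) (ltW h2).
Qed.

(** Mean value theorem for cos: the increment is d, and at an intermediate z with 1 - 2d < cos z < 1
    - d the sine lies between d^(1/2) and 2 d^(1/2). *)
Lemma acos_diff (d : R) : 0 < d -> d < 2^-1 ->
  Num.sqrt d / 2 <= acos (1 - 2 * d) - acos (1 - d) <= Num.sqrt d.
Proof.
move=> d0 d1; set y1 := acos (1 - d); set y2 := acos (1 - 2 * d).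
have r1 : -1 <= 1 - d <= 1 by apply/andP; split; lra.
have r2 : -1 <= 1 - 2 * d <= 1 by apply/andP; split; lra.
have cy1 : cos y1 = 1 - d by rewrite acosK// in_itv.
have cy2 : cos y2 = 1 - 2 * d by rewrite acosK// in_itv.
have y10 : 0 < y1 by apply: acos_gt0; apply/andP; split; lra.
have y2pi : y2 < pi by apply: acos_ltpi; apply/andP; split; lra.
have D1 : y1 \in `[0, pi] by rewrite in_itv/= acos_ge0// acos_lepi.
have D2 : y2 \in `[0, pi] by rewrite in_itv/= acos_ge0// acos_lepi.
have y12 : y1 < y2 by rewrite -ltr_cos// cy1 cy2; lra.
have hd x : x \in `]y1, y2[ -> is_derive x 1 (@cos R) (- sin x) by move=> _; exact: is_derive_cos.
have hc : {within `[y1, y2], continuous (@cos R)}.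
  by apply: continuous_subspaceT; exact: continuous_cos.
have [z] := MVT y12 hd hc.
rewrite in_itv/= => /andP[z1 z2]; rewrite cy1 cy2 => h.
have Dz : z \in `[0, pi] by rewrite in_itv/=; apply/andP; split; lra.
have cz1 : cos z < 1 - d by rewrite -cy1 ltr_cos.
have cz2 : 1 - 2 * d < cos z by rewrite -cy2 ltr_cos.
have sz0 : 0 <= sin z by rewrite sin_ge0_pi//; move: Dz; rewrite in_itv.
have sz2 := sin2cos2 z.
set w := y2 - y1 in h *; set u := Num.sqrt d.
have u0 : 0 < u by rewrite sqrtr_gt0.
have u2 : u ^+ 2 = d by rewrite sqr_sqrtr// ltW.
have w0 : 0 < w by rewrite subr_gt0.
have hw : sin z * w = u ^+ 2 by rewrite u2; lra.
have s1 : u <= sin z.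
  rewrite -(@ler_pXn2r _ 2) ?nnegrE ?(ltW u0)// u2 sz2; nra.
have s2 : sin z <= 2 * u.
  rewrite -(@ler_pXn2r _ 2) ?nnegrE ?mulr_ge0 ?(ltW u0)// exprMn u2 sz2; nra.
apply/andP; split.
- rewrite ler_pdivrMr// -(ler_pM2l u0) -expr2 -hw; nra.
- rewrite -(ler_pM2l u0) -expr2 -hw; nra.
Qed.

Context (alpha beta : R) (k : nat) (a M : 'I_k -> R).
Context (a1 : forall i, -1 <= a i <= 1) (M0 : forall i, 0 < M i)
  (ij : mu.-integrable X (EFin \o jweight alpha beta)).
Notation s := (alpha + 1 / 2).
Notation t := (beta + 1 / 2).
Notation N := (nuR alpha beta a M).
Notation c0 := (c0 alpha beta).
Let pN : posfun X N := posfun_nu a1 M0 ij.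

Lemma within_wgt e1 e2 y1 y2 : 0 < y1 -> y1 <= y2 -> y2 < pi ->
  {within `[cos y2, cos y1], continuous (wgt e1 e2 : R -> R)}.
Proof.
move=> y10 y12 y2pi.
apply: continuous_in_subspaceT => x; rewrite inE/= in_itv/= => /andP[xa xb].
apply: continuous_wgt.
have /andP[h1 _] : -1 < cos y2 < 1 by apply: cos_itv_oo; rewrite y2pi andbT; lra.
have /andP[_ h2] : -1 < cos y1 < 1 by apply: cos_itv_oo; rewrite y10/=; lra.
by rewrite (lt_le_trans h1)// (le_lt_trans xb).
Qed.

Lemma bmeas_powR (A : set R) (f : R -> R) p : 0 <= p -> bmeas A f -> bmeas A (fun x => `|f x| `^ p).
Proof.
move=> p0 [mf [L fL]]; split.
  by apply: (measurableT_comp (measurable_powR _)); exact: measurableT_comp.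
exists (`|L| `^ p) => x Ax; rewrite ger0_norm ?powR_ge0//.
by rewrite ge0_ler_powR ?nnegrE// (le_trans (fL _ Ax))// ler_norm.
Qed.

Section Interval.
Context (y1 y2 : R) (y10 : 0 < y1) (y12 : y1 < y2) (y2pi : y2 < pi) (cy2 : 0 <= cos y2).
Let A : set R := `[cos y2, cos y1].
Context (aA : forall i, ~ A (a i)).

Lemma interval_itv x : A x -> 0 <= x < 1.
Proof.
rewrite /A /= in_itv/= => /andP[xa xb]; rewrite (le_trans cy2 xa)/=.
have /andP[_ h] : -1 < cos y1 < 1 by apply: cos_itv_oo; rewrite y10 (lt_trans y12 y2pi).
by rewrite (le_lt_trans xb).
Qed.

(** The condition on [d1] is the critical one: |f|^p W is then at most a constant times sin y / (1 -
    cos y). The powers of 2 + 2x are harmless because x >= 0 on the interval. *)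
Lemma nu_Lp_le p d1 d2 K (f : R -> R) : 0 < p -> 0 <= K -> bmeas X f ->
  d1 * p + s = - 2^-1 -> (forall x, X x -> `|f x| <= \1_A x * (K * wgt d1 d2 x)) ->
  N (fun x => `|f x| `^ p) <=
  c0 * (K `^ p * 4 `^ `|d2 * p + t - 2^-1|) * (ln (1 - cos y2) - ln (1 - cos y1)).
Proof.
move=> p0 K0 bf dps fK; have y1_gt0 := y10; have y1_lt := y12; have y2_lt := y2pi.
pose h x := K `^ p * wgt (d1 * p) (d2 * p) x.
have mh : measurable_fun setT h by apply: measurable_funM => //; exact: measurable_wgt.
have ch : {within `[cos y2, cos y1], continuous h}.
  move=> x; apply: (@continuousM R (subspace _) (fun=> K `^ p) (wgt (d1 * p) (d2 * p))).
    exact: cst_continuous.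
  by apply: within_wgt => //; exact: ltW.
have bh := bmeas_indic_within mh ch.
rewrite (@le_trans _ _ (N (fun x => \1_A x * h x)))//.
  apply: (posfun_le pN) => //; first by apply: bmeas_powR => //; exact: ltW.
  move=> x Xx; have := fK x Xx; rewrite indicE; case: (x \in A).
    rewrite !mul1r => fx; rewrite /h -wgt_powR -powRM ?wgt_ge0//.
    have KW : 0 <= K * wgt d1 d2 x by apply: mulr_ge0 => //; exact: wgt_ge0.
    by rewrite ge0_ler_powR ?nnegrE ?(ltW p0).
  by rewrite !mul0r normr_le0 => /eqP->; rewrite normr0 powR0// lt0r_neq0.
rewrite (nu_itv M ij y10 (ltW y12) y2pi mh ch aA).
have c00 := c0_gt0 alpha beta.
rewrite -mulrA ler_wpM2l ?(ltW c00)// -Ipi_sin_div//.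
have bs : bmeas D (fun y => \1_`[y1, y2] y * (sin y / (1 - cos y))).
  have := @bmeas_indicM R `[y1, y2]%classic D _ (measurable_itv _) (bmeas_comp_cos (ltW y10) (ltW y2pi)
    (bmeas_wgt_itv (- 2^-1) 2^-1 y10 (ltW y12) y2pi)).
  congr bmeas; apply/funext => y; rewrite indicE.
  case: (boolP (y \in _)) => [|_]; last by rewrite !mul0r.
  by rewrite inE/= in_itv/= => /andP[ya yb]; rewrite wgt_cos_half//; apply/andP; split; lra.
rewrite -(posfunZ posfun_Ipi)//; apply: (posfun_le posfun_Ipi).
- apply: bmeas_indicM; first exact: measurable_itv.
  apply: (bmeas_comp_cos (g := fun x => h x * wgt s t x)); [exact: ltW|exact: ltW|].
  by apply: bmeasM; [exact: bmeas_within|apply: bmeas_wgt_itv => //; exact: ltW].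
- exact: bmeasZ.
move=> y _; rewrite indicE; case: (boolP (y \in _)) => [|_]; last by rewrite !mul0r mulr0.
rewrite inE/= => yy; rewrite [X in X <= _]mul1r [X in _ <= _ * X]mul1r -wgt_cos_half; last first.
  by move: yy; rewrite in_itv/= => /andP[ya yb]; apply/andP; split; lra.
have /interval_itv/andP[x0 x1] : A (cos y) by apply: cos_itv => //; exact: ltW.
have x11 : -1 < cos y < 1 by rewrite x1 andbT; lra.
rewrite /h -mulrA wgtD// dps -mulrA ler_wpM2l ?powR_ge0//.
have -> : wgt (- 2^-1) (d2 * p + t) (cos y) =
    (2 + 2 * cos y) `^ (d2 * p + t - 2^-1) * wgt (- 2^-1) 2^-1 (cos y).
  rewrite /wgt mulrCA -powRD; last by apply/implyP => _; lra.
  by congr (_ * _ `^ _); ring.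
by rewrite ler_wpM2r ?wgt_ge0// powR_ge1_le4//; apply/andP; split; lra.
Qed.

Lemma nu_indic : N (\1_A) = c0 * Ipi (fun y => \1_`[y1, y2] y * wgt s t (cos y)).
Proof.
have m1 : measurable_fun setT (fun _ : R => 1 : R) by exact: measurable_cst.
have h1 : {within `[cos y2, cos y1], continuous (fun _ : R => 1 : R)}.
  by apply: continuous_subspaceT => x; exact: cst_continuous.
have := nu_itv M ij y10 (ltW y12) y2pi m1 h1 aA.
rewrite (_ : (fun x => \1_ _ x * 1) = \1_A); last by apply/funext => x; rewrite mulr1.
by move=> ->; congr (_ * Ipi _); apply/funext => y; rewrite [_ * wgt _ _ _]mul1r.
Qed.

Lemma Ipi_indic : Ipi (\1_`[y1, y2] : R -> R) = y2 - y1.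
Proof.
have SD : `[y1, y2] `<=` D by apply: subset_itv; rewrite bnd_simp ltW.
have -> : (\1_`[y1, y2] : R -> R) = fun y => \1_`[y1, y2] y * 1.
  by apply/funext => y; rewrite mulr1.
rewrite /Ipi (Rintegral_indicM _ (measurable_itv _) SD) Rintegral_cst//=.
by rewrite lebesgue_measure_itv/= lte_fin y12 -EFinD/= mul1r.
Qed.

Lemma nu_indic_le (m : R) : (forall x, A x -> wgt s t x <= m) ->
  N (\1_A) <= c0 * m * (y2 - y1).
Proof.
move=> wm; rewrite nu_indic -mulrA ler_wpM2l ?(ltW (c0_gt0 _ _))// -Ipi_indic.
have bi : bmeas D (\1_`[y1, y2] : R -> R) by apply: bmeas_indic; exact: measurable_itv.
rewrite -(posfunZ posfun_Ipi)//; apply: (posfun_le posfun_Ipi).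
- apply: bmeas_indicM; first exact: measurable_itv.
  by apply: bmeas_comp_cos; [exact: ltW|exact: ltW|apply: bmeas_wgt_itv => //; exact: ltW].
- exact: bmeasZ.
move=> y _; rewrite indicE; case: (boolP (y \in _)) => [|_]; last by rewrite mul0r mulr0.
rewrite inE/= => yy; rewrite [X in X <= _]mul1r [X in _ <= X]mulr1.
by apply: wm; apply: cos_itv => //; exact: ltW.
Qed.

Lemma nu_indic_ge (m : R) : (forall x, A x -> m <= wgt s t x) ->
  c0 * m * (y2 - y1) <= N (\1_A).
Proof.
move=> wm; rewrite nu_indic -mulrA ler_wpM2l ?(ltW (c0_gt0 _ _))// -Ipi_indic.
have bi : bmeas D (\1_`[y1, y2] : R -> R) by apply: bmeas_indic; exact: measurable_itv.
rewrite -(posfunZ posfun_Ipi)//; apply: (posfun_le posfun_Ipi).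
- exact: bmeasZ.
- apply: bmeas_indicM; first exact: measurable_itv.
  by apply: bmeas_comp_cos; [exact: ltW|exact: ltW|apply: bmeas_wgt_itv => //; exact: ltW].
move=> y _; rewrite indicE; case: (boolP (y \in _)) => [|_]; last by rewrite mul0r mulr0.
rewrite inE/= => yy; rewrite [X in _ <= X]mul1r [X in X <= _]mulr1.
by apply: wm; apply: cos_itv => //; exact: ltW.
Qed.

End Interval.
End Explicit.

(** * Test functions near the endpoint 1 *)

Section BumpEstimates.
Context {R : realType}.
Notation X := `[-1, (1 : R)]%classic.
Context (alpha beta : R) (k : nat) (a M : 'I_k -> R) (P : nat -> {poly R}).
Context (a1 : forall i, -1 <= a i <= 1) (M0 : forall i, 0 < M i).
Context (oP : orthonormal_family alpha beta a M P).
Notation s := (alpha + 1 / 2).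
Notation t := (beta + 1 / 2).
Notation N := (nuR alpha beta a M).
Notation S := (Sn alpha beta a M P).
Notation c0 := (c0 alpha beta).
Notation cst := (cst alpha beta).
Context (s0 : 0 < s).
Let ij := integrable_jweight oP.
Let pN : posfun X N := posfun_nu a1 M0 ij.

(** [|C0| + 1] and the positive bound W replace the given constant and the exact norm, to make the
    weak-type bound positive as [weak_pairing] requires. *)
Lemma nu_Sn_weak (p C0 W G : R) n (f g : R -> R) (B : set R) : 1 < p -> 0 < W -> 0 <= G ->
  (forall (n : nat) (f : R -> R), in_Lp alpha beta a M p f ->
     (weak_Lp_norm alpha beta a M p (S n f) <= C0%:E * Lp_norm alpha beta a M p f)%E) ->
  bmeas X f -> N (fun x => `|f x| `^ p) <= W ->
  bmeas X g -> measurable B -> (forall x, X x -> `|g x| <= G * \1_B x) ->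
  0 < N (\1_B) ->
  `|N (fun x => S n f x * g x)| <=
    weak_cst p * ((`|C0| + 1) * W `^ p^-1) * G * (N (\1_B)) `^ (1 - p^-1).
Proof.
move=> p1 W0 G0 hC bf fW bg mB gB v0; have p0 : 0 < p by lra.
have bfp : bmeas X (fun x => `|f x| `^ p) by apply: bmeas_powR => //; exact: ltW.
have nfp := nu_int_nuR a M ij bfp.
have Nf0 : 0 <= N (fun x => `|f x| `^ p) by apply: (posfun_ge0 pN) => // x _; exact: powR_ge0.
apply: (weak_pairing a1 M0 ij p1 _ (bmeas_Sn a1 M0 oP n bf)) => //.
  by rewrite mulr_gt0 ?powR_gt0// ltr_wpDl.
have inL : in_Lp alpha beta a M p f.
  by split; [exact: measurable_funTS bf.1|rewrite nfp ltry].
apply: (le_trans (hC n f inL)); rewrite /Lp_norm nfp poweR_EFin -EFinM lee_fin.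
rewrite (@le_trans _ _ ((`|C0| + 1) * N (fun x => `|f x| `^ p) `^ p^-1))//.
  by rewrite ler_wpM2r ?powR_ge0// (le_trans (ler_norm _))// lerDl.
rewrite ler_wpM2l ?addr_ge0// ge0_ler_powR ?nnegrE ?invr_ge0 ?(ltW p0) ?(ltW W0)//.
Qed.

Context (q : nat -> {poly R}) (C : R)
  (qC : forall j y, nsq (circ (q j) y) * wgt s t (cos y) <= C).

Lemma C_ge0 : 0 <= C.
Proof. by rewrite (le_trans _ (qC 0%N 0))// mulr_ge0 ?nsq_ge0// wgt_ge0. Qed.

(** At interior points W is invertible, so |q|^2 W <= C reads |q| <= C^(1/2) W^(-1/2). *)
Lemma norm_le_wgt (z x : R) j e : -1 < x < 1 -> 0 <= e ->
  z ^+ 2 <= e ^+ 2 * nsq (circ (q j) (acos x)) ->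
  `|z| <= e * (Num.sqrt C * wgt (- (s / 2)) (- (t / 2)) x).
Proof.
move=> x1 e0 ze; have w0 : 0 <= wgt (- (s / 2)) (- (t / 2)) x by exact: wgt_ge0.
have x1' : x \in `[-1, 1] by move: x1; rewrite in_itv/= => /andP[/ltW-> /ltW->].
rewrite -(@ler_pXn2r _ 2) ?nnegrE//; last first.
  by apply: mulr_ge0 => //; apply: mulr_ge0 => //; exact: sqrtr_ge0.
rewrite real_normK ?num_real// (le_trans ze)// exprMn ler_wpM2l ?sqr_ge0//.
rewrite exprMn sqr_sqrtr ?C_ge0// -!mulNr wgt_half.
have := qC j (acos x); rewrite acosK// => h.
have := ler_wpM2r (wgt_ge0 (- s) (- t) x) h.
by rewrite -mulrA wgtV// mulr1.
Qed.

Lemma rev_cheb_bound j n x : (size (q j) <= n)%N -> -1 < x < 1 ->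
  `|(rev_cheb (q j) n).[x]| <= Num.sqrt C * wgt (- (s / 2)) (- (t / 2)) x.
Proof.
move=> qn x1; rewrite -[leRHS]mul1r; apply: (@norm_le_wgt _ _ j) => //.
rewrite expr1n mul1r -{1}[x](acosK) ?rev_cheb_sq_le//.
by move: x1; rewrite in_itv/= => /andP[/ltW-> /ltW->].
Qed.

Lemma conj_bound j n x : (size (q j) <= n)%N -> -1 < x < 1 ->
  `|x * (rev_cheb (q j) n).[x] - (rev_cheb (q j) n.+1).[x]| <=
  wgt 2^-1 2^-1 x / 2 * (Num.sqrt C * wgt (- (s / 2)) (- (t / 2)) x).
Proof.
move=> qn x1; have x1' : x \in `[-1, 1] by move: x1; rewrite in_itv/= => /andP[/ltW-> /ltW->].
apply: (@norm_le_wgt _ _ j) => //; first by rewrite divr_ge0 ?wgt_ge0.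
have h := rev_cheb_conj_le (acos x) qn.
move: h; rewrite hornerD hornerN hornerM hornerX acosK// => h.
rewrite (le_trans h)// ler_wpM2r ?nsq_ge0// expr_div_n.
have -> : wgt 2^-1 2^-1 x = wgt (1 / 2) (1 / 2) x by congr wgt; field.
move: x1 => /andP[xa xb].
rewrite wgt_half /wgt !powRr1; try lra.
rewrite sin2cos2 acosK//; lra.
Qed.

Context (c : R) (c01 : 0 < c < 1) (hc : forall i, a i < 1 -> a i < c).

(** Mass points below 1 lie below c, and x2 < 1 avoids a possible mass at 1. *)
Lemma acos_itv (x1 x2 : R) : c <= x1 -> x1 < x2 -> x2 < 1 ->
  [/\ 0 < acos x2, acos x2 < acos x1, acos x1 < pi,
      cos (acos x1) = x1 /\ cos (acos x2) = x2 &
      forall i, ~ `[cos (acos x1), cos (acos x2)]%classic (a i)].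
Proof.
move: c01 => /andP[cp c1] h1 h2 h3.
have r1 : -1 <= x1 <= 1 by apply/andP; split; lra.
have r2 : -1 <= x2 <= 1 by apply/andP; split; lra.
have e1 : cos (acos x1) = x1 by rewrite acosK// in_itv.
have e2 : cos (acos x2) = x2 by rewrite acosK// in_itv.
split.
- by apply: acos_gt0; apply/andP; split; lra.
- by rewrite -ltr_cos ?in_itv/= ?acos_ge0 ?acos_lepi// e1 e2.
- by apply: acos_ltpi; apply/andP; split; lra.
- by [].
- move=> i; rewrite e1 e2 /= in_itv/= => /andP[xa xb].
  by have := @hc i (le_lt_trans xb h3); rewrite ltNge (le_trans h1 xa).
Qed.

Lemma phi_bound y1 y2 d1 d2 j n x : (size (q j) <= n)%N ->
  (`[cos y2, cos y1]%classic x -> -1 < x < 1) ->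
  `|phi q y1 y2 (wgt d1 d2) j n x| <=
  \1_`[cos y2, cos y1] x * (Num.sqrt C * wgt (d1 - s / 2) (d2 - t / 2) x).
Proof.
move=> qn Ax; rewrite /phi indicE; case: (boolP (_ \in _)) => [|_]; last first.
  by rewrite !mul0r normr0.
rewrite inE => /Ax x1; rewrite [X in `|X|]mul1r [X in _ <= X]mul1r normrM ger0_norm ?wgt_ge0//.
rewrite -wgtD// mulrCA ler_wpM2l ?wgt_ge0//; exact: rev_cheb_bound.
Qed.

Lemma psi_bound y1 y2 d1 d2 j n x : (size (q j) <= n)%N ->
  (`[cos y2, cos y1]%classic x -> -1 < x < 1) ->
  `|psi q y1 y2 (wgt d1 d2) j n x| <= \1_`[cos y2, cos y1] x *
    (Num.sqrt C / 2 * wgt (d1 + 2^-1 - s / 2) (d2 + 2^-1 - t / 2) x).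
Proof.
move=> qn Ax; rewrite /psi indicE; case: (boolP (_ \in _)) => [|_]; last first.
  by rewrite !mul0r normr0.
rewrite inE => /Ax x1; rewrite [X in `|X|]mul1r [X in _ <= X]mul1r normrM ger0_norm ?wgt_ge0//.
rewrite (le_trans (ler_wpM2l (wgt_ge0 d1 d2 x) (conj_bound qn x1)))//.
rewrite -!wgtD// le_eqVlt; apply/orP; left; apply/eqP.
by move: (wgt _ _ _) (wgt _ _ _) (wgt _ _ _) (Num.sqrt _) => u v w z; field.
Qed.

(** Kept in the form of a cosine image of an interval of angles, as the lemmas on integrals over
    intervals expect. *)
Definition shell (d : R) : set R := `[cos (acos (1 - 2 * d)), cos (acos (1 - d))].
(** Bounds C^(1/2) W^(-1/2), hence R_n, on the shell: as s > 0, the worst case is 2 - 2x = 2d. *)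
Definition shell_sup (d : R) := Num.sqrt C * (2 * d) `^ (- (s / 2)) * 4 `^ `|t / 2|.
Definition shell_cst : R := c0 * (4 `^ s * 4 `^ `|t|).

Section Bump.
Context (d : R) (d0 : 0 < d) (dc : 2 * d <= 1 - c).

Let dc1 : [/\ 0 < acos (1 - d), acos (1 - d) < acos (1 - 2 * d), acos (1 - 2 * d) < pi,
      cos (acos (1 - 2 * d)) = 1 - 2 * d /\ cos (acos (1 - d)) = 1 - d &
      forall i, ~ `[cos (acos (1 - 2 * d)), cos (acos (1 - d))]%classic (a i)].
Proof. by have h1 := d0; have h2 := dc; apply: acos_itv; lra. Qed.

Lemma shell_itv x : shell d x -> [/\ 2 * d <= 2 - 2 * x, 2 - 2 * x <= 4 * d,
  1 <= 2 + 2 * x <= 4 & -1 < x < 1].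
Proof.
have [_ _ _ [e1 e2] _] := dc1; rewrite /shell e1 e2 /= in_itv/= => /andP[xa xb].
have h1 := d0; have h2 := dc; have /andP[h3 h4] := c01.
by split; [lra|lra|apply/andP; split; lra|apply/andP; split; lra].
Qed.

Lemma shell_sup_bound x : shell d x -> Num.sqrt C * wgt (- (s / 2)) (- (t / 2)) x <= shell_sup d.
Proof.
move=> /shell_itv[x1 x2 x3 x4]; have h1 := d0.
rewrite /shell_sup -mulrA ler_wpM2l ?sqrtr_ge0// /wgt ler_pM ?powR_ge0//; last first.
  by rewrite -normrN powR_ge1_le4.
have s0' := s0; have x0 : 0 < 2 - 2 * x by lra.
have dd : 0 < 2 * d by lra.
rewrite !powRN lef_pV2 ?posrE ?powR_gt0//.
by rewrite ge0_ler_powR ?nnegrE ?(ltW x0) ?(ltW dd)// divr_ge0// ltW.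
Qed.

Lemma shell_sup_ge0 : 0 <= shell_sup d.
Proof. by rewrite /shell_sup !mulr_ge0 ?sqrtr_ge0 ?powR_ge0. Qed.

Lemma wgt_shell x : shell d x ->
  (2 * d) `^ s * 4 `^ (- `|t|) <= wgt s t x <= 4 `^ s * 4 `^ `|t| * d `^ s.
Proof.
move=> /shell_itv[x1 x2 x3 x4]; have h1 := d0; have s0' := ltW s0.
apply/andP; split.
  rewrite /wgt ler_pM ?powR_ge0 ?powR_ge4V//.
  by rewrite ge0_ler_powR ?nnegrE//; lra.
rewrite /wgt mulrAC -powRM; [|lra|lra].
rewrite ler_pM ?powR_ge0 ?powR_ge1_le4//.
by rewrite ge0_ler_powR ?nnegrE//; lra.
Qed.

Lemma nu_shell_gt0 : 0 < N (\1_(shell d)).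
Proof.
have [y1 y12 y2 _ aA] := dc1; have h1 := d0; have c00 := c0_gt0 alpha beta.
have wB x : shell d x -> (2 * d) `^ s * 4 `^ (- `|t|) <= wgt s t x by move=> /wgt_shell/andP[].
rewrite (lt_le_trans _ (nu_indic_ge M ij y1 y12 y2 aA wB))// !mulr_gt0 ?subr_gt0// powR_gt0//.
by rewrite mulr_gt0.
Qed.

(** The weight is of order d^s on the shell, and the corresponding arc has length at most
    d^(1/2). *)
Lemma nu_shell_le : N (\1_(shell d)) <= shell_cst * d `^ (s + 2^-1).
Proof.
have [y1 y12 y2 _ aA] := dc1; have h1 := d0; have c00 := c0_gt0 alpha beta.
have h2 := dc; have /andP[h3 h4] := c01.
have wB x : shell d x -> wgt s t x <= 4 `^ s * 4 `^ `|t| * d `^ s by move=> /wgt_shell/andP[].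
rewrite (le_trans (nu_indic_le M ij y1 y12 y2 aA wB))//.
have /andP[_ hw] : Num.sqrt d / 2 <= acos (1 - 2 * d) - acos (1 - d) <= Num.sqrt d.
  by apply: acos_diff => //; lra.
have -> : d `^ (s + 2^-1) = d `^ s * Num.sqrt d.
  by rewrite powRD ?(lt0r_neq0 h1) ?implybT// powR12_sqrt ?(ltW h1).
rewrite /shell_cst -!mulrA; apply: ler_wpM2l; first exact: ltW.
by rewrite !ler_wpM2l ?powR_ge0.
Qed.

End Bump.

(* The scale-invariant size of the bump at distance [d] from [1], at the larger endpoint. *)
Lemma shell_sup_nu_le (p d : R) : 1 < p -> s * p = 2 * (alpha + 1) -> 0 < d -> 2 * d <= 1 - c ->
  shell_sup d * N (\1_(shell d)) `^ (1 - p^-1) <=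
  (Num.sqrt C * 2 `^ (- (s / 2)) * 4 `^ `|t / 2| * shell_cst `^ (1 - p^-1)) * Num.sqrt d.
Proof.
move=> p1 sp d0 dc; have p0 : 0 < p by lra.
have ip : 0 <= 1 - p^-1 by rewrite subr_ge0 invf_le1// ltW.
have Kv0 : 0 <= shell_cst by rewrite /shell_cst mulr_ge0 ?(ltW (c0_gt0 _ _))// mulr_ge0 ?powR_ge0.
have v0 := nu_shell_gt0 d0 dc.
have h : N (\1_(shell d)) `^ (1 - p^-1) <= (shell_cst * d `^ (s + 2^-1)) `^ (1 - p^-1).
  rewrite ge0_ler_powR ?nnegrE//; [exact: ltW|by rewrite mulr_ge0 ?powR_ge0|exact: nu_shell_le].
rewrite (le_trans (ler_wpM2l (shell_sup_ge0 d) h))//.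
rewrite powRM ?powR_ge0// -powRrM /shell_sup powRM ?(ltW d0)//.
(* Since s p = 2 s + 1, the quotient (s + 1/2) / p equals s / 2; the powers of d then cancel down to
   d^(1/2). *)
have -> : (s + 2^-1) * (1 - p^-1) = s / 2 + 2^-1.
  have : p * s = 2 * s + 1 by rewrite mulrC sp; field.
  move=> ps; apply: (mulfI (lt0r_neq0 p0)).
  have -> : p * ((s + 2^-1) * (1 - p^-1)) = p * s + p / 2 - s - 2^-1 by field; rewrite lt0r_neq0.
  have -> : p * (s / 2 + 2^-1) = p * s / 2 + p / 2 by ring.
  by rewrite ps; field.
have -> : d `^ (s / 2 + 2^-1) = d `^ (s / 2) * Num.sqrt d.
  by rewrite powRD ?(lt0r_neq0 d0) ?implybT// powR12_sqrt ?(ltW d0).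
have e : d `^ (- (s / 2)) * d `^ (s / 2) = 1.
  by rewrite -powRD ?(lt0r_neq0 d0) ?implybT// addNr powRr0.
rewrite le_eqVlt; apply/orP; left; apply/eqP.
move: (d `^ (- (s / 2))) (d `^ (s / 2)) e => x1 x2 e.
move: (Num.sqrt C) (2 `^ _) (4 `^ _) (shell_cst `^ _) (Num.sqrt d) => u1 u2 u3 u4 u5.
rewrite -[RHS]mulr1 -e; ring.
Qed.

End BumpEstimates.

Lemma root_growth_absurd {R : realType} (p D E : R) : 1 < p -> 0 < D ->
  (forall L, 0 < L -> D * L <= E * L `^ p^-1) -> False.
Proof.
move=> p1 D0 h; have p0 : 0 < p by lra.
have ip : 0 < 1 - p^-1 by rewrite subr_gt0 invf_lt1.
(* L is chosen so that L^(1 - 1/p) = B; the hypothesis then reads |E| + D <= E. *)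
pose B := `|E| / D + 1; have B0 : 0 < B by rewrite ltr_wpDl// divr_ge0// ltW.
pose L := B `^ (1 - p^-1)^-1; have L0 : 0 < L by rewrite powR_gt0.
have := h L L0.
have -> : D * L = D * B * L `^ p^-1.
  rewrite -mulrA; congr (_ * _).
  have -> : B = L `^ (1 - p^-1) by rewrite /L -powRrM mulVf ?powRr1 ?(ltW B0)// lt0r_neq0.
  by rewrite -powRD ?subrK ?powRr1 ?(ltW L0)// (lt0r_neq0 L0) implybT.
rewrite ler_pM2r ?powR_gt0// /B mulrDr mulr1 mulrCA divff ?lt0r_neq0// mulr1.
by have := ler_norm E; lra.
Qed.

(** * Concrete test functions, and the lower critical exponent *)

Section Cases.
Context {R : realType}.
Notation D := `[0, (pi : R)]%classic.
Notation X := `[-1, (1 : R)]%classic.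
Context (alpha beta : R) (k : nat) (a M : 'I_k -> R) (P : nat -> {poly R}).
Context (a1 : forall i, -1 <= a i <= 1) (M0 : forall i, 0 < M i).
Context (oP : orthonormal_family alpha beta a M P).
Notation s := (alpha + 1 / 2).
Notation t := (beta + 1 / 2).
Notation N := (nuR alpha beta a M).
Notation S := (Sn alpha beta a M P).
Notation c0 := (c0 alpha beta).
Notation cst := (cst alpha beta).
Context (s0 : 0 < s).
Let ij := integrable_jweight oP.
Let pN : posfun X N := posfun_nu a1 M0 ij.
Context (q : nat -> {poly R}) (q0 : forall j, (q j)`_0 = 1)
  (qa : forall j i, nsq (circ (q j) (acos (a i))) = 0)
  (C : R) (qC : forall j y, nsq (circ (q j) y) * wgt s t (cos y) <= C)
  (qI : forall g, bmeas D g ->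
      Ipi (fun y => g y * (nsq (circ (q j) y) * wgt s t (cos y))) @[j --> \oo] --> Ipi g).
Context (c : R) (c01 : 0 < c < 1) (hc : forall i, a i < 1 -> a i < c).
Context (p C0 : R) (p1 : 1 < p) (hC : forall (n : nat) (f : R -> R), in_Lp alpha beta a M p f ->
   (weak_Lp_norm alpha beta a M p (S n f) <= C0%:E * Lp_norm alpha beta a M p f)%E).

Let c00 : 0 < c0 := c0_gt0 alpha beta.
Let cst0 : 0 < cst := cst_gt0 alpha beta.

Section Shell.
Context (d : R) (d0 : 0 < d) (dc : 2 * d <= 1 - c).
Notation B := (shell d).

(** [wgt 0 0] is the constant 1, so this is R_n cut off to the shell, in a form to which the lemmas
    on [phi] apply. *)
Definition bump j n := phi q (acos (1 - d)) (acos (1 - 2 * d)) (wgt 0 0) j n.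

Let dc1 : [/\ 0 < acos (1 - d), acos (1 - d) < acos (1 - 2 * d), acos (1 - 2 * d) < pi,
      cos (acos (1 - 2 * d)) = 1 - 2 * d /\ cos (acos (1 - d)) = 1 - d &
      forall i, ~ `[cos (acos (1 - 2 * d)), cos (acos (1 - d))]%classic (a i)].
Proof. by have h1 := d0; have h2 := dc; apply: (acos_itv c01 hc); lra. Qed.

Lemma bmeas_bump j n : bmeas X (bump j n).
Proof.
have [h1 h2 h3 _ _] := dc1.
by apply: bmeas_phi; [exact: measurable_wgt|apply: within_wgt => //; exact: ltW].
Qed.

Lemma bump_bound j n x : (size (q j) <= n)%N ->
  `|bump j n x| <= shell_sup alpha beta C d * \1_B x.
Proof.
move=> qn; have hB := shell_itv c01 hc d0 dc.
rewrite (le_trans (phi_bound qC 0 0 qn _))// => [/hB[]//|].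
rewrite -/(shell d) indicE; case: (boolP (x \in _)) => [|_]; last by rewrite mul0r mulr0.
rewrite inE => Bx; rewrite [X in X <= _]mul1r mulr1 !add0r.
by have := shell_sup_bound beta s0 C c01 hc d0 dc Bx; rewrite -!mulNr.
Qed.

Lemma bumpM_bound j n x : (size (q j) <= n)%N ->
  `|(1 - x) * bump j n x| <= 2 * d * shell_sup alpha beta C d * \1_B x.
Proof.
move=> qn; have := bump_bound x qn; move: (bump j n x) => z.
rewrite normrM -[2 * d * _ * _]mulrA indicE; case: (boolP (x \in _)) => [|_]; last first.
  by rewrite !mulr0 normr_le0 => /eqP ->; rewrite normr0 mulr0.
rewrite inE => /(shell_itv c01 hc d0 dc)[x1 x2 x3 /andP[x4 x5]].
by move=> h; rewrite ler_pM// ger0_norm; lra.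
Qed.

Lemma lim2_bump : lim2 (fun j n => fcoef alpha beta a M P n (bump j n))
  (cst * (c0 * (2^-1 * (acos (1 - 2 * d) - acos (1 - d))))).
Proof.
have [h1 h2 h3 _ aA] := dc1.
have := lim2_phi a1 M0 oP q0 qa qC qI h1 (ltW h2) h3 (measurable_wgt 0 0)
  (@within_wgt _ 0 0 _ _ h1 (ltW h2) h3) aA.
rewrite (_ : Ipi _ = acos (1 - 2 * d) - acos (1 - d))//.
rewrite -(Ipi_indic h1 h2 h3); congr Ipi; apply/funext => y.
by rewrite /wgt !powRr0 !mulr1.
Qed.

(** Cauchy-Schwarz against a unit vector. The bound may depend on d; only its independence of j and
    n matters, as it is multiplied by a coefficient tending to 0. *)
Lemma bump_coef_bounded : exists K, ev2 (fun j n => `|fcoef alpha beta a M P n.+1 (bump j n)| <= K).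
Proof.
have [h1 h2 h3 _ aA] := dc1.
have := nu_phi_sq oP qC h1 (ltW h2) h3 (measurable_wgt 0 0)
  (@within_wgt _ 0 0 _ _ h1 (ltW h2) h3) aA.
set K := c0 * _ => hK; exists (Num.sqrt K); apply: (ev2_imp hK) => j n h.
have := posfun_cauchy_schwarz pN (bmeas_hornerX (P n.+1)) (bmeas_bump j n).
under [X in _ <= N X * _]eq_fun do rewrite expr2.
rewrite (nu_orthonormal oP) eqxx mul1r => /le_trans/(_ h) h'.
by rewrite -sqrtr_sqr ler_sqrt// (le_trans (sqr_ge0 _) h').
Qed.

End Shell.

Section Far.
Context (L : R) (L0 : 0 < L).
(* Chosen so that [ln ((1 - c) / (2 * gap)) = L]. *)
Definition gap : R := (1 - c) / 2 * expR (- L).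
Definition far_y1 := acos (1 - 2 * gap).
Definition far_y2 := acos c.
Notation A := `[cos far_y2, cos far_y1]%classic.

Lemma gap_gt0 : 0 < gap.
Proof. by have /andP[_ h] := c01; rewrite mulr_gt0 ?expR_gt0 ?divr_gt0 ?subr_gt0. Qed.

Lemma gap_lt : 2 * gap < 1 - c.
Proof.
have /andP[_ h] := c01; rewrite /gap mulrA mulrCA divff// mulr1 gtr_pMr ?subr_gt0//.
by rewrite expR_lt1 oppr_lt0.
Qed.

Lemma far_itv : [/\ 0 < far_y1, far_y1 < far_y2, far_y2 < pi, cos far_y2 = c /\ cos far_y1 = 1 - 2 * gap &
   forall i, ~ A (a i)].
Proof. by have h1 := gap_gt0; have h2 := gap_lt; apply: (acos_itv c01 hc); lra. Qed.

Lemma far_cos x : A x -> c <= x <= 1 - 2 * gap.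
Proof. by have [_ _ _ [-> ->] _] := far_itv; rewrite /= in_itv. Qed.

Lemma far_in x : A x -> -1 < x < 1.
Proof.
move=> /far_cos/andP[h1 h2]; have h3 := gap_gt0; have /andP[h4 h5] := c01.
by apply/andP; split; lra.
Qed.

Lemma far_ln : ln (1 - cos far_y2) - ln (1 - cos far_y1) = L.
Proof.
have [_ _ _ [-> ->] _] := far_itv; have /andP[_ h] := c01.
have -> : 1 - (1 - 2 * gap) = (1 - c) * expR (- L) by rewrite /gap; field.
rewrite lnM ?posrE ?expR_gt0 ?subr_gt0// expRK; lra.
Qed.

Lemma Ipi_far : Ipi (fun y => \1_`[far_y1, far_y2] y * wgt (- 2^-1) 2^-1 (cos y)) = L.
Proof.
have [h1 h2 h3 _ _] := far_itv; rewrite -far_ln -Ipi_sin_div//; congr Ipi.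
apply/funext => y; rewrite indicE; case: (boolP (y \in _)) => [|_]; last by rewrite !mul0r.
rewrite inE/= in_itv/= => /andP[ya yb]; rewrite wgt_cos_half//.
by rewrite (lt_le_trans h1 ya) (le_lt_trans yb h3).
Qed.

(** The factor sin^2 y from [lim2_psi1] is a quarter of [wgt 1 1]; it restores the logarithmic
    weight. *)
Lemma Ipi_far_sin :
  Ipi (fun y => \1_`[far_y1, far_y2] y * wgt (- (3 / 2)) (- 2^-1) (cos y) * sin y ^+ 2) = L / 4.
Proof.
have [h1 h2 h3 _ _] := far_itv.
transitivity (Ipi (fun y => 4^-1 * (\1_`[far_y1, far_y2] y * wgt (- 2^-1) 2^-1 (cos y)))).
  congr Ipi; apply/funext => y; rewrite indicE; case: (boolP (y \in _)) => [|_]; last first.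
    by rewrite !mul0r mulr0.
  rewrite inE/= in_itv/= => /andP[ya yb].
  have y0 : 0 < y < pi by rewrite (lt_le_trans h1 ya) (le_lt_trans yb h3).
  have cy := cos_itv_oo y0; have /andP[ca cb] := cy.
  have -> : sin y ^+ 2 = 4^-1 * wgt 1 1 (cos y).
    by rewrite sin2cos2 /wgt !powRr1; lra.
  rewrite mulrCA -[_ * wgt 1 1 _]mulrA wgtD//.
  by congr (_ * (_ * wgt _ _ _)); field.
have b : bmeas D (fun y => \1_`[far_y1, far_y2] y * wgt (- 2^-1) 2^-1 (cos y)).
  apply: bmeas_indicM; first exact: measurable_itv.
  by apply: bmeas_comp_cos; [exact: ltW|exact: ltW|apply: bmeas_wgt_itv => //; exact: ltW].
by have := posfunZ posfun_Ipi 4^-1 b; rewrite Ipi_far mulrC.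
Qed.

Definition far_cst (d2 : R) := c0 * 4 `^ `|d2 * p + t - 2^-1|.

Lemma far_cst_gt0 d2 : 0 < far_cst d2.
Proof. by rewrite mulr_gt0// powR_gt0. Qed.

Lemma far_weak d1 d2 K G n (f g : R -> R) (B : set R) : 0 < K -> 0 <= G -> d1 * p + s = - 2^-1 ->
  bmeas X f -> (forall x, X x -> `|f x| <= \1_A x * (K * wgt d1 d2 x)) ->
  bmeas X g -> measurable B -> (forall x, X x -> `|g x| <= G * \1_B x) -> 0 < N (\1_B) ->
  `|N (fun x => S n f x * g x)| <=
  weak_cst p * ((`|C0| + 1) * (K * (far_cst d2 `^ p^-1 * L `^ p^-1))) * G * (N (\1_B)) `^ (1 - p^-1).
Proof.
move=> K0 G0 dps bf fK bg mB gB v0; have p0 : 0 < p by have := p1; lra.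
have [h1 h2 h3 [cy _] aA] := far_itv; have h4 : 0 <= cos far_y2.
  by rewrite cy; have /andP[/ltW] := c01.
have := nu_Lp_le a1 M0 ij h1 h2 h3 h4 aA p0 (ltW K0) bf dps fK.
rewrite far_ln => fW.
have -> : K * (far_cst d2 `^ p^-1 * L `^ p^-1) = (c0 * (K `^ p * 4 `^ `|d2 * p + t - 2^-1|) * L) `^ p^-1.
  have e0 := ltW (far_cst_gt0 d2); have l0 := ltW L0; have k0 := powR_ge0 K p.
  rewrite -(powRM _ e0 l0).
  have {1}-> : K = (K `^ p) `^ p^-1 by rewrite -powRrM mulfV ?lt0r_neq0// powRr1// ltW.
  by rewrite -(powRM _ k0 (mulr_ge0 e0 l0)); congr (_ `^ _); rewrite /far_cst; ring.
have W0 : 0 < c0 * (K `^ p * 4 `^ `|d2 * p + t - 2^-1|) * L.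
  by apply: mulr_gt0 => //; apply: mulr_gt0 => //; apply: mulr_gt0; exact: powR_gt0.
exact: (nu_Sn_weak a1 M0 oP n p1 W0 G0 hC bf fW bg mB gB v0).
Qed.

End Far.

Definition weak_factor := weak_cst p * (`|C0| + 1).

(* The equation says [p = 4 (alpha + 1) / (2 alpha + 3)]. *)
Lemma case_minus : (1 + s) * p = 2 * s + 1 ->
  exists D E, 0 < D /\ forall L, 0 < L -> D * L <= E * L `^ p^-1.
Proof.
(* The shell is fixed here, so its measure and the bound for R_n on it can enter the constant E. *)
move=> sp; pose d := (1 - c) / 2.
have d0 : 0 < d by have /andP[_ h] := c01; rewrite divr_gt0// subr_gt0.
have dc : 2 * d <= 1 - c by rewrite /d mulrC divfK.
(* The exponents of [wgt (- 2^-1) 2^-1] multiplied by W^(-1/2), the pointwise bound of R_n. *)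
pose d1 := - 2^-1 - s / 2; pose d2 := 2^-1 - t / 2.
have dps : d1 * p + s = - 2^-1.
  have -> : d1 * p = - ((1 + s) * p) / 2 by rewrite /d1; field.
  by rewrite sp; field.
pose h := acos (1 - 2 * d) - acos (1 - d).
have h0 : 0 < h.
  rewrite subr_gt0; have /andP[_ hc1] := c01.
  have [] // := @acos_itv _ _ _ _ c01 hc (1 - 2 * d) (1 - d); lra.
pose v := N (\1_(shell d)) `^ (1 - p^-1).
pose K := Num.sqrt C + 1.
have K0 : 0 < K by rewrite ltr_wpDl ?sqrtr_ge0.
exists (cst * (c0 * (2^-1 * (2^-1))) * (cst * (c0 * (2^-1 * (2^-1 * h))))),
  (2 * (weak_factor * (K * far_cst d2 `^ p^-1) * shell_sup alpha beta C d * v)); split.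
  by rewrite !mulr_gt0// invr_gt0.
move=> L L0; have [h1 h2 h3 _ aA] := far_itv L0.
pose f j n := phi q (far_y1 L) far_y2 (wgt (- 2^-1) 2^-1) j n.
have bf j n : bmeas X (f j n).
  by apply: bmeas_phi; [exact: measurable_wgt|apply: within_wgt => //; exact: ltW].
have fl := lim2_phi a1 M0 oP q0 qa qC qI h1 (ltW h2) h3 (measurable_wgt (- 2^-1) 2^-1)
  (@within_wgt _ (- 2^-1) 2^-1 _ _ h1 (ltW h2) h3) aA.
rewrite (Ipi_far L0) in fl.
have gl := lim2_bump d0 dc; rewrite -/h in gl.
pose lf := cst * (c0 * (2^-1 * L)); pose lg := cst * (c0 * (2^-1 * h)).
have lf0 : 0 < lf / 2 by rewrite divr_gt0// !mulr_gt0.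
have lg0 : 0 < lg / 2 by rewrite divr_gt0// !mulr_gt0.
have n0 : ev2 (fun j n => (0 < n)%N) by apply: ev2_near; exists 1%N.
have [j [n [[fn gn] [qn n1]]]] := ev2_ex (ev2_and (ev2_and (fl _ lf0) (gl _ lg0))
  (ev2_and (ev2_size q) n0)).
case: n n1 fn gn qn => // m _ fn gn qn.
have fK x : X x -> `|f j m.+1 x| <= \1_`[cos far_y2, cos (far_y1 L)] x * (K * wgt d1 d2 x).
  move=> _; rewrite (le_trans (phi_bound qC (- 2^-1) 2^-1 qn _))//; first exact: far_in.
  by apply: ler_wpM2l => //; apply: ler_wpM2r; [exact: wgt_ge0|rewrite lerDl].
have gB x : X x -> `|bump d j m.+1 x| <= shell_sup alpha beta C d * \1_(shell d) x.
  by move=> _; exact: bump_bound.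
have mB : measurable (shell d) by exact: measurable_itv.
have wk l := far_weak L0 l K0 (shell_sup_ge0 alpha beta C d) dps (bf j m.+1) fK
  (bmeas_bump d0 dc j m.+1) mB gB (nu_shell_gt0 oP s0 c01 hc d0 dc).
have := nu_Sn_diff a1 M0 oP m (bf j m.+1) (bmeas_bump d0 dc j m.+1).
have := wk m.+1; have := wk m.
move: (N (fun x => S m _ x * _)) (N (fun x => S m.+1 _ x * _)) => u1 u2.
have : `|fcoef alpha beta a M P m.+1 (f j m.+1) - lf| <= lf / 2 by exact: fn.
have : `|fcoef alpha beta a M P m.+1 (bump d j m.+1) - lg| <= lg / 2 by exact: gn.
move: (fcoef _ _ _ _ _ _ (f j m.+1)) (fcoef _ _ _ _ _ _ _) => x y.
rewrite !ler_distl => /andP[yl _] /andP[xl _] w1 w2 e.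
(* Both coefficients are at least half their limits, and the first limit is proportional to L. *)
have xy : lf / 2 * (lg / 2) <= x * y by apply: ler_pM; [exact: ltW|exact: ltW|lra|lra].
have w : x * y <= `|u2| + `|u1|.
  by rewrite -e (le_trans (ler_norm _))// ler_normB.
rewrite (_ : _ * L = lf / 2 * (lg / 2)); last by rewrite /lf /lg; field.
rewrite (le_trans xy)// (le_trans w)// (le_trans (lerD w2 w1))//.
by rewrite le_eqVlt; apply/orP; left; apply/eqP; rewrite /weak_factor /v; ring.
Qed.

End Cases.

(** The main product -x1 y0 is at least u v / 4 and the other at most u v / 8 in absolute value;
    what is left is multiplied by r >= 1/8. *)
Lemma commutator_lower {R : realType} (u v e K x0 x1 y0 y1 r : R) :
  0 < u -> 0 < v -> e * K <= u * v / 8 ->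
  `|x0| <= e -> `|x1 + u| <= u / 2 -> `|y0 - v| <= v / 2 -> `|y1| <= K -> 8^-1 <= r ->
  u * v / 64 <= r * (x0 * y1 - x1 * y0).
Proof.
move=> u0 v0 eK x0e; rewrite [`|x1 + u| <= _]ler_norml [`|y0 - v| <= _]ler_norml => /andP[_ x1u] /andP[y0v _] y1K r8.
have h1 : `|x0 * y1| <= u * v / 8.
  by rewrite (le_trans _ eK)// normrM ler_pM.
have h2 : u / 2 * (v / 2) <= - x1 * y0 by apply: ler_pM; lra.
have uv : 0 < u * v by rewrite mulr_gt0.
have h3 : u * v / 8 <= x0 * y1 - x1 * y0.
  by move: h1; rewrite ler_norml => /andP[h1 _]; lra.
have -> : u * v / 64 = 8^-1 * (u * v / 8) by field.
by apply: ler_pM => //; lra.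
Qed.

(** * The upper critical exponent *)

Section UpperEndpoint.
Context {R : realType}.
Notation D := `[0, (pi : R)]%classic.
Notation X := `[-1, (1 : R)]%classic.
Context (alpha beta : R) (k : nat) (a M : 'I_k -> R) (P : nat -> {poly R}).
Context (a1 : forall i, -1 <= a i <= 1) (M0 : forall i, 0 < M i).
Context (oP : orthonormal_family alpha beta a M P).
Notation s := (alpha + 1 / 2).
Notation t := (beta + 1 / 2).
Notation N := (nuR alpha beta a M).
Notation S := (Sn alpha beta a M P).
Notation c0 := (c0 alpha beta).
Notation cst := (cst alpha beta).
Context (s0 : 0 < s).
Let ij := integrable_jweight oP.
Let pN : posfun X N := posfun_nu a1 M0 ij.
Context (q : nat -> {poly R}) (q0 : forall j, (q j)`_0 = 1)
  (qa : forall j i, nsq (circ (q j) (acos (a i))) = 0)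
  (C : R) (qC : forall j y, nsq (circ (q j) y) * wgt s t (cos y) <= C)
  (qI : forall g, bmeas D g ->
      Ipi (fun y => g y * (nsq (circ (q j) y) * wgt s t (cos y))) @[j --> \oo] --> Ipi g).
Context (c : R) (c01 : 0 < c < 1) (hc : forall i, a i < 1 -> a i < c).
Context (p C0 : R) (p1 : 1 < p) (hC : forall (n : nat) (f : R -> R), in_Lp alpha beta a M p f ->
   (weak_Lp_norm alpha beta a M p (S n f) <= C0%:E * Lp_norm alpha beta a M p f)%E).

Let c00 : 0 < c0 := c0_gt0 alpha beta.
Let cst0 : 0 < cst := cst_gt0 alpha beta.

(** The ratio is kap (n+1) / (2 kap n), and [kap_bounds] confines numerator and denominator. *)
Lemma lead_ratio_ge : \forall n \near \oo, 8^-1 <= lead P n / lead P n.+1.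
Proof.
have [n0 _ hn] := kap_bounds a1 M0 oP q0 qa qC qI.
exists n0 => // n nn; have /andP[_ k4] := hn n nn; have /andP[k1 _] := hn n.+1 (leqW nn).
have l0 := lead_gt0 oP n; have l1 := lead_gt0 oP n.+1.
move: k1 k4; rewrite /kap exprS.
have e0 : 0 < 2 ^+ n :> R by rewrite exprn_gt0.
move: cst0 e0; move: cst (2 ^+ n) (lead P n) (lead P n.+1) l0 l1 => z e x y x0 y0 z0 e0.
rewrite [z * (_ / y)]mulrA [z * (_ / x)]mulrA ler_pdivlMr// ler_pdivrMr// => h1 h2.
rewrite ler_pdivlMr//; lra.
Qed.

(* The equation says [p = 4 (alpha + 1) / (2 alpha + 1)]. *)
Lemma case_plus : s * p = 2 * s + 1 ->
  exists D E, 0 < D /\ forall L, 0 < L -> D * L <= E * L `^ p^-1.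
Proof.
move=> sp; pose e2 := - (t / 2).
have dps : - (s / 2) * p + s = - 2^-1.
  have -> : - (s / 2) * p = - (s * p) / 2 by field.
  by rewrite sp; field.
have sp' : s * p = 2 * (alpha + 1) by rewrite sp; field.
pose K := Num.sqrt C + 1.
have K0 : 0 < K by rewrite ltr_wpDl ?sqrtr_ge0.
pose K3 := Num.sqrt C * 2 `^ (- (s / 2)) * 4 `^ `|t / 2| * shell_cst alpha beta `^ (1 - p^-1).
(* A lower bound for lf lg / 64, divided by L d^(1/2), where lf = cst c0 L / 8 and lg >= cst c0
   d^(1/2) / 4. *)
exists (cst * c0 / 32 * (cst * c0 / 64)),
  (2 * (weak_factor p C0 * (K * far_cst alpha beta p e2 `^ p^-1) * K3)); split.
  by rewrite mulr_gt0// divr_gt0// mulr_gt0.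
move=> L L0; have [h1 h2 h3 _ aA] := far_itv c01 hc L0.
(* The shell starts where the support [c, 1 - 2d] of f ends, so it shrinks as L grows; both sides of
   the final estimate carry d^(1/2), which cancels. *)
pose d := gap c L; have d0 : 0 < d := gap_gt0 c01 L; have dc : 2 * d <= 1 - c := ltW (gap_lt c01 L0).
pose h := acos (1 - 2 * d) - acos (1 - d).
have hh : Num.sqrt d / 2 <= h.
  have d2 : d < 2^-1 by have /andP[hc0 _] := c01; lra.
  by have /andP[] := acos_diff d0 d2.
have sd0 : 0 < Num.sqrt d by rewrite sqrtr_gt0.
(* [psi] carries a factor sin y, so the exponent -3/2 makes (1 - x) f of critical size W^(-1/2),
   while f itself pairs with P_(n+1) to order L. *)
pose f j n := psi q (far_y1 c L) (far_y2 c) (wgt (- (3 / 2)) (- 2^-1)) j n.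
have bf j n : bmeas X (f j n).
  by apply: bmeas_psi; [exact: measurable_wgt|apply: within_wgt => //; exact: ltW].
have m3 : measurable_fun setT (wgt (- (3 / 2)) (- 2^-1) : R -> R) by exact: measurable_wgt.
have w3 := @within_wgt _ (- (3 / 2)) (- 2^-1) _ _ h1 (ltW h2) h3.
have fl0 := lim2_psi0 a1 M0 oP q0 qa qC qI h1 (ltW h2) h3 m3 w3 aA.
have fl1 := lim2_psi1 a1 M0 oP q0 qa qC qI h1 (ltW h2) h3 m3 w3 aA.
rewrite (Ipi_far_sin c01 hc L0) in fl1.
have gl := lim2_bump a1 M0 oP q0 qa qC qI c01 hc d0 dc; rewrite -/h in gl.
have [Kb hKb] := bump_coef_bounded a1 M0 oP qC c01 hc d0 dc.
pose lf := cst * (c0 * (2^-1 * (L / 4))); pose lg := cst * (c0 * (2^-1 * h)).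
have h0 : 0 < h by lra.
have lf0 : 0 < lf / 2 by rewrite divr_gt0// !mulr_gt0// divr_gt0.
have lg0 : 0 < lg / 2 by rewrite divr_gt0// !mulr_gt0.
(* The tolerance for <f, P_n>, chosen after [Kb], so that its product with the bounded coefficient
   of g is at most lf lg / 8. *)
pose e := lf * lg / 8 / (`|Kb| + 1).
have lf1 : 0 < lf by lra.
have lg1 : 0 < lg by lra.
have e0 : 0 < e by rewrite divr_gt0 ?ltr_wpDl// divr_gt0// mulr_gt0.
have [j [n [[[fn0 fn1] [gn gb]] [qn kn]]]] := ev2_ex (ev2_and
  (ev2_and (ev2_and (fl0 _ e0) (fl1 _ lf0)) (ev2_and (gl _ lg0) hKb))
  (ev2_and (ev2_size q) (ev2_near lead_ratio_ge))).
pose g := bump q d j n; have bg : bmeas X g := bmeas_bump q c01 hc d0 dc j n.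
pose F x := (1 - x) * f j n x; pose Xg x := (1 - x) * g x.
have b1x (u : R -> R) : bmeas X u -> bmeas X (fun x => (1 - x) * u x).
  move=> bu; have := bmeasB bu (bmeasX_mul bu); congr bmeas.
  by apply/funext => x; ring.
have bF : bmeas X F := b1x _ (bf j n).
have bXg : bmeas X Xg := b1x _ bg.
have comm := nu_Sn_commutator a1 M0 oP n (bf j n) bg.
have mB : measurable (shell d) by exact: measurable_itv.
have gB x : X x -> `|g x| <= shell_sup alpha beta C d * \1_(shell d) x.
  by move=> _; exact: (bump_bound s0 qC c01 hc d0 dc).
have XgB x : X x -> `|Xg x| <= 2 * d * shell_sup alpha beta C d * \1_(shell d) x.
  by move=> _; exact: (bumpM_bound s0 qC c01 hc d0 dc).
have FK x : X x -> `|F x| <= \1_`[cos (far_y2 c), cos (far_y1 c L)] x * (K * wgt (- (s / 2)) e2 x).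
  move=> _; rewrite /F normrM.
  have := psi_bound qC (- (3 / 2)) (- 2^-1) qn (@far_in _ _ _ _ c01 hc _ L0 x).
  rewrite -/(f j n x) indicE; move: (f j n x) => z.
  case: (boolP (x \in _)) => [|_]; last by rewrite !mul0r normr_le0 => /eqP ->; rewrite normr0 mulr0.
  rewrite inE => Ax; have /andP[xa xb] := far_in c01 hc L0 Ax.
  rewrite [X in _ <= X]mul1r [X in _ -> _ <= X]mul1r => zl.
  have x1 : `|1 - x| = 2^-1 * wgt 1 0 x.
    by rewrite /wgt powRr1 ?powRr0 ?ger0_norm; lra.
  rewrite x1 (le_trans (ler_wpM2l _ zl))//; first by rewrite mulr_ge0 ?wgt_ge0.
  have -> : 2^-1 * wgt 1 0 x * (Num.sqrt C / 2 *
      wgt (- (3 / 2) + 2^-1 - s / 2) (- 2^-1 + 2^-1 - t / 2) x) =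
      Num.sqrt C / 4 * wgt (- (s / 2)) e2 x.
    rewrite (_ : wgt (- (s / 2)) e2 x = wgt 1 0 x *
      wgt (- (3 / 2) + 2^-1 - s / 2) (- 2^-1 + 2^-1 - t / 2) x).
      by move: (wgt _ _ _) (wgt _ _ _) (Num.sqrt _) => u1 u2 u3; field.
    by rewrite wgtD ?xa//; congr wgt; rewrite /e2; field.
  by rewrite ler_wpM2r ?wgt_ge0// /K; have := sqrtr_ge0 C; lra.
(* On the support of f one has 1 - x >= 2d, so removing the factor 1 - x from F costs 1/(2d). The
   bound 2d G for (1 - x) g compensates this exactly. *)
have fK x : X x -> `|f j n x| <=
    \1_`[cos (far_y2 c), cos (far_y1 c L)] x * (K / (2 * d) * wgt (- (s / 2)) e2 x).
  move=> Xx; case: (boolP (x \in `[cos (far_y2 c), cos (far_y1 c L)]%classic)) => [|nA]; last first.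
    by rewrite {1}/f /psi !indicE (negbTE nA) !mul0r normr0.
  have := FK x Xx; rewrite /F normrM; move: (f j n x) => z + xA; rewrite indicE xA.
  move: xA; rewrite inE => /(far_cos c01 hc L0)/andP[_ xd].
  rewrite [X in _ <= X]mul1r [X in _ -> _ <= X]mul1r => zl.
  have dd0 : 0 < 2 * d by rewrite mulr_gt0.
  rewrite mulrAC ler_pdivlMr//; apply: le_trans zl.
  have xd' : 2 * d <= 1 - x by rewrite /d; lra.
  by rewrite mulrC ler_wpM2r// (le_trans xd')// ler_norm.
have v0 := nu_shell_gt0 oP s0 c01 hc d0 dc.
have Kd0 : 0 < K / (2 * d) by rewrite divr_gt0// mulr_gt0.
have dG : 0 <= 2 * d * shell_sup alpha beta C d by rewrite mulr_ge0 ?shell_sup_ge0// mulr_ge0// ltW.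
have w1 := far_weak a1 M0 oP c01 hc p1 hC L0 n K0 (shell_sup_ge0 alpha beta C d) dps bF FK bg mB gB v0.
have w2 := far_weak a1 M0 oP c01 hc p1 hC L0 n Kd0 dG dps (bf j n) fK bXg mB XgB v0.
have gv := shell_sup_nu_le oP s0 C c01 hc p1 sp' d0 dc.
(* Replacing x by 1 - x in the commutator only changes its sign, because the constant 1 commutes
   with [S n]; the order of the two terms absorbs the sign. *)
have {}comm : N (fun x => S n F x * g x) - N (fun x => S n (f j n) x * Xg x) =
  lead P n / lead P n.+1 *
  (fcoef alpha beta a M P n (f j n) * fcoef alpha beta a M P n.+1 g -
   fcoef alpha beta a M P n.+1 (f j n) * fcoef alpha beta a M P n g).
  have E1 : N (fun x => S n F x * g x) = N (fun x => S n (f j n) x * g x) -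
      N (fun x => S n (fun y => y * f j n y) x * g x).
    have bx := bmeasX_mul (bf j n).
    rewrite !(nu_Sn a1 M0 oP)// -sumrB; apply: eq_bigr => i _; rewrite -mulrBl; congr (_ * _).
    have bi h' : bmeas X h' -> bmeas X (fun x => (P i).[x] * h' x).
      by move=> bh; apply: bmeasM => //; exact: bmeas_hornerX.
    rewrite /fcoef -(posfunB pN (bi _ (bf j n)) (bi _ bx)); congr nuR.
    by apply/funext => x; rewrite /F; ring.
  have E2 : N (fun x => S n (f j n) x * Xg x) = N (fun x => S n (f j n) x * g x) -
      N (fun x => S n (f j n) x * (x * g x)).
    have bS := bmeas_Sn a1 M0 oP n (bf j n).
    rewrite -(posfunB pN (bmeasM bS bg) (bmeasM bS (bmeasX_mul bg))); congr nuR.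
    by apply/funext => x; rewrite /Xg; ring.
  by rewrite E1 E2 -comm; ring.
have fx0 : `|fcoef alpha beta a M P n (f j n)| <= e by have := fn0; rewrite subr0.
have fx1 : `|fcoef alpha beta a M P n.+1 (f j n) + lf| <= lf / 2.
  by have := fn1; rewrite /= !mulrN opprK.
have eK : e * `|Kb| <= lf * lg / 8.
  rewrite /e mulrAC ler_pdivrMr ?ltr_wpDl// ler_wpM2l ?lerDl// ltW// divr_gt0// mulr_gt0//.
have low := commutator_lower lf1 lg1 eK fx0 fx1 gn (le_trans gb (ler_norm _)) kn.
rewrite -comm in low.
move: w1 w2 low gv; rewrite -/K3.
move: (N (fun x => S n F x * _)) (N (fun x => S n _ x * Xg x)) => u1 u2.
move: (shell_sup alpha beta C d) (N _ `^ _) => G v w1 w2 low gv.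
rewrite -(ler_pM2r sd0).
have lo : cst * c0 / 32 * (cst * c0 / 64) * L * Num.sqrt d <= lf * lg / 64.
  have -> : cst * c0 / 32 * (cst * c0 / 64) * L * Num.sqrt d =
    lf * (cst * (c0 * (2^-1 * (Num.sqrt d / 2)))) / 64 by rewrite /lf; field.
  apply: ler_wpM2r; first by rewrite invr_ge0.
  apply: ler_wpM2l; first exact: ltW.
  rewrite /lg; apply: ler_wpM2l; first exact: ltW.
  by apply: ler_wpM2l; [exact: ltW|apply: ler_wpM2l].
have up : u1 - u2 <= `|u1| + `|u2| by rewrite (le_trans (ler_norm _))// ler_normB.
rewrite (le_trans lo)// (le_trans low)// (le_trans up)// (le_trans (lerD w1 w2))//.
have -> : weak_cst p * ((`|C0| + 1) * (K * (far_cst alpha beta p e2 `^ p^-1 * L `^ p^-1))) * G * v +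
  weak_cst p * ((`|C0| + 1) * (K / (2 * d) * (far_cst alpha beta p e2 `^ p^-1 * L `^ p^-1))) *
    (2 * d * G) * v =
  2 * (weak_factor p C0 * (K * far_cst alpha beta p e2 `^ p^-1)) * L `^ p^-1 * (G * v).
  rewrite /weak_factor; move: (weak_cst p) (far_cst _ _ _ _ `^ _) (L `^ _) => v1 v2 v3.
  by field; rewrite lt0r_neq0.
rewrite (_ : 2 * (_ * K3) * _ * _ =
  2 * (weak_factor p C0 * (K * far_cst alpha beta p e2 `^ p^-1)) * L `^ p^-1 * (K3 * Num.sqrt d)); last first.
  by move: (Num.sqrt d) => sd; ring.
apply: ler_wpM2l => //; apply: mulr_ge0; last exact: powR_ge0.
apply: mulr_ge0 => //; apply: mulr_ge0; last by apply: mulr_ge0; [exact: ltW|exact: powR_ge0].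
rewrite /weak_factor; apply: mulr_ge0; last by rewrite addr_ge0.
rewrite /weak_cst addr_ge0// invr_ge0 subr_ge0.
have h12 : 1 <= 2 :> R by lra.
by have := ler_powR h12 (_ : 1 - p <= 0); rewrite powRr0; apply; have := p1; lra.
Qed.

End UpperEndpoint.

(** The midpoint between 1 and the larger of 0 and the mass points below 1. *)
Lemma point_below_one {R : realType} (k : nat) (a : 'I_k -> R) :
  exists2 c, 0 < c < 1 & forall i, a i < 1 -> a i < c.
Proof.
pose m := \big[Num.max/0]_(i | a i < 1) a i.
have m0 : 0 <= m by exact: bigmax_ge_id.
have m1 : m < 1 by apply: bigmax_lt => //; exact: ltr01.
exists ((m + 1) / 2); first by apply/andP; split; lra.
move=> i ai; have : a i <= m by exact: le_bigmax_cond.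
by move=> h; lra.
Qed.

Theorem theorem13 (R : realType) (alpha beta : R) (k : nat)
    (a M : 'I_k -> R) (P : nat -> {poly R}) (p : R) :
  -(1/2) < alpha -> beta <= alpha -> -1 < beta ->
  injective a ->
  (forall i, -1 <= a i <= 1) ->
  (forall i, 0 < M i) ->
  orthonormal_family alpha beta a M P ->
  (p = 4 * (alpha + 1) / (2 * alpha + 1) \/
   p = 4 * (alpha + 1) / (2 * alpha + 3)) ->
  ~ (exists C : R, forall (n : nat) (f : R -> R),
       in_Lp alpha beta a M p f ->
       (weak_Lp_norm alpha beta a M p (Sn alpha beta a M P n f)
        <= C%:E * Lp_norm alpha beta a M p f)%E).
Proof.
move=> al ba be _ a1 M0 oP pE [C0 hC].
have s0 : 0 < alpha + 1 / 2 by lra.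
have t1 : -1 < beta + 1 / 2 by lra.
have [q [q0 qa [C qC] qI]] := szego_upper s0 t1 a1.
have [c c01 hc] := point_below_one a.
have d3 : 0 < 2 * alpha + 3 by lra.
have d1 : 0 < 2 * alpha + 1 by lra.
have p1 : 1 < p.
  by case: pE => ->; rewrite ltr_pdivlMr//; lra.
have [K [E [K0 h]]] : exists K E, 0 < K /\ forall L, 0 < L -> K * L <= E * L `^ p^-1.
  case: pE => pE.
    apply: (case_plus a1 M0 oP s0 q0 qa qC qI c01 hc p1 hC).
    by rewrite pE; field; rewrite lt0r_neq0.
  apply: (case_minus a1 M0 oP s0 q0 qa qC qI c01 hc p1 hC).
  by rewrite pE; field; rewrite lt0r_neq0.
exact: root_growth_absurd p1 K0 h.
Qed.
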